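(* Let $\bar{\mathcal{A}}$ be a semi-simple rigid $K$-category of homological origin. Then any $\bar M\in\bar{\mathcal{A}}$ is Schur-finite; in particular, $\bar{\mathcal{A}}$ is geometrically of integral type.
   Context: $K$ is a field of characteristic $0$. A rigid $K$-category is an additive $K$-linear symmetric monoidal category with $K$-bilinear tensor product, in which every object has a dual, and such that $\operatorname{End}(\mathbf{1})=K$; it is not assumed abelian or pseudo-abelian. $\operatorname{tr}(f)\in K$ denotes the categorical trace of an endomorphism. A rigid $K$-category is semi-simple if all rings $\operatorname{End}(M)$ are semi-simple; they are then finite-dimensional semi-simple $K$-algebras. A rigid $K$-category $\mathcal{A}$ is of homological type if there exist an extension $L$ of $K$ and a ($K$-linear symmetric monoidal) tensor functor $H:\mathcal{A}\to\operatorname{Vec}_L^{\pm}$ (a realisation), where $\operatorname{Vec}_L^\pm$ is the tensor category of $\mathbf{Z}/2$-graded finite-dimensional $L$-vector spaces with the Koszul rule for the commutativity constraint; no exactness or faithfulness is required. $\mathcal{N}=\mathcal{N}(\mathcal{A})$ is the ideal of morphisms universally of trace $0$: $\mathcal{N}(M,N)=\{f:M\to N\mid\operatorname{tr}(gf)=0\ \forall g:N\to M\}$. A semi-simple rigid $K$-category $\bar{\mathcal{A}}$ is of homological origin if it is $\otimes$-equivalent to $\mathcal{A}/\mathcal{N}$ for some rigid $K$-category $\mathcal{A}$ of homological type. An object $M$ is Schur-finite if $\mathbb{S}(M)=0$ (computed in the idempotent completion) for some nonzero Schur functor $\mathbb{S}$. For a finite-dimensional simple $K$-algebra $A$, $\operatorname{Trd}_A=\operatorname{Tr}_{Z(A)/K}\circ\operatorname{Trd}_{A/Z(A)}$;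 for $A=\prod A_i$ semi-simple, $\operatorname{Trd}_A=\sum_i\operatorname{Trd}_{A_i}$. For $M$ in a semi-simple rigid $K$-category, with $\operatorname{End}(M)=\prod_iA_i$ and corresponding central idempotents $e_i$, there is a unique $\mu(M)\in\operatorname{End}(M)$ with $\operatorname{tr}(f)=\operatorname{Trd}_{\operatorname{End}(M)}(\mu(M)f)$ for all $f$; it is central and invertible and $\mu(M)=\sum_i\mu_i(M)e_i$ with $\mu_i(M)\in Z(A_i)$. $M$ is of integral type if all $\mu_i(M)\in\mathbf{Z}$, and geometrically of integral type if its image in $\bar{\mathcal{A}}\otimes_K\bar K$ (same objects, Homs tensored with an algebraic closure $\bar K$ of $K$) is of integral type. The category is geometrically of integral type if all its objects are. *)

(* Defs.v *)
From HB Require Import structures.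
From mathcomp Require Import all_boot all_order all_algebra all_fingroup all_field.
From mathcomp Require Import boolp.

Set Implicit Arguments.
Unset Strict Implicit.
Unset Printing Implicit Defensive.

Import GRing.Theory.
Local Open Scope ring_scope.

Declare Scope cat_scope.
Delimit Scope cat_scope with cat.
Local Open Scope cat_scope.

Reserved Notation "g ∘ f" (at level 40, left associativity).
Reserved Notation "X ⊗ Y" (at level 35, right associativity).
Reserved Notation "f ⊠ g" (at level 35, right associativity).

Record linCat (K : fieldType) := LinCat {
  obj :> Type;
  hom : obj -> obj -> lmodType K;
  idc : forall X, hom X X;
  comp : forall X Y Z, hom Y Z -> hom X Y -> hom X Z;
  compA : forall X Y Z W (h : hom Z W) (g : hom Y Z) (f : hom X Y),
    comp h (comp g f) = comp (comp h g) f;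
  comp1f : forall X Y (f : hom X Y), comp (idc Y) f = f;
  compf1 : forall X Y (f : hom X Y), comp f (idc X) = f;
  comp_linear_l : forall X Y Z (f : hom X Y),
    linear (fun g : hom Y Z => comp g f);
  comp_linear_r : forall X Y Z (g : hom Y Z),
    linear (fun f : hom X Y => comp g f) }.

Arguments idc {K l} X.
Arguments comp {K l X Y Z} g f.
Notation "g ∘ f" := (comp g f) : cat_scope.

Definition is_zero (K : fieldType) (A : linCat K) (Z : A) : Prop :=
  forall X : A, (forall f : hom Z X, f = 0) /\ (forall f : hom X Z, f = 0).

Definition is_biproduct (K : fieldType) (A : linCat K) (X Y S : A) : Prop :=
  exists (i : hom X S) (j : hom Y S) (p : hom S X) (q : hom S Y),
    [/\ p ∘ i = idc X, q ∘ j = idc Y, p ∘ j = 0, q ∘ i = 0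
      & i ∘ p + j ∘ q = idc S].

Definition additive_cat (K : fieldType) (A : linCat K) : Prop :=
  (exists Z : A, is_zero Z) /\
  (forall X Y : A, exists S : A, is_biproduct X Y S).

(* The primed isomorphisms are the inverses of the unprimed ones. *)
Record symCat (K : fieldType) := SymCat {
  lin_of :> linCat K;
  unit : lin_of;
  tens : lin_of -> lin_of -> lin_of;
  tensh : forall X X' Y Y' : lin_of,
    hom X X' -> hom Y Y' -> hom (tens X Y) (tens X' Y');
  assoc : forall X Y Z, hom (tens (tens X Y) Z) (tens X (tens Y Z));
  assoc' : forall X Y Z, hom (tens X (tens Y Z)) (tens (tens X Y) Z);
  lunit : forall X, hom (tens unit X) X;
  lunit' : forall X, hom X (tens unit X);
  runit : forall X, hom (tens X unit) X;
  runit' : forall X, hom X (tens X unit);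
  symm : forall X Y, hom (tens X Y) (tens Y X);
  tensh1 : forall X Y, tensh (idc X) (idc Y) = idc (tens X Y);
  tensh_comp : forall X X' X'' Y Y' Y'' (f' : hom X' X'') (f : hom X X')
    (g' : hom Y' Y'') (g : hom Y Y'),
    tensh (f' ∘ f) (g' ∘ g) = tensh f' g' ∘ tensh f g;
  tensh_linear_l : forall X X' Y Y' (g : hom Y Y'),
    linear (fun f : hom X X' => tensh f g);
  tensh_linear_r : forall X X' Y Y' (f : hom X X'),
    linear (fun g : hom Y Y' => tensh f g);
  assocK : forall X Y Z, assoc' X Y Z ∘ assoc X Y Z = idc _;
  assocK' : forall X Y Z, assoc X Y Z ∘ assoc' X Y Z = idc _;
  lunitK : forall X, lunit' X ∘ lunit X = idc _;
  lunitK' : forall X, lunit X ∘ lunit' X = idc _;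
  runitK : forall X, runit' X ∘ runit X = idc _;
  runitK' : forall X, runit X ∘ runit' X = idc _;
  symmK : forall X Y, symm Y X ∘ symm X Y = idc _;
  assoc_nat : forall X X' Y Y' Z Z' (f : hom X X') (g : hom Y Y')
    (h : hom Z Z'),
    assoc X' Y' Z' ∘ tensh (tensh f g) h =
    tensh f (tensh g h) ∘ assoc X Y Z;
  lunit_nat : forall X X' (f : hom X X'),
    lunit X' ∘ tensh (idc unit) f = f ∘ lunit X;
  runit_nat : forall X X' (f : hom X X'),
    runit X' ∘ tensh f (idc unit) = f ∘ runit X;
  symm_nat : forall X X' Y Y' (f : hom X X') (g : hom Y Y'),
    symm X' Y' ∘ tensh f g = tensh g f ∘ symm X Y;
  pentagon : forall W X Y Z,
    assoc W X (tens Y Z) ∘ assoc (tens W X) Y Z =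
    tensh (idc W) (assoc X Y Z) ∘ assoc W (tens X Y) Z
      ∘ tensh (assoc W X Y) (idc Z);
  triangle : forall X Y,
    tensh (idc X) (lunit Y) ∘ assoc X unit Y = tensh (runit X) (idc Y);
  hexagon : forall X Y Z,
    assoc Y Z X ∘ symm X (tens Y Z) ∘ assoc X Y Z =
    tensh (idc Y) (symm X Z) ∘ assoc Y X Z ∘ tensh (symm X Y) (idc Z);
  lunit_symm : forall X, lunit X ∘ symm X unit = runit X;
  lunit_unit : lunit unit = runit unit }.

Arguments unit {K s}.
Arguments tens {K s} X Y.
Arguments tensh {K s X X' Y Y'} f g.
Arguments assoc {K s} X Y Z.
Arguments assoc' {K s} X Y Z.
Arguments lunit {K s} X.
Arguments lunit' {K s} X.
Arguments runit {K s} X.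
Arguments runit' {K s} X.
Arguments symm {K s} X Y.
Notation "X ⊗ Y" := (tens X Y) : cat_scope.
Notation "f ⊠ g" := (tensh f g) : cat_scope.

Record rigidCat (K : fieldType) := RigidCat {
  sym_of :> symCat K;
  additiveP : additive_cat sym_of;
  unit_id_neq0 : idc (unit : sym_of) != 0;
  unit_scalar : forall f : hom (unit : sym_of) unit,
    exists a : K, f == a *: idc unit;
  dual : sym_of -> sym_of;
  ev : forall X, hom (dual X ⊗ X) unit;
  coev : forall X, hom unit (X ⊗ dual X);
  zigzag_l : forall X,
    runit X ∘ (idc X ⊠ ev X) ∘ assoc X (dual X) X ∘ (coev X ⊠ idc X)
      ∘ lunit' X = idc X;
  zigzag_r : forall X,
    lunit (dual X) ∘ (ev X ⊠ idc (dual X)) ∘ assoc' (dual X) X (dual X)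
      ∘ (idc (dual X) ⊠ coev X) ∘ runit' (dual X) = idc (dual X) }.

Arguments dual {K r} X.
Arguments ev {K r} X.
Arguments coev {K r} X.

Section Trace.
Variables (K : fieldType) (A : rigidCat K).

(* the identification End(1) = K *)
Definition unit_coef (f : hom (unit : A) unit) : K := xchoose (unit_scalar f).

Definition tr (X : A) (f : hom X X) : K :=
  unit_coef (ev X ∘ symm X (dual X) ∘ (f ⊠ idc (dual X)) ∘ coev X).

Definition Nideal (X Y : A) (f : hom X Y) : Prop :=
  forall g : hom Y X, tr (g ∘ f) = 0.

End Trace.

Section Coherence.
Variables (K : fieldType).

Section Lin.
Variable A : linCat K.
Implicit Types X Y Z W : A.

Lemma compDl X Y Z (g g' : hom Y Z) (f : hom X Y) :
  (g + g') ∘ f = g ∘ f + g' ∘ f.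
Proof. by have /= := comp_linear_l f 1 g g'; rewrite !scale1r. Qed.
Lemma compDr X Y Z (g : hom Y Z) (f f' : hom X Y) :
  g ∘ (f + f') = g ∘ f + g ∘ f'.
Proof. by have /= := comp_linear_r g 1 f f'; rewrite !scale1r. Qed.
Lemma comp0f X Y Z (f : hom X Y) : (0 : hom Y Z) ∘ f = 0.
Proof. by apply: (addrI (0 ∘ f)); rewrite -compDl !addr0. Qed.
Lemma compf0 X Y Z (g : hom Y Z) : g ∘ (0 : hom X Y) = 0.
Proof. by apply: (addrI (g ∘ 0)); rewrite -compDr !addr0. Qed.
Lemma compZl X Y Z a (g : hom Y Z) (f : hom X Y) :
  (a *: g) ∘ f = a *: (g ∘ f).
Proof. by have /= := comp_linear_l f a g 0; rewrite comp0f !addr0. Qed.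
Lemma compZr X Y Z a (g : hom Y Z) (f : hom X Y) :
  g ∘ (a *: f) = a *: (g ∘ f).
Proof. by have /= := comp_linear_r g a f 0; rewrite compf0 !addr0. Qed.

Lemma iso_cancelr X Y Z (i : hom X Y) (j : hom Y X) (f g : hom Y Z) :
  i ∘ j = idc Y -> f ∘ i = g ∘ i -> f = g.
Proof. by move=> ij e; rewrite -[f]compf1 -[g]compf1 -ij !compA e. Qed.
Lemma iso_cancell X Y Z (i : hom X Y) (j : hom Y X) (f g : hom Z X) :
  j ∘ i = idc X -> i ∘ f = i ∘ g -> f = g.
Proof. by move=> ij e; rewrite -[f]comp1f -[g]comp1f -ij -!compA e. Qed.
End Lin.

Section Sym.
Variable A : symCat K.
Implicit Types X Y Z W P : A.

Lemma tenshDl X X' Y Y' (f f' : hom X X') (g : hom Y Y') :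
  (f + f') ⊠ g = f ⊠ g + f' ⊠ g.
Proof. by have /= := tensh_linear_l g 1 f f'; rewrite !scale1r. Qed.
Lemma tenshDr X X' Y Y' (f : hom X X') (g g' : hom Y Y') :
  f ⊠ (g + g') = f ⊠ g + f ⊠ g'.
Proof. by have /= := tensh_linear_r f 1 g g'; rewrite !scale1r. Qed.
Lemma tensh_idl X Y Y' Y'' (g' : hom Y' Y'') (g : hom Y Y') :
  (idc X ⊠ g') ∘ (idc X ⊠ g) = idc X ⊠ (g' ∘ g).
Proof. by rewrite -tensh_comp comp1f. Qed.
Lemma tensh_idr X Y Y' Y'' (g' : hom Y' Y'') (g : hom Y Y') :
  (g' ⊠ idc X) ∘ (g ⊠ idc X) = (g' ∘ g) ⊠ idc X.
Proof. by rewrite -tensh_comp comp1f. Qed.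
Lemma tensh_lr X X' Y Y' (f : hom X X') (g : hom Y Y') :
  (f ⊠ idc Y') ∘ (idc X ⊠ g) = f ⊠ g.
Proof. by rewrite -tensh_comp comp1f compf1. Qed.
Lemma tensh_rl X X' Y Y' (f : hom X X') (g : hom Y Y') :
  (idc X' ⊠ g) ∘ (f ⊠ idc Y) = f ⊠ g.
Proof. by rewrite -tensh_comp comp1f compf1. Qed.

Lemma assoc'_nat X X' Y Y' Z Z' (f : hom X X') (g : hom Y Y') (h : hom Z Z') :
  assoc' X' Y' Z' ∘ (f ⊠ (g ⊠ h)) = ((f ⊠ g) ⊠ h) ∘ assoc' X Y Z.
Proof.
apply: (iso_cancell (@assocK _ _ X' Y' Z')); rewrite !compA assocK' comp1f.
by rewrite assoc_nat -compA assocK' compf1.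
Qed.
Lemma lunit'_nat X X' (f : hom X X') :
  (idc unit ⊠ f) ∘ lunit' X = lunit' X' ∘ f.
Proof.
apply: (iso_cancell (@lunitK _ _ X')); rewrite !compA lunitK' comp1f.
by rewrite lunit_nat -compA lunitK' compf1.
Qed.
Lemma runit'_nat X X' (f : hom X X') :
  (f ⊠ idc unit) ∘ runit' X = runit' X' ∘ f.
Proof.
apply: (iso_cancell (@runitK _ _ X')); rewrite !compA runitK' comp1f.
by rewrite runit_nat -compA runitK' compf1.
Qed.

Lemma tensl_inj X Y (f g : hom X Y) :
  idc unit ⊠ f = idc unit ⊠ g -> f = g.
Proof.
move=> e; apply: (iso_cancelr (@lunitK' _ _ X)).
by rewrite -!lunit_nat e.
Qed.
Lemma tensr_inj X Y (f g : hom X Y) :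
  f ⊠ idc unit = g ⊠ idc unit -> f = g.
Proof.
move=> e; apply: (iso_cancelr (@runitK' _ _ X)).
by rewrite -!runit_nat e.
Qed.

Lemma lunit_assoc X Y : lunit (X ⊗ Y) ∘ assoc unit X Y = lunit X ⊠ idc Y.
Proof.
apply: tensl_inj.
apply: (@iso_cancelr _ _ _ _ (assoc unit (unit ⊗ X) Y) (assoc' _ _ _)).
  exact: assocK'.
apply: (@iso_cancelr _ _ _ _ (assoc unit unit X ⊠ idc Y)
  (assoc' unit unit X ⊠ idc Y)).
  by rewrite tensh_idr assocK' tensh1.
rewrite -tensh_idl -!compA.
rewrite [_ ∘ (assoc unit (unit ⊗ X) Y ∘ _)]compA -pentagon compA triangle.
rewrite -(tensh1 X Y) -assoc_nat [in RHS]compA -assoc_nat -compA tensh_idr.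
by rewrite triangle.
Qed.

Lemma runit_assoc X Y : (idc X ⊠ runit Y) ∘ assoc X Y unit = runit (X ⊗ Y).
Proof.
apply: tensr_inj; rewrite -tensh_idr.
apply: (@iso_cancell _ _ _ _ (assoc X Y unit) (assoc' _ _ _)).
  exact: assocK.
rewrite compA assoc_nat -triangle -tensh_idl -!triangle -(tensh1 X Y).
rewrite [in RHS]compA assoc_nat -[RHS]compA pentagon.
by rewrite !compA.
Qed.

Lemma lunit'_assoc X Y : lunit' X ⊠ idc Y = assoc' unit X Y ∘ lunit' (X ⊗ Y).
Proof.
apply: (@iso_cancell _ _ _ _ (lunit X ⊠ idc Y) (lunit' X ⊠ idc Y)).
  by rewrite tensh_idr lunitK tensh1.
rewrite tensh_idr lunitK' tensh1 -lunit_assoc -compA.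
by rewrite (compA (assoc unit X Y)) assocK' comp1f lunitK'.
Qed.

Lemma runit'_assoc X Y : assoc X Y unit ∘ runit' (X ⊗ Y) = idc X ⊠ runit' Y.
Proof.
apply: (@iso_cancell _ _ _ _ (idc X ⊠ runit Y) (idc X ⊠ runit' Y)).
  by rewrite tensh_idl runitK tensh1.
by rewrite tensh_idl runitK' tensh1 compA runit_assoc runitK'.
Qed.

Lemma triangle' X Y : assoc X unit Y ∘ (runit' X ⊠ idc Y) = idc X ⊠ lunit' Y.
Proof.
apply: (@iso_cancell _ _ _ _ (idc X ⊠ lunit Y) (idc X ⊠ lunit' Y)).
  by rewrite tensh_idl lunitK tensh1.
by rewrite tensh_idl lunitK' tensh1 compA triangle tensh_idr runitK' tensh1.
Qed.

Lemma pentagon' W X Y Z :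
  assoc W (X ⊗ Y) Z ∘ (assoc W X Y ⊠ idc Z) ∘ assoc' (W ⊗ X) Y Z =
  (idc W ⊠ assoc' X Y Z) ∘ assoc W X (Y ⊗ Z).
Proof.
apply: (@iso_cancell _ _ _ _ (idc W ⊠ assoc X Y Z) (idc W ⊠ assoc' X Y Z)).
  by rewrite tensh_idl assocK tensh1.
rewrite 2!compA compA -pentagon -!compA assocK' compf1.
by rewrite compA tensh_idl assocK' tensh1 comp1f.
Qed.

Lemma pentagon'' W X Y Z :
  assoc (W ⊗ X) Y Z ∘ (assoc' W X Y ⊠ idc Z) =
  assoc' W X (Y ⊗ Z) ∘ (idc W ⊠ assoc X Y Z) ∘ assoc W (X ⊗ Y) Z.
Proof.
apply: (@iso_cancelr _ _ _ _ (assoc W X Y ⊠ idc Z) (assoc' W X Y ⊠ idc Z)).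
  by rewrite tensh_idr assocK' tensh1.
rewrite -compA tensh_idr assocK tensh1 compf1.
by rewrite -2!compA (compA (idc W ⊠ _)) -pentagon compA assocK comp1f.
Qed.

End Sym.
End Coherence.
Section NidealTheory.
Variables (K : fieldType) (A : rigidCat K).
Implicit Types X Y Z W P : A.

Lemma lunit'_unit : lunit' (unit : A) = runit' unit.
Proof.
apply: (iso_cancell (lunitK (unit : A))).
by rewrite lunitK' lunit_unit runitK'.
Qed.

Definition mate X P (g : hom (P ⊗ X) unit) : hom P (dual X) :=
  lunit _ ∘ (g ⊠ idc (dual X)) ∘ assoc' _ _ _ ∘ (idc P ⊠ coev X) ∘ runit' P.

Lemma ev_mate X P (g : hom (P ⊗ X) unit) : ev X ∘ (mate g ⊠ idc X) = g.
Proof.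
rewrite /mate -!tensh_idr !compA -lunit_assoc !compA -lunit_nat.
rewrite -!compA (compA (assoc _ _ _)) assoc_nat !compA tensh1.
rewrite -(compA (lunit _)) tensh_rl -tensh_lr compA lunit_unit runit_nat.
rewrite -!compA (compA (assoc _ _ _)) pentagon'' !compA.
rewrite -(tensh1 P X) -(compA _ _ (assoc' P X _)) -assoc'_nat !compA.
rewrite -(compA _ (assoc P (X ⊗ dual X) X)) assoc_nat !compA.
rewrite -(compA _ (assoc P unit X)) triangle' -!compA.
rewrite (compA (runit _)) -runit_assoc -(compA _ _ (assoc' _ _ _)) assocK'.
by rewrite compf1 !tensh_idl !compA zigzag_l tensh1 compf1.
Qed.

Definition partial_tr X P (a : hom unit (X ⊗ P)) (g : hom (P ⊗ X) unit) :
    hom X X :=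
  runit X ∘ (idc X ⊠ g) ∘ assoc X P X ∘ (a ⊠ idc X) ∘ lunit' X.

Lemma partial_tr_coev X P (a : hom unit (X ⊗ P)) (g : hom (P ⊗ X) unit) :
  (partial_tr a g ⊠ idc (dual X)) ∘ coev X = (idc X ⊠ mate g) ∘ a.
Proof.
rewrite /partial_tr -!tensh_idr lunit'_assoc -triangle.
rewrite -!compA -lunit'_nat.
rewrite (compA ((a ⊠ _) ⊠ _)) -assoc'_nat tensh1.
rewrite -!compA (compA (a ⊠ _)) tensh_lr -[a ⊠ coev X]tensh_rl.
rewrite (compA (assoc X unit _)) assoc_nat -!compA.
rewrite lunit'_unit runit'_nat (compA (assoc X (P ⊗ X) _)).
rewrite (compA (_ ∘ _) (assoc' _ _ _)) pentagon' -!compA.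
rewrite (compA (assoc _ _ _)) -(tensh1 X P) assoc_nat -!compA.
rewrite (compA (assoc _ _ _)) runit'_assoc.
by rewrite !compA !tensh_idl.
Qed.

Lemma tr_partial_tr X P (a : hom unit (X ⊗ P)) (g : hom (P ⊗ X) unit) :
  ev X ∘ symm X (dual X) ∘ (partial_tr a g ⊠ idc (dual X)) ∘ coev X =
  g ∘ symm X P ∘ a.
Proof.
rewrite -!compA partial_tr_coev (compA (symm _ _)) symm_nat -!compA.
by rewrite compA ev_mate.
Qed.

Lemma unit_coefE (f : hom (unit : A) unit) : f = unit_coef f *: idc unit.
Proof. exact/eqP/(xchooseP (unit_scalar f)). Qed.

Lemma unit_coef_inj (f g : hom (unit : A) unit) :
  unit_coef f = unit_coef g -> f = g.
Proof. by move=> e; rewrite [f]unit_coefE [g]unit_coefE e. Qed.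

Lemma unit_coefZ a : unit_coef (a *: idc (unit : A)) = a.
Proof.
apply/eqP; rewrite -subr_eq0; have := unit_id_neq0 A; apply: contraNT => ne0.
have /eqP := unit_coefE (a *: idc (unit : A)).
rewrite eq_sym -subr_eq0 -scalerBl => /eqP e.
by apply/eqP/(scalerI ne0); rewrite e scaler0.
Qed.

Lemma Nideal_closed X Y P (f : hom X Y) (a : hom unit (X ⊗ P))
  (b : hom (Y ⊗ P) unit) : Nideal f -> b ∘ (f ⊠ idc P) ∘ a = 0.
Proof.
move=> Nf.
pose c := b ∘ symm P Y.
pose k := runit X ∘ (idc X ⊠ c) ∘ assoc X P Y ∘ (a ⊠ idc Y) ∘ lunit' Y.
have ek : partial_tr a (c ∘ (idc P ⊠ f)) = k ∘ f.
  rewrite /partial_tr /k -tensh_idl -!compA -lunit'_nat.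
  rewrite (compA (a ⊠ _)) tensh_lr -[a ⊠ f]tensh_rl -(tensh1 X P).
  by rewrite -!compA (compA (assoc _ _ Y)) assoc_nat -!compA.
have eb : b ∘ (f ⊠ idc P) ∘ a = c ∘ (idc P ⊠ f) ∘ symm X P ∘ a.
  by rewrite /c -!compA (compA (idc P ⊠ f)) -symm_nat -compA (compA (symm P Y))
    symmK comp1f.
rewrite eb -tr_partial_tr ek; apply: unit_coef_inj.
by rewrite -(scale0r (idc unit)) unit_coefZ -[RHS](Nf k).
Qed.

Lemma Nideal_compl X Y Z (f : hom X Y) (h : hom Y Z) :
  Nideal f -> Nideal (h ∘ f).
Proof. by move=> Nf g; rewrite compA; apply: Nf. Qed.

Lemma unit_coef0 : unit_coef (0 : hom (unit : A) unit) = 0.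
Proof. by rewrite -(scale0r (idc unit)) unit_coefZ. Qed.

Lemma Nideal_compr X Y Z (f : hom Y Z) (h : hom X Y) :
  Nideal f -> Nideal (f ∘ h).
Proof.
move=> Nf g; rewrite /tr compA -!tensh_idr !compA -(compA _ (h ⊠ _)).
by rewrite (Nideal_closed _ _ Nf) unit_coef0.
Qed.

Lemma Nideal_tensl X Y Z (f : hom X Y) : Nideal f -> Nideal (f ⊠ idc Z).
Proof.
move=> Nf g; rewrite /tr -tensh_idr !compA -(compA _ (_ ⊠ _) (coev _)).
have -> : ((f ⊠ idc Z) ⊠ idc (dual (X ⊗ Z))) =
    assoc' _ _ _ ∘ (f ⊠ idc (Z ⊗ dual (X ⊗ Z))) ∘ assoc _ _ _.
  by rewrite -tensh1 assoc'_nat -compA assocK compf1.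
by rewrite !compA -(compA _ (assoc _ _ _) (coev _)) (Nideal_closed _ _ Nf)
  unit_coef0.
Qed.

Lemma Nideal_tensr X Y Z (f : hom X Y) : Nideal f -> Nideal (idc Z ⊠ f).
Proof.
move=> Nf.
have -> : idc Z ⊠ f = symm _ _ ∘ (f ⊠ idc Z) ∘ symm _ _.
  by rewrite symm_nat -compA symmK compf1.
exact/Nideal_compr/Nideal_compl/Nideal_tensl.
Qed.

Lemma unit_coef_linear a (f g : hom (unit : A) unit) :
  unit_coef (a *: f + g) = a * unit_coef f + unit_coef g.
Proof.
rewrite [in LHS](unit_coefE f) [in LHS](unit_coefE g).
by rewrite scalerA -scalerDl unit_coefZ.
Qed.

Lemma tr_linear X a (f g : hom X X) : tr (a *: f + g) = a * tr f + tr g.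
Proof.
rewrite /tr (tensh_linear_l (idc (dual X)) a f g) /=.
by rewrite compDr compDl compZr compZl unit_coef_linear.
Qed.

Lemma Nideal0 X Y : Nideal (0 : hom X Y).
Proof.
move=> g; rewrite compf0.
by rewrite -(subrr (0 : hom X X)) addrC -scaleN1r tr_linear mulN1r addNr.
Qed.

Lemma Nideal_lin X Y a (f g : hom X Y) :
  Nideal f -> Nideal g -> Nideal (a *: f + g).
Proof.
by move=> Nf Ng h; rewrite compDr compZr tr_linear Nf Ng mulr0 addr0.
Qed.

Lemma Nideal_id : ~ Nideal (idc (unit : A)).
Proof.
move=> /(@Nideal_closed _ _ unit _ (lunit' unit) (lunit unit)).
rewrite tensh1 compf1 lunitK' => e.
by have := unit_id_neq0 A; rewrite e eqxx.
Qed.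

End NidealTheory.
(* A module presented by operations on representatives and an equivalence
   relation, such that the axioms of a module hold up to the equivalence. *)
Record modPres (K : pzRingType) := ModPres {
  pres :> choiceType;
  peq : equiv_rel pres;
  pzero : pres;
  padd : pres -> pres -> pres;
  popp : pres -> pres;
  pscale : K -> pres -> pres;
  padd_eq : forall x x' y y',
    peq x x' -> peq y y' -> peq (padd x y) (padd x' y');
  popp_eq : forall x x', peq x x' -> peq (popp x) (popp x');
  pscale_eq : forall a x x', peq x x' -> peq (pscale a x) (pscale a x');
  paddA : forall x y z, peq (padd x (padd y z)) (padd (padd x y) z);
  paddC : forall x y, peq (padd x y) (padd y x);
  padd0 : forall x, peq (padd pzero x) x;
  paddN : forall x, peq (padd (popp x) x) pzero;
  pscaleA : forall a b x, peq (pscale a (pscale b x)) (pscale (a * b) x);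
  pscale1 : forall x, peq (pscale 1 x) x;
  pscaleDr : forall a x y,
    peq (pscale a (padd x y)) (padd (pscale a x) (pscale a y));
  pscaleDl : forall x a b,
    peq (pscale (a + b) x) (padd (pscale a x) (pscale b x)) }.

Arguments peq {K m}.
Arguments padd {K m}.
Arguments popp {K m}.
Arguments pscale {K m}.

Local Open Scope quotient_scope.
Section ModQuot.
Variables (K : pzRingType) (P : modPres K).

Definition modquot : Type := {eq_quot (@peq K P)}.
HB.instance Definition _ := Choice.on modquot.
HB.instance Definition _ := EqQuotient.on modquot.

Definition mqclass (x : P) : modquot := \pi_modquot x.
Definition mqrepr (u : modquot) : P := generic_quotient.repr u.

Lemma mqclassP (x y : P) : mqclass x = mqclass y <-> peq x y.
Proof. by split=> [/eqmodP|/eqmodP]. Qed.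
Lemma mqreprK (u : modquot) : mqclass (mqrepr u) = u.
Proof. exact: reprK. Qed.
Lemma mqclassK (x : P) : peq (mqrepr (mqclass x)) x.
Proof. by apply/mqclassP; rewrite mqreprK. Qed.
Lemma mqW (Q : modquot -> Prop) : (forall x, Q (mqclass x)) -> forall u, Q u.
Proof. by move=> h u; rewrite -[u]mqreprK. Qed.

Definition mq0 : modquot := mqclass (pzero P).
Definition mqadd (u v : modquot) := mqclass (padd (mqrepr u) (mqrepr v)).
Definition mqopp (u : modquot) := mqclass (popp (mqrepr u)).
Definition mqscale (a : K) (u : modquot) := mqclass (pscale a (mqrepr u)).

Lemma mqaddE x y : mqadd (mqclass x) (mqclass y) = mqclass (padd x y).
Proof. by apply/mqclassP/padd_eq; apply: mqclassK. Qed.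
Lemma mqoppE x : mqopp (mqclass x) = mqclass (popp x).
Proof. by apply/mqclassP/popp_eq; apply: mqclassK. Qed.
Lemma mqscaleE a x : mqscale a (mqclass x) = mqclass (pscale a x).
Proof. by apply/mqclassP/pscale_eq; apply: mqclassK. Qed.

Lemma mqaddA : associative mqadd.
Proof.
by elim/mqW=> x; elim/mqW=> y; elim/mqW=> z; rewrite !mqaddE;
   apply/mqclassP/paddA.
Qed.
Lemma mqaddC : commutative mqadd.
Proof.
by elim/mqW=> x; elim/mqW=> y; rewrite !mqaddE; apply/mqclassP/paddC.
Qed.
Lemma mqadd0 : left_id mq0 mqadd.
Proof. by elim/mqW=> x; rewrite !mqaddE; apply/mqclassP/padd0. Qed.
Lemma mqaddN : left_inverse mq0 mqopp mqadd.
Proof. by elim/mqW=> x; rewrite mqoppE mqaddE; apply/mqclassP/paddN. Qed.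

HB.instance Definition _ :=
  GRing.isZmodule.Build modquot mqaddA mqaddC mqadd0 mqaddN.

Lemma mqscaleA a b u : mqscale a (mqscale b u) = mqscale (a * b) u.
Proof. by elim/mqW: u => x; rewrite !mqscaleE; apply/mqclassP/pscaleA. Qed.
Lemma mqscale1 : left_id 1 mqscale.
Proof. by elim/mqW=> x; rewrite !mqscaleE; apply/mqclassP/pscale1. Qed.
Lemma mqscaleDr : right_distributive mqscale +%R.
Proof.
move=> a; elim/mqW=> x; elim/mqW=> y.
by rewrite [X in mqscale _ X]mqaddE !mqscaleE [RHS]mqaddE; apply/mqclassP/pscaleDr.
Qed.
Lemma mqscaleDl u : {morph mqscale^~ u : a b / a + b}.
Proof.
move=> a b; elim/mqW: u => x.
by rewrite !mqscaleE [RHS]mqaddE; apply/mqclassP/pscaleDl.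
Qed.

HB.instance Definition _ := GRing.Zmodule_isLmodule.Build K modquot
  mqscaleA mqscale1 mqscaleDr mqscaleDl.

Lemma mqclassD (x y : P) : mqclass x + mqclass y = mqclass (padd x y).
Proof. exact: mqaddE. Qed.
Lemma mqclassZ a (x : P) : a *: mqclass x = mqclass (pscale a x).
Proof. exact: mqscaleE. Qed.
End ModQuot.

Section SubQuot.
Variables (K : pzRingType) (V : lmodType K) (N : V -> Prop).
Hypothesis N0 : N 0.
Hypothesis Nlin : forall a u v, N u -> N v -> N (a *: u + v).

Let ND u v : N u -> N v -> N (u + v).
Proof. by move=> Nu Nv; rewrite -[u]scale1r; apply: Nlin. Qed.
Let NZ a u : N u -> N (a *: u).
Proof. by move=> Nu; rewrite -[_ *: _]addr0; apply: Nlin. Qed.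

Definition subquot_rel : rel V := fun u v => `[< N (u - v) >].

Lemma subquot_equiv : equiv_class_of subquot_rel.
Proof.
have Nopp u v : N (u - v) -> N (v - u).
  by move=> Nu; rewrite -opprB -scaleN1r; apply: NZ.
split.
- by move=> u; apply/asboolP; rewrite subrr.
- by move=> u v; apply/asboolP/asboolP; apply: Nopp.
- move=> u v w /asboolP uv /asboolP vw; apply/asboolP.
  by rewrite -(subrKA u); apply: ND.
Qed.
Canonical subquot_equiv_rel := EquivRelPack subquot_equiv.

Definition subquot_pres : modPres K.
Proof.
refine (@ModPres K V subquot_equiv_rel 0 +%R -%R *:%R _ _ _ _ _ _ _ _ _ _ _).
- move=> x x' y y' /asboolP ex /asboolP ey; apply/asboolP.
  rewrite opprD addrACA. exact: ND.
- move=> x x' /asboolP ex; apply/asboolP.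
  by rewrite -opprD -[- (x - x')]scaleN1r; apply: NZ.
- move=> a x x' /asboolP ex; apply/asboolP.
  by rewrite -scalerBr; apply: NZ.
- by move=> x y z; rewrite addrA.
- by move=> x y; rewrite addrC.
- by move=> x; rewrite add0r.
- by move=> x; rewrite addNr.
- by move=> a b x; rewrite scalerA.
- by move=> x; rewrite scale1r.
- by move=> a x y; rewrite scalerDr.
- by move=> x a b; rewrite scalerDl.
Defined.

Definition subquot : lmodType K := modquot subquot_pres.
Definition subquot_class (v : V) : subquot := @mqclass K subquot_pres v.
Definition subquot_repr (u : subquot) : V := @mqrepr K subquot_pres u.

Lemma subquot_classP u v : subquot_class u = subquot_class v <-> N (u - v).
Proof. by rewrite mqclassP; split=> /asboolP. Qed.
Lemma subquot_reprK u : subquot_class (subquot_repr u) = u.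
Proof. exact: mqreprK. Qed.
Lemma subquot_classK v : N (subquot_repr (subquot_class v) - v).
Proof. by apply/subquot_classP; rewrite subquot_reprK. Qed.
Lemma subquot_class_linear : linear subquot_class.
Proof.
move=> a u v; rewrite [X in _ = X + _](@mqclassZ K subquot_pres).
by rewrite [RHS](@mqclassD K subquot_pres).
Qed.
End SubQuot.

(* The scalar extension of a K-module V to L, along iota : K -> L: formal sums
   of pairs (l, v), two of them being identified when they take the same value
   under all K-linear maps from V to an L-module. *)
Section ScalExt.
Variables (K L : fieldType) (iota : {rmorphism K -> L}) (V : lmodType K).

Definition semilin (W : lmodType L) (f : V -> W) : Prop :=
  forall a u v, f (a *: u + v) = iota a *: f u + f v.

Definition fsum_eval (W : lmodType L) (f : V -> W) (s : seq (L * V)) : W :=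
  \sum_(x <- s) x.1 *: f x.2.

Definition scalext_rel : rel (seq (L * V)) := fun s t =>
  `[< forall (W : lmodType L) (f : V -> W), semilin f ->
        fsum_eval f s = fsum_eval f t >].

Lemma scalext_equiv : equiv_class_of scalext_rel.
Proof.
split.
- by move=> s; apply/asboolP.
- by move=> s t; apply/asboolP/asboolP => h W f Hf; rewrite h.
- by move=> s t u /asboolP h /asboolP h'; apply/asboolP => W f Hf;
     rewrite h ?h'.
Qed.
Canonical scalext_equiv_rel := EquivRelPack scalext_equiv.

Definition fsum_scale (a : L) (s : seq (L * V)) :=
  [seq (a * x.1, x.2) | x <- s].

Lemma fsum_eval_cat (W : lmodType L) (f : V -> W) s t :
  fsum_eval f (s ++ t) = fsum_eval f s + fsum_eval f t.
Proof. exact: big_cat. Qed.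
Lemma fsum_eval_scale (W : lmodType L) (f : V -> W) a s :
  fsum_eval f (fsum_scale a s) = a *: fsum_eval f s.
Proof.
rewrite /fsum_eval big_map scaler_sumr.
by apply: eq_bigr => x _; rewrite scalerA.
Qed.

Definition scalext_pres : modPres L.
Proof.
refine (@ModPres L (seq (L * V)) scalext_equiv_rel [::] cat (fsum_scale (-1))
          fsum_scale _ _ _ _ _ _ _ _ _ _ _).
- by move=> x x' y y' /asboolP ex /asboolP ey; apply/asboolP => W f Hf;
     rewrite !fsum_eval_cat ex ?ey.
- by move=> x x' /asboolP ex; apply/asboolP => W f Hf;
     rewrite !fsum_eval_scale ex.
- by move=> a x x' /asboolP ex; apply/asboolP => W f Hf;
     rewrite !fsum_eval_scale ex.
- by move=> x y z; rewrite catA.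
- by move=> x y; apply/asboolP => W f Hf; rewrite !fsum_eval_cat addrC.
- by [].
- by move=> x; apply/asboolP => W f Hf;
     rewrite fsum_eval_cat fsum_eval_scale scaleN1r addNr /fsum_eval big_nil.
- by move=> a b x; apply/asboolP => W f Hf;
     rewrite !fsum_eval_scale scalerA.
- by move=> x; apply/asboolP => W f Hf; rewrite !fsum_eval_scale scale1r.
- by move=> a x y; apply/asboolP => W f Hf;
     rewrite !(fsum_eval_cat, fsum_eval_scale) scalerDr.
- by move=> x a b; apply/asboolP => W f Hf;
     rewrite !(fsum_eval_cat, fsum_eval_scale) scalerDl.
Defined.

Definition scalext : lmodType L := modquot scalext_pres.
Definition scalext_in (v : V) : scalext :=
  @mqclass L scalext_pres [:: (1, v)].

Lemma scalext_in_semilin : semilin scalext_in.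
Proof.
move=> a u v; rewrite [X in _ = X + _](@mqclassZ L scalext_pres).
rewrite [RHS](@mqclassD L scalext_pres); apply/mqclassP/asboolP => W f Hf.
by rewrite /fsum_eval !big_cons !big_nil /= !addr0 Hf !scale1r mulr1.
Qed.

Definition scalext_lift (W : lmodType L) (f : V -> W) (u : scalext) : W :=
  fsum_eval f (@mqrepr L scalext_pres u).

Section Lift.
Variables (W : lmodType L) (f : V -> W).
Hypothesis Hf : semilin f.

Lemma scalext_liftE (s : seq (L * V)) :
  scalext_lift f (@mqclass L scalext_pres s) = fsum_eval f s.
Proof. by have /asboolP := @mqclassK L scalext_pres s; apply. Qed.

Lemma scalext_lift_in v : scalext_lift f (scalext_in v) = f v.
Proof. by rewrite scalext_liftE /fsum_eval big_seq1 scale1r. Qed.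

Lemma scalext_lift_linear : linear (scalext_lift f).
Proof.
move=> a; elim/mqW=> s; elim/mqW=> t.
rewrite (@mqclassZ L scalext_pres) (@mqclassD L scalext_pres) !scalext_liftE.
by rewrite fsum_eval_cat fsum_eval_scale.
Qed.
End Lift.

Lemma scalext_ind (Q : scalext -> Prop) :
  Q 0 -> (forall a v u, Q u -> Q (a *: scalext_in v + u)) -> forall u, Q u.
Proof.
move=> Q0 QS; elim/mqW; elim=> [//|[a v] s IHs].
have := QS a v _ IHs.
by rewrite (@mqclassZ L scalext_pres) (@mqclassD L scalext_pres) /= mulr1.
Qed.

End ScalExt.
(* A family of L-modules spanned by the images of the Homs of A, to which
   composition and tensor product extend L-bilinearly; it defines a rigid
   L-category with the same objects as A. *)
Record homChange (K L : fieldType) (iota : {rmorphism K -> L})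
    (A : rigidCat K) := HomChange {
  chom : A -> A -> lmodType L;
  cpi : forall X Y, hom X Y -> chom X Y;
  ccomp : forall X Y Z, chom Y Z -> chom X Y -> chom X Z;
  ctens : forall X X' Y Y', chom X X' -> chom Y Y' -> chom (X ⊗ Y) (X' ⊗ Y');
  cpi_semilin : forall X Y, semilin iota (@cpi X Y);
  cpi_ind : forall X Y (Q : chom X Y -> Prop),
    Q 0 -> (forall a f u, Q u -> Q (a *: cpi f + u)) -> forall u, Q u;
  ccomp_linear_l : forall X Y Z (f : chom X Y),
    linear (fun g : chom Y Z => ccomp g f);
  ccomp_linear_r : forall X Y Z (g : chom Y Z),
    linear (fun f : chom X Y => ccomp g f);
  ctens_linear_l : forall X X' Y Y' (g : chom Y Y'),
    linear (fun f : chom X X' => ctens f g);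
  ctens_linear_r : forall X X' Y Y' (f : chom X X'),
    linear (fun g : chom Y Y' => ctens f g);
  ccomp_pi : forall X Y Z (g : hom Y Z) (f : hom X Y),
    ccomp (cpi g) (cpi f) = cpi (g ∘ f);
  ctens_pi : forall X X' Y Y' (f : hom X X') (g : hom Y Y'),
    ctens (cpi f) (cpi g) = cpi (f ⊠ g);
  cpi_id_neq0 : cpi (idc (unit : A)) != 0 }.

Arguments cpi {K L iota A} h {X Y} f.
Arguments ccomp {K L iota A} h {X Y Z} g f.
Arguments ctens {K L iota A} h {X X' Y Y'} f g.

Section ChangeHom.
Variables (K L : fieldType) (iota : {rmorphism K -> L}) (A : rigidCat K).
Variable C : homChange iota A.
Local Notation H := (@chom K L iota A C).
Local Notation pi := (cpi C).
Local Notation comp' := (ccomp C).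
Local Notation tens' := (ctens C).
Implicit Types X Y Z W : A.

Lemma chom_ext X Y (W : lmodType L) (F G : H X Y -> W) :
  linear F -> linear G -> (forall f, F (pi f) = G (pi f)) -> forall u, F u = G u.
Proof.
move=> lF lG e; have z E : linear E -> E 0 = 0 :> W.
  move=> lE; have := lE 1 0 0.
  by rewrite !scale1r addr0 -{1}[E 0]addr0 => /addrI.
by apply: cpi_ind => [|a f u IH]; [rewrite !z | rewrite lF lG e IH].
Qed.

Lemma cpiD X Y (f g : hom X Y) : pi (f + g) = pi f + pi g.
Proof. by have := cpi_semilin C 1 f g; rewrite rmorph1 !scale1r. Qed.
Lemma cpi0 X Y : pi (0 : hom X Y) = 0.
Proof. by apply: (addrI (pi 0)); rewrite -cpiD !addr0. Qed.
Lemma cpiZ X Y a (f : hom X Y) : pi (a *: f) = iota a *: pi f.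
Proof. by have := cpi_semilin C a f 0; rewrite cpi0 !addr0. Qed.

Let cl X Y Z a (g g' : H Y Z) (f : H X Y) :
  comp' (a *: g + g') f = a *: comp' g f + comp' g' f.
Proof. exact: ccomp_linear_l. Qed.
Let cr X Y Z a (g : H Y Z) (f f' : H X Y) :
  comp' g (a *: f + f') = a *: comp' g f + comp' g f'.
Proof. exact: ccomp_linear_r. Qed.
Let tl X X' Y Y' a (f f' : H X X') (g : H Y Y') :
  tens' (a *: f + f') g = a *: tens' f g + tens' f' g.
Proof. exact: ctens_linear_l. Qed.
Let tr X X' Y Y' a (f : H X X') (g g' : H Y Y') :
  tens' f (a *: g + g') = a *: tens' f g + tens' f g'.
Proof. exact: ctens_linear_r. Qed.

Ltac ext u := move: u; apply: chom_ext;
  [by move=> ? ? ?; rewrite ?(cl, cr, tl, tr) |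
   by move=> ? ? ?; rewrite ?(cl, cr, tl, tr) | move=> u].
Ltac pis := rewrite ?(ccomp_pi, ctens_pi).

Definition change_lin : linCat L.
Proof.
refine (@LinCat L A H (fun X => pi (idc X)) (@ccomp _ _ _ _ C) _ _ _
          (@ccomp_linear_l _ _ _ _ C) (@ccomp_linear_r _ _ _ _ C)).
- by move=> X Y Z W h g f; ext h; ext g; ext f; pis; rewrite compA.
- by move=> X Y f; ext f; pis; rewrite comp1f.
- by move=> X Y f; ext f; pis; rewrite compf1.
Defined.

Definition change_sym : symCat L.
Proof.
refine (@SymCat L change_lin (unit : A) (@tens K A) (@ctens _ _ _ _ C)
  (fun X Y Z => pi (assoc X Y Z)) (fun X Y Z => pi (assoc' X Y Z))
  (fun X => pi (lunit X)) (fun X => pi (lunit' X))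
  (fun X => pi (runit X)) (fun X => pi (runit' X))
  (fun X Y => pi (symm X Y))
  _ _ (@ctens_linear_l _ _ _ _ C) (@ctens_linear_r _ _ _ _ C)
  _ _ _ _ _ _ _ _ _ _ _ _ _ _ _ _); rewrite /comp /=.
- by move=> X Y; pis; rewrite tensh1.
- by move=> X X' X'' Y Y' Y'' f' f g' g; ext f'; ext f; ext g'; ext g;
     pis; rewrite tensh_comp.
- by move=> X Y Z; pis; rewrite assocK.
- by move=> X Y Z; pis; rewrite assocK'.
- by move=> X; pis; rewrite lunitK.
- by move=> X; pis; rewrite lunitK'.
- by move=> X; pis; rewrite runitK.
- by move=> X; pis; rewrite runitK'.
- by move=> X Y; pis; rewrite symmK.
- by move=> X X' Y Y' Z Z' f g h; ext f; ext g; ext h; pis; rewrite assoc_nat.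
- by move=> X X' f; ext f; pis; rewrite lunit_nat.
- by move=> X X' f; ext f; pis; rewrite runit_nat.
- by move=> X X' Y Y' f g; ext f; ext g; pis; rewrite symm_nat.
- by move=> W X Y Z; pis; rewrite pentagon.
- by move=> X Y; pis; rewrite triangle.
- by move=> X Y Z; pis; rewrite hexagon.
- by move=> X; pis; rewrite lunit_symm.
- by rewrite lunit_unit.
Defined.

Definition change_rigid : rigidCat L.
Proof.
refine (@RigidCat L change_sym _ (cpi_id_neq0 C) _ (@dual K A)
  (fun X => pi (ev X)) (fun X => pi (coev X)) _ _); rewrite /comp /=.
- have [[Z Z0] bp] := additiveP A.
  split.
    exists Z => X; have [Zl Zr] := Z0 X; split; apply: cpi_ind => // a f u ->.
      by rewrite (Zl f) cpi0 scaler0 addr0.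
    by rewrite (Zr f) cpi0 scaler0 addr0.
  move=> X Y; have [S [i [j [p [q [e1 e2 e3 e4 e5]]]]]] := bp X Y.
  exists S, (pi i), (pi j), (pi p), (pi q).
  by split; rewrite /comp /=; pis; rewrite ?e1 ?e2 ?e3 ?e4 ?cpi0 // -cpiD e5.
- apply: cpi_ind => [|a f u [b /eqP eb]]; first by exists 0; rewrite scale0r.
  exists (a * iota (unit_coef f) + b).
  by rewrite eb (unit_coefE f) unit_coefZ cpiZ scalerA -scalerDl.
- by move=> X; pis; rewrite zigzag_l.
- by move=> X; pis; rewrite zigzag_r.
Defined.
End ChangeHom.

Section Quotient.
Variables (K : fieldType) (A : rigidCat K).
Implicit Types X Y Z : A.

Definition quot_hom X Y : lmodType K :=
  subquot (@Nideal0 K A X Y) (@Nideal_lin K A X Y).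
Definition quot_pi X Y (f : hom X Y) : quot_hom X Y := subquot_class _ _ f.
Definition quot_repr X Y (u : quot_hom X Y) : hom X Y := subquot_repr u.
Definition quot_comp X Y Z (v : quot_hom Y Z) (u : quot_hom X Y) :
  quot_hom X Z := quot_pi (quot_repr v ∘ quot_repr u).
Definition quot_tens X X' Y Y' (u : quot_hom X X') (v : quot_hom Y Y') :
  quot_hom (X ⊗ Y) (X' ⊗ Y') := quot_pi (quot_repr u ⊠ quot_repr v).

Lemma quot_piP X Y (f g : hom X Y) : quot_pi f = quot_pi g <-> Nideal (f - g).
Proof. exact: subquot_classP. Qed.
Lemma quot_reprK X Y (u : quot_hom X Y) : quot_pi (quot_repr u) = u.
Proof. exact: subquot_reprK. Qed.
Lemma quot_pi_linear X Y : linear (@quot_pi X Y).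
Proof. exact: subquot_class_linear. Qed.
Lemma quot_W X Y (Q : quot_hom X Y -> Prop) :
  (forall f, Q (quot_pi f)) -> forall u, Q u.
Proof. by move=> h u; rewrite -[u]quot_reprK. Qed.

Lemma quot_pi_eqD X Y (f f' : hom X Y) :
  quot_pi f = quot_pi f' -> exists2 n, Nideal n & f = f' + n.
Proof. by move=> /quot_piP Nn; exists (f - f') => //; rewrite addrC subrK. Qed.
Lemma quot_piDN X Y (f n : hom X Y) :
  Nideal n -> quot_pi (f + n) = quot_pi f.
Proof. by move=> Nn; apply/quot_piP; rewrite addrC addKr. Qed.

Lemma quot_comp_pi X Y Z (g : hom Y Z) (f : hom X Y) :
  quot_comp (quot_pi g) (quot_pi f) = quot_pi (g ∘ f).
Proof.
have [n Nn en] := quot_pi_eqD (quot_reprK (quot_pi g)).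
have [m Nm em] := quot_pi_eqD (quot_reprK (quot_pi f)).
rewrite /quot_comp en em compDl quot_piDN; last exact: Nideal_compr.
by rewrite compDr quot_piDN //; apply: Nideal_compl.
Qed.

Lemma quot_tens_pi X X' Y Y' (f : hom X X') (g : hom Y Y') :
  quot_tens (quot_pi f) (quot_pi g) = quot_pi (f ⊠ g).
Proof.
have [n Nn en] := quot_pi_eqD (quot_reprK (quot_pi f)).
have [m Nm em] := quot_pi_eqD (quot_reprK (quot_pi g)).
rewrite /quot_tens en em tenshDl quot_piDN; last first.
  by rewrite -tensh_rl; apply/Nideal_compl/Nideal_tensl.
rewrite tenshDr quot_piDN // -tensh_lr.
exact/Nideal_compl/Nideal_tensr.
Qed.

Definition quot_change : homChange (@idfun K) A.
Proof.
refine (@HomChange K K idfun A quot_hom quot_pi quot_comp quot_tens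
          _ _ _ _ _ _ quot_comp_pi quot_tens_pi _).
- exact: quot_pi_linear.
- move=> X Y Q Q0 QS; elim/quot_W=> f.
  have := QS 1 f _ Q0; by rewrite scale1r addr0.
- move=> X Y Z; elim/quot_W=> f a; elim/quot_W=> g; elim/quot_W=> g'.
  by rewrite -quot_pi_linear !quot_comp_pi compDl compZl quot_pi_linear.
- move=> X Y Z; elim/quot_W=> f a; elim/quot_W=> g; elim/quot_W=> g'.
  by rewrite -quot_pi_linear !quot_comp_pi compDr compZr quot_pi_linear.
- move=> X X' Y Y'; elim/quot_W=> g a; elim/quot_W=> f; elim/quot_W=> f'.
  by rewrite -quot_pi_linear !quot_tens_pi tensh_linear_l quot_pi_linear.
- move=> X X' Y Y'; elim/quot_W=> g a; elim/quot_W=> f; elim/quot_W=> f'.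
  by rewrite -quot_pi_linear !quot_tens_pi tensh_linear_r quot_pi_linear.
- apply/eqP => e; apply: (@Nideal_id K A).
  have := quot_pi_linear (-1) (idc (unit : A)) (idc unit).
  by rewrite scaleN1r addNr e scaler0 addr0 -e => /esym/quot_piP; rewrite subr0.
Defined.

Definition quot_rigid : rigidCat K := change_rigid quot_change.

End Quotient.

Section ScalExtBil.
Variables (K L : fieldType) (iota : {rmorphism K -> L}).
Variables (U V W : lmodType K) (b : U -> V -> W).
Hypothesis bl : forall v, linear (b^~ v).
Hypothesis br : forall u, linear (b u).
Local Notation ext := (scalext iota).

Definition scalext_bil (u : ext U) (v : ext V) : ext W :=
  scalext_lift (iota := iota)
    (fun x => scalext_lift (iota := iota) (fun y => scalext_in iota (b x y)) v)
    u.

Let semil_r x : semilin iota (fun y => scalext_in iota (b x y)).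
Proof. by move=> a y y'; rewrite br scalext_in_semilin. Qed.

Let semil_l v :
  semilin iota (fun x => scalext_lift (iota := iota) (fun y => scalext_in iota (b x y)) v).
Proof.
move=> a x x'; rewrite /scalext_lift /fsum_eval scaler_sumr -big_split /=.
apply: eq_bigr => z _.
by rewrite bl scalext_in_semilin scalerDr !scalerA mulrC.
Qed.

Lemma scalext_bil_linear_l v : linear (scalext_bil^~ v).
Proof. exact/scalext_lift_linear/semil_l. Qed.

Lemma scalext_bil_linear_r u : linear (scalext_bil u).
Proof.
move=> a v v'.
have E w : scalext_bil u w = \sum_(z <- @mqrepr L (scalext_pres iota U) u)
    z.1 *: scalext_lift (iota := iota) (fun y => scalext_in iota (b z.2 y)) w by [].
rewrite !E scaler_sumr -big_split /=; apply: eq_bigr => z _.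
by rewrite (scalext_lift_linear (semil_r _)) scalerDr !scalerA mulrC.
Qed.

Lemma scalext_bil_in x y :
  scalext_bil (scalext_in iota x) (scalext_in iota y) = scalext_in iota (b x y).
Proof. by rewrite /scalext_bil !scalext_lift_in. Qed.
End ScalExtBil.

Section ScalExtCat.
Variables (K L : fieldType) (iota : {rmorphism K -> L}) (A : rigidCat K).
Implicit Types X Y Z : A.

Definition scalext_change : homChange iota A.
Proof.
refine (@HomChange K L iota A (fun X Y => scalext iota (hom X Y))
  (fun X Y => @scalext_in K L iota (hom X Y))
  (fun X Y Z => scalext_bil (@comp K A X Y Z))
  (fun X X' Y Y' => scalext_bil (@tensh K A X X' Y Y')) _ _ _ _ _ _ _ _ _).
- by move=> X Y; apply: scalext_in_semilin.
- by move=> X Y Q; apply: scalext_ind.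
- by move=> X Y Z f; apply: scalext_bil_linear_l => g; apply: comp_linear_l.
- by move=> X Y Z g; apply: scalext_bil_linear_r => f; apply: comp_linear_r.
- by move=> X X' Y Y' g; apply: scalext_bil_linear_l => f;
     apply: tensh_linear_l.
- by move=> X X' Y Y' f; apply: scalext_bil_linear_r => g;
     apply: tensh_linear_r.
- by move=> X Y Z g f; apply: scalext_bil_in => h;
     [apply: comp_linear_l | apply: comp_linear_r].
- by move=> X X' Y Y' f g; apply: scalext_bil_in => h;
     [apply: tensh_linear_l | apply: tensh_linear_r].
- pose c (f : hom (unit : A) unit) : L^o := iota (unit_coef f).
  have Hc : semilin iota c.
    by move=> a f g; rewrite /c unit_coef_linear rmorphD rmorphM.
  apply/eqP => e; have := scalext_lift_in Hc (idc unit).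
  rewrite e.
  have := scalext_lift_linear Hc (-1) 0 0.
  rewrite scaler0 addr0 scaleN1r addNr => ->.
  rewrite /c -[idc _]scale1r unit_coefZ rmorph1 => /eqP.
  by rewrite eq_sym oner_eq0.
Defined.

Definition scalext_rigid : rigidCat L := change_rigid scalext_change.

End ScalExtCat.
Section SubMod.
Variables (K : pzRingType) (V : lmodType K) (P : {pred V}).
Hypothesis HP : submod_closed P.

Definition submod_pred of submod_closed P : {pred V} := P.
HB.instance Definition _ := GRing.isSubmodClosed.Build K V (submod_pred HP) HP.
Record submod := SubMod { submod_val :> V; submodP : submod_val \in submod_pred HP }.
HB.instance Definition _ := [isSub for submod_val].
HB.instance Definition _ := [Choice of submod by <:].
HB.instance Definition _ := [SubChoice_isSubLmodule of submod by <:].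
End SubMod.

Section SubModTheory.
Variables (K : pzRingType) (V : lmodType K) (P : {pred V}).
Variable HP : submod_closed P.
Lemma submod_inj (u v : submod HP) : u = v :> V -> u = v.
Proof. exact: val_inj. Qed.
End SubModTheory.

Section TensorSpace.
Variable L : fieldType.
Implicit Types U V W : vectType L.

(* U ⊗ V is modelled by matrices: the coordinates of u ⊗ v in the basis of the
   b_i ⊗ b'_j are the products of the coordinates of u and v. *)
Definition tsp U V : vectType L := 'M[L]_(\dim {:U}, \dim {:V}).

Definition pure U V (u : U) (v : V) : tsp U V :=
  \matrix_(i, j) (coord (vbasis {:U}) i u * coord (vbasis {:V}) j v).

Definition tlift U V W (b : U -> V -> W) (m : tsp U V) : W :=
  \sum_i \sum_j m i j *: b (vbasis {:U})`_i (vbasis {:V})`_j.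

Lemma pure_linear_l U V (v : V) : linear (fun u : U => pure u v).
Proof.
by move=> a u u'; apply/matrixP => i j; rewrite !mxE linearP mulrDl mulrA.
Qed.
Lemma pure_linear_r U V (u : U) : linear (fun v : V => pure u v).
Proof.
move=> a v v'; apply/matrixP => i j.
by rewrite !mxE linearP mulrDr mulrCA.
Qed.

Lemma tlift_linear U V W (b : U -> V -> W) : linear (tlift b).
Proof.
move=> a m m'; rewrite /tlift scaler_sumr -big_split; apply: eq_bigr => i _.
rewrite scaler_sumr -big_split; apply: eq_bigr => j _ /=.
by rewrite !mxE scalerDl scalerA.
Qed.

Lemma linfunE U V (f : U -> V) (u : U) : linear f -> linfun f u = f u.
Proof.
move=> lf; pose g := GRing.isLinear.Build L U V *:%R f lf.
pose h : {linear U -> V} := HB.pack f g.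
exact: (lfunE h u).
Qed.

Section Bilin.
Variables (U V W : vectType L) (b : U -> V -> W).
Hypothesis bl : forall v, linear (b^~ v).
Hypothesis br : forall u, linear (b u).

Lemma tlift_pure u v : tlift b (pure u v) = b u v.
Proof.
rewrite [in RHS](coord_vbasis (memvf u)) [in RHS](coord_vbasis (memvf v)).
have bsl n (c : 'I_n -> L) (x : 'I_n -> U) y :
    b (\sum_i c i *: x i) y = \sum_i c i *: b (x i) y.
  elim/big_rec2: _ => [|i _ z _ <-]; last exact: bl.
  by apply: (addrI (b 0 y)); have := bl y 1 0 0; rewrite !scale1r !addr0.
have bsr n (c : 'I_n -> L) (x : 'I_n -> V) y :
    b y (\sum_i c i *: x i) = \sum_i c i *: b y (x i).
  elim/big_rec2: _ => [|i _ z _ <-]; last exact: br.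
  by apply: (addrI (b y 0)); have := br y 1 0 0; rewrite !scale1r !addr0.
rewrite bsl; apply: eq_bigr => i _; rewrite bsr scaler_sumr.
by apply: eq_bigr => j _; rewrite mxE scalerA.
Qed.
End Bilin.

Lemma tsp_ext U V W (f g : 'Hom(tsp U V, W)) :
  (forall u v, f (pure u v) = g (pure u v)) -> f = g.
Proof.
move=> e; apply/lfunP => m.
have -> : m = \sum_i \sum_j m i j *: pure (vbasis {:U})`_i (vbasis {:V})`_j.
  apply/matrixP => k l; rewrite summxE (bigD1 k) //= summxE (bigD1 l) //=.
  have fU : free (vbasis {:U}) by apply: basis_free (vbasisP _).
  have fV : free (vbasis {:V}) by apply: basis_free (vbasisP _).
  rewrite !mxE !coord_free // !eqxx !mulr1 !big1 ?addr0 // => i ni.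
    rewrite summxE big1 // => j _; rewrite !mxE !coord_free //.
    by rewrite (negPf ni) mul0r mulr0.
  by rewrite !mxE !coord_free // eqxx (negPf ni) !mulr0.
rewrite !linear_sum; apply: eq_bigr => i _; rewrite !linear_sum.
by apply: eq_bigr => j _; rewrite !linearZ /= e.
Qed.
End TensorSpace.

Section TensorMaps.
Variable L : fieldType.
Implicit Types U V W X Z : vectType L.

Lemma pureDl U V (u u' : U) (v : V) : pure (u + u') v = pure u v + pure u' v.
Proof. by have := pure_linear_l v 1 u u'; rewrite !scale1r. Qed.
Lemma pureDr U V (u : U) (v v' : V) : pure u (v + v') = pure u v + pure u v'.
Proof. by have := pure_linear_r u 1 v v'; rewrite !scale1r. Qed.
Lemma pure0l U V (v : V) : pure (0 : U) v = 0.
Proof. by apply: (addrI (pure 0 v)); rewrite -pureDl !addr0. Qed.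
Lemma pure0r U V (u : U) : pure u (0 : V) = 0.
Proof. by apply: (addrI (pure u 0)); rewrite -pureDr !addr0. Qed.
Lemma pureZl U V a (u : U) (v : V) : pure (a *: u) v = a *: pure u v.
Proof. by have := pure_linear_l v a u 0; rewrite pure0l !addr0. Qed.
Lemma pureZr U V a (u : U) (v : V) : pure u (a *: v) = a *: pure u v.
Proof. by have := pure_linear_r u a v 0; rewrite pure0r !addr0. Qed.

Lemma tlift_linear_fun U V W a (b b' b'' : U -> V -> W) m :
  (forall u v, b'' u v = a *: b u v + b' u v) ->
  tlift b'' m = a *: tlift b m + tlift b' m.
Proof.
move=> e; rewrite /tlift scaler_sumr -big_split; apply: eq_bigr => i _.
rewrite scaler_sumr -big_split; apply: eq_bigr => j _ /=.
by rewrite e scalerDr !scalerA mulrC.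
Qed.

Definition tmap U V W (b : U -> V -> W) : 'Hom(tsp U V, W) :=
  linfun (tlift b).

Lemma tmap_pure U V W (b : U -> V -> W) u v :
  (forall v, linear (b^~ v)) -> (forall u, linear (b u)) ->
  tmap b (pure u v) = b u v.
Proof.
by move=> bl br; rewrite /tmap linfunE ?tlift_pure //; apply: tlift_linear.
Qed.

Definition thom U U' V V' (f : 'Hom(U, U')) (g : 'Hom(V, V')) :
  'Hom(tsp U V, tsp U' V') := tmap (fun u v => pure (f u) (g v)).
Lemma thomE U U' V V' (f : 'Hom(U, U')) (g : 'Hom(V, V')) u v :
  thom f g (pure u v) = pure (f u) (g v).
Proof.
by apply: tmap_pure => x a y z; rewrite linearP /= ?pureDl ?pureDr
  ?pureZl ?pureZr.
Qed.

Definition tassoc U V W : 'Hom(tsp (tsp U V) W, tsp U (tsp V W)) :=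
  tmap (fun m w => tlift (fun u v => pure u (pure v w)) m).
Lemma tassocE U V W u v w :
  @tassoc U V W (pure (pure u v) w) = pure u (pure v w).
Proof.
rewrite tmap_pure ?tlift_pure //.
- by move=> x a y z; rewrite !(pureDl, pureDr, pureZl, pureZr).
- by move=> x a y z; rewrite !(pureDl, pureDr, pureZl, pureZr).
- by move=> x; apply: tlift_linear.
- move=> m a x y; apply: tlift_linear_fun => u' v'.
  by rewrite !(pureDl, pureDr, pureZl, pureZr).
Qed.

Definition tassoc' U V W : 'Hom(tsp U (tsp V W), tsp (tsp U V) W) :=
  tmap (fun u m => tlift (fun v w => pure (pure u v) w) m).
Lemma tassoc'E U V W u v w :
  @tassoc' U V W (pure u (pure v w)) = pure (pure u v) w.
Proof.
rewrite tmap_pure ?tlift_pure //.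
- by move=> x a y z; rewrite !(pureDl, pureDr, pureZl, pureZr).
- by move=> x a y z; rewrite !(pureDl, pureDr, pureZl, pureZr).
- move=> m a x y; apply: tlift_linear_fun => u' v'.
  by rewrite !(pureDl, pureDr, pureZl, pureZr).
- by move=> x; apply: tlift_linear.
Qed.

Definition tlunit V : 'Hom(tsp L^o V, V) := tmap (fun (a : L^o) v => a *: v).
Lemma tlunitE V a v : @tlunit V (pure a v) = a *: v.
Proof.
apply: tmap_pure => [x b y z|x b y z].
  by rewrite scalerDl scalerA.
by rewrite scalerDr !scalerA mulrC.
Qed.
Definition tlunit' V : 'Hom(V, tsp L^o V) := linfun (fun v => pure (1 : L^o) v).
Lemma tlunit'E V v : @tlunit' V v = pure (1 : L^o) v.
Proof. by rewrite linfunE //; apply: pure_linear_r. Qed.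

Definition trunit V : 'Hom(tsp V L^o, V) := tmap (fun v (a : L^o) => a *: v).
Lemma trunitE V a v : @trunit V (pure v a) = a *: v.
Proof.
apply: tmap_pure => [x b y z|x b y z].
  by rewrite scalerDr !scalerA mulrC.
by rewrite scalerDl scalerA.
Qed.
Definition trunit' V : 'Hom(V, tsp V L^o) := linfun (fun v => pure v (1 : L^o)).
Lemma trunit'E V v : @trunit' V v = pure v (1 : L^o).
Proof. by rewrite linfunE //; apply: pure_linear_l. Qed.

Lemma tsp_ext3 U V W Z (f g : 'Hom(tsp (tsp U V) W, Z)) :
  (forall u v w, f (pure (pure u v) w) = g (pure (pure u v) w)) -> f = g.
Proof.
move=> e; apply: tsp_ext => m w.
pose F (h : 'Hom(tsp (tsp U V) W, Z)) := linfun (fun m => h (pure m w)).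
have FE h x : F h x = h (pure x w).
  by rewrite linfunE // => a y z; rewrite pureDl pureZl linearP.
suff /lfunP/(_ m) : F f = F g by rewrite !FE.
by apply: tsp_ext => u v; rewrite !FE.
Qed.

Lemma tsp_ext3' U V W Z (f g : 'Hom(tsp U (tsp V W), Z)) :
  (forall u v w, f (pure u (pure v w)) = g (pure u (pure v w))) -> f = g.
Proof.
move=> e; apply: tsp_ext => u m.
pose F (h : 'Hom(tsp U (tsp V W), Z)) := linfun (fun m => h (pure u m)).
have FE h x : F h x = h (pure u x).
  by rewrite linfunE // => a y z; rewrite pureDr pureZr linearP.
suff /lfunP/(_ m) : F f = F g by rewrite !FE.
by apply: tsp_ext => v w; rewrite !FE.
Qed.

Lemma tsp_ext4 U V W X Z (f g : 'Hom(tsp (tsp (tsp U V) W) X, Z)) :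
  (forall u v w x, f (pure (pure (pure u v) w) x) =
                   g (pure (pure (pure u v) w) x)) -> f = g.
Proof.
move=> e; apply: tsp_ext => m x.
pose F (h : 'Hom(tsp (tsp (tsp U V) W) X, Z)) := linfun (fun m => h (pure m x)).
have FE h y : F h y = h (pure y x).
  by rewrite linfunE // => a y' z; rewrite pureDl pureZl linearP.
suff /lfunP/(_ m) : F f = F g by rewrite !FE.
by apply: tsp_ext3 => u v w; rewrite !FE.
Qed.
End TensorMaps.

(* A Z/2-grading of V is given by the projector onto the odd part V_1 along the
   even part V_0. *)
Record superVec (L : fieldType) := SuperVec {
  sv :> vectType L;
  oddp : 'End(sv);
  oddp_idem : (oddp \o oddp)%VF = oddp }.

Section SuperHom.
Variable L : fieldType.
Implicit Types U V W : superVec L.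

(* morphisms preserve the grading *)
Definition even_pred U V : {pred 'Hom(U, V)} :=
  fun f => (f \o oddp U)%VF == (oddp V \o f)%VF.

Lemma even_closed U V : submod_closed (even_pred (U := U) (V := V)).
Proof.
split=> [|a f g /eqP ef /eqP eg]; apply/eqP.
  by rewrite comp_lfun0l comp_lfun0r.
by rewrite comp_lfunDl comp_lfunDr -comp_lfunZl -comp_lfunZr ef eg.
Qed.

Definition shom U V : lmodType L := submod (even_closed U V).

Lemma shomP U V (f : 'Hom(U, V)) :
  (forall u, f (oddp U u) = oddp V (f u)) -> f \in submod_pred (even_closed U V).
Proof. by move=> e; apply/eqP/lfunP => u; rewrite !comp_lfunE e. Qed.

Lemma shom_odd U V (f : shom U V) u : submod_val f (oddp U u) = oddp V (submod_val f u).
Proof. by have /eqP/lfunP/(_ u) := submodP f; rewrite !comp_lfunE. Qed.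

Definition mkshom U V (f : 'Hom(U, V))
    (e : forall u, f (oddp U u) = oddp V (f u)) : shom U V :=
  SubMod (shomP e).

Arguments mkshom {U V} & f e.

Lemma shom_eq U V (f g : shom U V) :
  (submod_val f = submod_val g) -> f = g.
Proof. exact: submod_inj. Qed.

Definition homog V (a : bool) (v : V) := oddp V v = a%:R *: v.

Lemma homog_ext V (W : vectType L) (f g : 'Hom(V, W)) :
  (forall a v, homog a v -> f v = g v) -> f = g.
Proof.
move=> e; apply/lfunP => v.
have i x : oddp V (oddp V x) = oddp V x.
  by rewrite -[LHS]comp_lfunE oddp_idem.
rewrite -[v](subrK (oddp V v)) [LHS]linearD [RHS]linearD; congr (_ + _).
  by apply: (e false); rewrite /homog linearB /= i subrr scale0r.
by apply: (e true); rewrite /homog i scale1r.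
Qed.

Lemma homog_ext2 U V (W : vectType L) (f g : 'Hom(tsp U V, W)) :
  (forall a b u v, homog a u -> homog b v -> f (pure u v) = g (pure u v)) ->
  f = g.
Proof.
move=> e; apply: tsp_ext => u v.
pose F (h : 'Hom(tsp U V, W)) v := linfun (fun u : U => h (pure u v)).
have FE h x y : F h y x = h (pure x y).
  by rewrite linfunE // => a y' z; rewrite pureDl pureZl linearP.
suff /lfunP/(_ u) : F f v = F g v by rewrite !FE.
apply: homog_ext => a {}u hu.
pose G (h : 'Hom(tsp U V, W)) := linfun (fun v : V => h (pure u v)).
have GE h y : G h y = h (pure u y).
  by rewrite linfunE // => c y' z; rewrite pureDr pureZr linearP.
suff /lfunP/(_ v) : G f = G g by rewrite !FE !GE.
by apply: homog_ext => b {}v hv; rewrite !GE; apply: e hu hv.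
Qed.

Lemma homog_ext3 U V W (Z : vectType L) (f g : 'Hom(tsp (tsp U V) W, Z)) :
  (forall a b c u v w, homog a u -> homog b v -> homog c w ->
     f (pure (pure u v) w) = g (pure (pure u v) w)) ->
  f = g.
Proof.
move=> e; apply: tsp_ext => m w.
pose G m (h : 'Hom(tsp (tsp U V) W, Z)) := linfun (fun w : W => h (pure m w)).
have GE y m' h : G m' h y = h (pure m' y).
  by rewrite linfunE // => c y' z; rewrite pureDr pureZr linearP.
suff /lfunP/(_ w) : G m f = G m g by rewrite !GE.
apply: homog_ext => c {}w hw; rewrite !GE.
pose F (h : 'Hom(tsp (tsp U V) W, Z)) := linfun (fun m => h (pure m w)).
have FE h x : F h x = h (pure x w).
  by rewrite linfunE // => a y z; rewrite pureDl pureZl linearP.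
suff /lfunP/(_ m) : F f = F g by rewrite !FE.
by apply: homog_ext2 => a b u v hu hv; rewrite !FE; apply: e hu hv hw.
Qed.

(* u ⊗ v is odd when exactly one of u and v is odd *)
Definition sodd U V : 'End(tsp U V) :=
  thom (oddp U) \1%VF + thom \1%VF (oddp V) - 2%:R *: thom (oddp U) (oddp V).

Lemma soddE U V a b (u : U) (v : V) : homog a u -> homog b v ->
  sodd U V (pure u v) = (a (+) b)%:R *: pure u v.
Proof.
move=> hu hv; rewrite !(add_lfunE, opp_lfunE, scale_lfunE, thomE, id_lfunE).
rewrite hu hv !(pureZl, pureZr) !scalerA -!scalerDl -scalerBl.
by congr (_ *: _); case: a {hu}; case: b {hv};
   rewrite ?(mulr0, mulr1, mul0r, subr0, add0r, addr0, subrr, oppr0).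
Qed.

Lemma sodd_idem U V : (sodd U V \o sodd U V)%VF = sodd U V.
Proof.
apply: homog_ext2 => a b u v hu hv.
rewrite comp_lfunE (soddE hu hv) linearZ /= (soddE hu hv) scalerA.
by case: (_ (+) _); rewrite ?mulr1 ?mulr0.
Qed.

Definition stens U V : superVec L := SuperVec (sodd_idem U V).

Lemma homog_pure U V a b (u : U) (v : V) : homog a u -> homog b v ->
  homog (V := stens U V) (a (+) b) (pure u v).
Proof. exact: soddE. Qed.

Lemma sunit_idem :
  ((0 : 'End(L^o)) \o (0 : 'End(L^o)))%VF = (0 : 'End(L^o)).
Proof. by rewrite comp_lfun0l. Qed.
Definition sunit : superVec L := @SuperVec L L^o 0 sunit_idem.
Lemma homog_sunit (a : sunit) : homog false a.
Proof. by rewrite /homog zero_lfunE scale0r. Qed.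

(* the Koszul rule: v ⊗ w is sent to - w ⊗ v if both are odd, and to w ⊗ v
   if one of them is even *)
Definition ksymm U V : 'Hom(tsp U V, tsp V U) :=
  (tmap (fun u v => pure v u) \o (\1 - 2%:R *: thom (oddp U) (oddp V)))%VF.

Lemma ksymmE U V a b (u : U) (v : V) : homog a u -> homog b v ->
  ksymm U V (pure u v) = (-1) ^+ (a && b) *: pure v u.
Proof.
move=> hu hv; rewrite comp_lfunE.
rewrite !(add_lfunE, opp_lfunE, scale_lfunE, thomE, id_lfunE).
rewrite hu hv !(pureZl, pureZr) !scalerA -[X in _ (X - _)]scale1r -scalerBl.
rewrite linearZ /= tmap_pure; [|exact: pure_linear_r|exact: pure_linear_l].
by congr (_ *: _); case: a {hu}; case: b {hv};
   rewrite ?(mulr0, mulr1, mul0r, subr0) // opprD addrA subrr add0r.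
Qed.

Lemma even_comp U V W (g : shom V W) (f : shom U V) :
  forall u, (submod_val g \o submod_val f)%VF (oddp U u) =
            oddp W ((submod_val g \o submod_val f)%VF u).
Proof. by move=> u; rewrite !comp_lfunE !shom_odd. Qed.
Lemma even_id U : forall u, (\1 : 'End(U))%VF (oddp U u) = oddp U (\1%VF u).
Proof. by move=> u; rewrite !id_lfunE. Qed.

Definition scomp U V W (g : shom V W) (f : shom U V) : shom U W :=
  mkshom (submod_val g \o submod_val f)%VF (even_comp g f).
Definition sid U : shom U U := mkshom \1%VF (even_id (U := U)).

Lemma homog_shom U V a (f : shom U V) u :
  homog a u -> homog a (submod_val f u).
Proof. by move=> hu; rewrite /homog -shom_odd hu linearZ. Qed.

Lemma even_hom_ext U V W (f : 'Hom(tsp U V, W)) :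
  (forall a b (u : U) (v : V), homog a u -> homog b v ->
     homog (a (+) b) (f (pure u v))) ->
  forall m, f (oddp (stens U V) m) = oddp W (f m).
Proof.
move=> e m; rewrite -!comp_lfunE; move: m; apply/lfunP.
apply: homog_ext2 => a b u v hu hv.
by rewrite !comp_lfunE (homog_pure hu hv) linearZ /= (e _ _ _ _ hu hv).
Qed.

Lemma even_tens U U' V V' (f : shom U U') (g : shom V V') :
  forall m, thom (submod_val f) (submod_val g) (oddp (stens U V) m) =
    oddp (stens U' V') (thom (submod_val f) (submod_val g) m).
Proof.
apply: (@even_hom_ext U V (stens U' V')) => a b u v hu hv; rewrite thomE.
by apply: homog_pure; apply: homog_shom.
Qed.
Definition stensh U U' V V' (f : shom U U') (g : shom V V') :
  shom (stens U V) (stens U' V') := mkshom (thom (submod_val f) (submod_val g)) (even_tens f g).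

Lemma even_assoc U V W : forall m,
  tassoc U V W (oddp (stens (stens U V) W) m) =
  oddp (stens U (stens V W)) (tassoc U V W m).
Proof.
move=> m; rewrite -!comp_lfunE; move: m; apply/lfunP.
apply: (@homog_ext3 U V W) => a b c u v w hu hv hw.
rewrite !comp_lfunE (homog_pure (homog_pure hu hv) hw) linearZ /= tassocE.
by rewrite (homog_pure hu (homog_pure hv hw)) addbA.
Qed.
Definition sassoc U V W : shom (stens (stens U V) W) (stens U (stens V W)) :=
  mkshom (tassoc U V W) (even_assoc (U := U) (V := V) (W := W)).

Lemma tassocK U V W : (tassoc' U V W \o tassoc U V W)%VF = \1%VF.
Proof.
by apply: tsp_ext3 => u v w; rewrite comp_lfunE id_lfunE tassocE tassoc'E.
Qed.
Lemma tassocK' U V W : (tassoc U V W \o tassoc' U V W)%VF = \1%VF.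
Proof.
by apply: tsp_ext3' => u v w; rewrite comp_lfunE id_lfunE tassoc'E tassocE.
Qed.

Lemma even_inv U V (f : 'Hom(U, V)) (g : 'Hom(V, U)) :
  (f \o g)%VF = \1%VF -> (g \o f)%VF = \1%VF ->
  (forall u, f (oddp U u) = oddp V (f u)) ->
  forall v, g (oddp V v) = oddp U (g v).
Proof.
move=> /lfunP fg /lfunP gf e v.
have -> : v = f (g v) by have := fg v; rewrite comp_lfunE id_lfunE.
rewrite -e; have := gf (oddp U (g v)); rewrite comp_lfunE id_lfunE => ->.
by have := gf (g v); rewrite comp_lfunE id_lfunE => ->.
Qed.

Lemma even_assoc' U V W : forall m,
  tassoc' U V W (oddp (stens U (stens V W)) m) =
  oddp (stens (stens U V) W) (tassoc' U V W m).
Proof.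
apply: (@even_inv (stens (stens U V) W) (stens U (stens V W)) (tassoc U V W)).
- exact: tassocK'.
- exact: tassocK.
- exact: even_assoc.
Qed.
Definition sassoc' U V W : shom (stens U (stens V W)) (stens (stens U V) W) :=
  mkshom (tassoc' U V W) (even_assoc' (U := U) (V := V) (W := W)).

Lemma even_lunit U : forall m,
  tlunit U (oddp (stens sunit U) m) = oddp U (tlunit U m).
Proof.
apply: (@even_hom_ext sunit U U) => a b x u hx hu.
rewrite tlunitE /homog linearZ /= hu !scalerA; move: hx.
rewrite /homog zero_lfunE => /esym/eqP; rewrite scaler_eq0.
case: a => /= [/orP[|/eqP->]|_]; rewrite ?oner_eq0 ?mulr0 ?mul0r ?scale0r //.
by rewrite mulrC.
Qed.
Definition slunit U : shom (stens sunit U) U := mkshom (tlunit U) (even_lunit (U := U)).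
Lemma tlunitK (U : vectType L) : (tlunit' U \o tlunit U)%VF = \1%VF.
Proof.
apply: tsp_ext => x u; rewrite comp_lfunE id_lfunE tlunitE tlunit'E.
by rewrite pureZr -pureZl [_ *: _]mulr1.
Qed.
Lemma tlunitK' (U : vectType L) : (tlunit U \o tlunit' U)%VF = \1%VF.
Proof.
by apply/lfunP => u; rewrite comp_lfunE id_lfunE tlunit'E tlunitE scale1r.
Qed.
Lemma even_lunit' U : forall m,
  tlunit' U (oddp U m) = oddp (stens sunit U) (tlunit' U m).
Proof.
apply: (@even_inv (stens sunit U) U (tlunit U)).
- exact: tlunitK'.
- exact: tlunitK.
- exact: even_lunit.
Qed.
Definition slunit' U : shom U (stens sunit U) := mkshom (tlunit' U) (even_lunit' (U := U)).

Lemma even_runit U : forall m,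
  trunit U (oddp (stens U sunit) m) = oddp U (trunit U m).
Proof.
apply: (@even_hom_ext U sunit U) => b a u x hu hx.
rewrite trunitE /homog linearZ /= hu !scalerA; move: hx.
rewrite /homog zero_lfunE => /esym/eqP; rewrite scaler_eq0.
case: a => /= [/orP[|/eqP->]|_]; rewrite ?oner_eq0 ?mulr0 ?mul0r ?scale0r //.
by rewrite addbF mulrC.
Qed.
Definition srunit U : shom (stens U sunit) U := mkshom (trunit U) (even_runit (U := U)).
Lemma trunitK (U : vectType L) : (trunit' U \o trunit U)%VF = \1%VF.
Proof.
apply: tsp_ext => u x; rewrite comp_lfunE id_lfunE trunitE trunit'E.
by rewrite pureZl -pureZr [_ *: _]mulr1.
Qed.
Lemma trunitK' (U : vectType L) : (trunit U \o trunit' U)%VF = \1%VF.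
Proof.
by apply/lfunP => u; rewrite comp_lfunE id_lfunE trunit'E trunitE scale1r.
Qed.
Lemma even_runit' U : forall m,
  trunit' U (oddp U m) = oddp (stens U sunit) (trunit' U m).
Proof.
apply: (@even_inv (stens U sunit) U (trunit U)).
- exact: trunitK'.
- exact: trunitK.
- exact: even_runit.
Qed.
Definition srunit' U : shom U (stens U sunit) := mkshom (trunit' U) (even_runit' (U := U)).

Lemma even_symm U V : forall m,
  ksymm U V (oddp (stens U V) m) = oddp (stens V U) (ksymm U V m).
Proof.
apply: (@even_hom_ext U V (stens V U)) => a b u v hu hv.
rewrite (ksymmE hu hv) /homog linearZ /= (homog_pure hv hu).
by rewrite !scalerA mulrC addbC.
Qed.
Definition ssymm U V : shom (stens U V) (stens V U) :=
  mkshom (ksymm U V) (even_symm (U := U) (V := V)).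

Definition sVec_lin : linCat L.
Proof.
refine (@LinCat L (superVec L) shom sid scomp _ _ _ _ _).
- by move=> X Y Z W h g f; apply/shom_eq/comp_lfunA.
- by move=> X Y f; apply/shom_eq/comp_lfun1l.
- by move=> X Y f; apply/shom_eq/comp_lfun1r.
- by move=> X Y Z f a g g'; apply: shom_eq;
     rewrite /= comp_lfunDl -comp_lfunZl.
- by move=> X Y Z g a f f'; apply: shom_eq;
     rewrite /= comp_lfunDr -comp_lfunZr.
Defined.

Definition sVec : symCat L.
Proof.
refine (@SymCat L sVec_lin sunit stens stensh sassoc sassoc' slunit slunit'
  srunit srunit' ssymm _ _ _ _ _ _ _ _ _ _ _ _ _ _ _ _ _ _ _ _);
  rewrite /comp /=.
- by move=> X Y; apply: submod_inj => /=; apply: tsp_ext => u v;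
     rewrite thomE !id_lfunE.
- by move=> X X' X'' Y Y' Y'' f' f g' g; apply: submod_inj => /=; apply: tsp_ext => u v;
     rewrite !(comp_lfunE, thomE).
- by move=> X X' Y Y' g a f f'; apply: submod_inj => /=; apply: tsp_ext => u v;
     rewrite /= !(add_lfunE, scale_lfunE, thomE) pureDl pureZl.
- by move=> X X' Y Y' g a f f'; apply: submod_inj => /=; apply: tsp_ext => u v;
     rewrite /= !(add_lfunE, scale_lfunE, thomE) pureDr pureZr.
- by move=> X Y Z; apply/submod_inj/tassocK.
- by move=> X Y Z; apply/submod_inj/tassocK'.
- by move=> X; apply/submod_inj/tlunitK.
- by move=> X; apply/submod_inj/tlunitK'.
- by move=> X; apply/submod_inj/trunitK.
- by move=> X; apply/submod_inj/trunitK'.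
- move=> X Y; apply: submod_inj => /=; apply: homog_ext2 => a b u v hu hv.
  rewrite comp_lfunE (ksymmE hu hv) linearZ /= (ksymmE hv hu) scalerA.
  by rewrite andbC -expr2 sqrr_sign scale1r id_lfunE.
- by move=> X X' Y Y' Z Z' f g h; apply: submod_inj => /=; apply: tsp_ext3 => u v w;
     rewrite /= !(comp_lfunE, thomE, tassocE).
- by move=> X X' f; apply: submod_inj => /=; apply: tsp_ext => x u;
     rewrite /= !(comp_lfunE, thomE, tlunitE) id_lfunE linearZ.
- by move=> X X' f; apply: submod_inj => /=; apply: tsp_ext => u x;
     rewrite /= !(comp_lfunE, thomE, trunitE) id_lfunE linearZ.
- move=> X X' Y Y' f g; apply: submod_inj => /=; apply: homog_ext2 => a b u v hu hv.
  rewrite [LHS]comp_lfunE [RHS]comp_lfunE thomE; rewrite (ksymmE hu hv) linearZ /= thomE.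
  by rewrite (ksymmE (homog_shom f hu) (homog_shom g hv)).
- by move=> W X Y Z; apply: submod_inj => /=; apply: tsp_ext4 => w x y z;
     rewrite /= !(comp_lfunE, thomE, tassocE, id_lfunE).
- by move=> X Y; apply: submod_inj => /=; apply: tsp_ext3 => x a y;
     rewrite /= !(comp_lfunE, thomE, tassocE, tlunitE, trunitE, id_lfunE)
       pureZl pureZr.
- move=> X Y Z; apply: submod_inj.
  apply: (@homog_ext3 X Y Z) => a b c u v w hu hv hw.
  do 2![rewrite [LHS]comp_lfunE]; do 2![rewrite [RHS]comp_lfunE].
  rewrite tassocE (ksymmE hu (homog_pure hv hw)) linearZ /=.
  rewrite tassocE thomE (ksymmE hu hv) id_lfunE pureZl !linearZ /=.
  rewrite tassocE thomE id_lfunE (ksymmE hu hw) pureZr scalerA.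
  by rewrite -signr_addb andb_addr.
- move=> X; apply: submod_inj => /=; apply: (@homog_ext2 X sunit) => a b u x hu hx.
  rewrite /= comp_lfunE (ksymmE hu (homog_sunit x)) andbF scale1r.
  by rewrite tlunitE trunitE.
- apply: submod_inj => /=; apply: tsp_ext => x y.
  by rewrite /= tlunitE trunitE [LHS]mulrC.
Defined.
End SuperHom.

(* K-linear (along iota : K -> L) strong symmetric monoidal functors *)
Record tensorFunctor (K L : fieldType) (iota : {rmorphism K -> L})
    (A : symCat K) (B : symCat L) := TensorFunctor {
  fobj :> A -> B;
  fhom : forall X Y : A, hom X Y -> hom (fobj X) (fobj Y);
  fmu : forall X Y : A, hom (fobj X ⊗ fobj Y) (fobj (X ⊗ Y));
  fmu' : forall X Y : A, hom (fobj (X ⊗ Y)) (fobj X ⊗ fobj Y);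
  feta : hom unit (fobj unit);
  feta' : hom (fobj unit) unit;
  fhom_semilin : forall X Y, semilin iota (@fhom X Y);
  fhom_id : forall X, fhom (idc X) = idc (fobj X);
  fhom_comp : forall X Y Z (g : hom Y Z) (f : hom X Y),
    fhom (g ∘ f) = fhom g ∘ fhom f;
  fmuK : forall X Y, fmu' X Y ∘ fmu X Y = idc _;
  fmuK' : forall X Y, fmu X Y ∘ fmu' X Y = idc _;
  fetaK : feta' ∘ feta = idc _;
  fetaK' : feta ∘ feta' = idc _;
  fmu_nat : forall X X' Y Y' (f : hom X X') (g : hom Y Y'),
    fmu X' Y' ∘ (fhom f ⊠ fhom g) = fhom (f ⊠ g) ∘ fmu X Y;
  fmu_assoc : forall X Y Z,
    fhom (assoc X Y Z) ∘ fmu (X ⊗ Y) Z ∘ (fmu X Y ⊠ idc (fobj Z)) =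
    fmu X (Y ⊗ Z) ∘ (idc (fobj X) ⊠ fmu Y Z)
      ∘ assoc (fobj X) (fobj Y) (fobj Z);
  fmu_lunit : forall X,
    fhom (lunit X) ∘ fmu unit X ∘ (feta ⊠ idc (fobj X)) = lunit (fobj X);
  fmu_runit : forall X,
    fhom (runit X) ∘ fmu X unit ∘ (idc (fobj X) ⊠ feta) = runit (fobj X);
  fmu_symm : forall X Y,
    fhom (symm X Y) ∘ fmu X Y = fmu Y X ∘ symm (fobj X) (fobj Y) }.

Arguments fhom {K L iota A B} t {X Y} f.

Definition isomorphic (K : fieldType) (A : linCat K) (X Y : A) : Prop :=
  exists (f : hom X Y) (g : hom Y X), g ∘ f = idc X /\ f ∘ g = idc Y.

Definition tensor_equivalent (K : fieldType) (A B : symCat K) : Prop :=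
  exists F : tensorFunctor (@idfun K) A B,
    (forall X Y : A, bijective (@fhom _ _ _ _ _ F X Y)) /\
    (forall Y : B, exists X : A, isomorphic (F X) Y).

Definition homological_type (K : fieldType) (A : rigidCat K) : Prop :=
  exists (L : fieldType) (iota : {rmorphism K -> L}),
    inhabited (tensorFunctor iota A (sVec L)).

Definition homological_origin (K : fieldType) (B : rigidCat K) : Prop :=
  exists A : rigidCat K,
    homological_type A /\ tensor_equivalent B (quot_rigid A).

Definition endo (K : fieldType) (A : linCat K) (X : A) : Type := hom X X.

Section Endo.
Variables (K : fieldType) (A : linCat K) (X : A).
HB.instance Definition _ := GRing.Lmodule.on (endo X).
HB.instance Definition _ := GRing.Zmodule_isPzRing.Build (endo X)
  (fun f g h : endo X => compA f g h) (fun f : endo X => comp1f f)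
  (fun f : endo X => compf1 f)
  (fun f g h : endo X => compDl f g h)
  (fun f g h : endo X => compDr f g h).
End Endo.

Definition left_ideal (R : pzRingType) (I : R -> Prop) : Prop :=
  [/\ I 0, forall x y, I x -> I y -> I (x + y) & forall a x, I x -> I (a * x)].

(* every left ideal of R is a direct summand *)
Definition semisimple_ring (R : pzRingType) : Prop :=
  forall I : R -> Prop, left_ideal I ->
    exists2 J : R -> Prop, left_ideal J &
      (forall x, I x -> J x -> x = 0) /\
      (forall x, exists y z, [/\ I y, J z & x = y + z]).

Definition semisimple_cat (K : fieldType) (A : rigidCat K) : Prop :=
  forall M : A, semisimple_ring (endo M).

Section ReducedTrace.
Variables (K : fieldType) (B : falgType K).

Definition simple_algebra : Prop :=
  forall I : {vspace B}, (fullv * I <= I)%VS -> (I * fullv <= I)%VS ->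
    I = 0%VS \/ I = fullv.

(* phi restricts to an embedding of the centre Z in E, and induces an
   isomorphism from B ⊗_Z E to M_n(E). *)
Definition is_splitting (E : fieldType) (n : nat) (phi : {rmorphism B -> 'M[E]_n})
    : Prop :=
  (forall z, z \in 'Z({:B})%VS -> is_scalar_mx (phi z)) /\
  (n ^ 2 * \dim 'Z({:B}) = \dim {:B})%N.

(* t = Trd_{B/Z} *)
Definition is_Trd_center (t : B -> B) : Prop :=
  exists (E : fieldType) (n : nat) (phi : {rmorphism B -> 'M[E]_n}),
    is_splitting phi /\
    forall b, t b \in 'Z({:B})%VS /\ phi (t b) = (\tr (phi b))%:M.

(* Tr_{Z/K} *)
Definition center_trace (z : B) : K :=
  let bZ := vbasis 'Z({:B}) in \sum_i coord bZ i (z * bZ`_i).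

Definition is_Trd (T : B -> K) : Prop :=
  exists2 t, is_Trd_center t & forall b, T b = center_trace (t b).

End ReducedTrace.

Section IntegralType.
Variables (K : fieldType) (A : rigidCat K).

Definition is_wedderburn_decomposition (M : A) (r : nat)
    (B : 'I_r -> falgType K) (phi : forall i, endo M -> B i) : Prop :=
  [/\ forall i, simple_algebra (B i),
      forall i, linear (phi i),
      forall i, monoid_morphism (phi i) &
      forall b : (forall i, B i), exists! f, forall i, phi i f = b i].

Definition is_multiplicity (M : A) (r : nat) (B : 'I_r -> falgType K)
    (phi : forall i, endo M -> B i) (mu : forall i, B i) : Prop :=
  (forall i, mu i \in 'Z({:B i})%VS) /\
  exists2 T : forall i, B i -> K, forall i, is_Trd (T i) &
    forall f : endo M, tr f = \sum_i T i (mu i * phi i f).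

Definition integral_type (M : A) : Prop :=
  exists (r : nat) (B : 'I_r -> falgType K) (phi : forall i, endo M -> B i)
         (mu : forall i, B i),
    [/\ is_wedderburn_decomposition phi, is_multiplicity phi mu &
        forall i, exists n : int, mu i = n%:~R].

End IntegralType.

Definition is_algebraic_closure (K Kb : fieldType) (iota : {rmorphism K -> Kb})
    : Prop :=
  GRing.closed_field_axiom Kb /\ forall x : Kb, algebraicOver iota x.

Definition geometrically_integral_type (K : fieldType) (A : rigidCat K) (M : A)
    : Prop :=
  forall (Kb : fieldType) (iota : {rmorphism K -> Kb}),
    is_algebraic_closure iota -> integral_type (M : scalext_rigid iota A).

Definition geometrically_integral_cat (K : fieldType) (A : rigidCat K) : Prop :=
  forall M : A, geometrically_integral_type M.

Section Karoubi.
Variables (K : fieldType) (A : linCat K).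

Record karObj := KarObj {
  kobj : A;
  kidem : hom kobj kobj;
  kidemP : kidem ∘ kidem = kidem }.
Implicit Types X Y Z : karObj.

Definition kar_pred X Y : {pred hom (kobj X) (kobj Y)} :=
  fun f => kidem Y ∘ f ∘ kidem X == f.

Lemma kar_closed X Y : submod_closed (kar_pred (X := X) (Y := Y)).
Proof.
split=> [|a f g /eqP ef /eqP eg]; apply/eqP; first by rewrite compf0 comp0f.
by rewrite compDr compDl compZr compZl ef eg.
Qed.

Definition khom X Y : lmodType K := submod (kar_closed X Y).

Lemma khomP X Y (f : khom X Y) : kidem Y ∘ submod_val f ∘ kidem X = submod_val f.
Proof. exact/eqP/(submodP f). Qed.
Lemma khom_l X Y (f : khom X Y) : kidem Y ∘ submod_val f = submod_val f.
Proof. by rewrite -khomP !compA kidemP. Qed.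
Lemma khom_r X Y (f : khom X Y) : submod_val f ∘ kidem X = submod_val f.
Proof. by rewrite -khomP -!compA kidemP. Qed.

Lemma kid_subproof X : kidem X \in submod_pred (kar_closed X X).
Proof. by apply/eqP; rewrite !kidemP. Qed.
Definition kid X : khom X X := SubMod (kid_subproof X).

Lemma kcomp_subproof X Y Z (g : khom Y Z) (f : khom X Y) :
  submod_val g ∘ submod_val f \in submod_pred (kar_closed X Z).
Proof. by apply/eqP; rewrite compA khom_l -compA khom_r. Qed.
Definition kcomp X Y Z (g : khom Y Z) (f : khom X Y) : khom X Z :=
  SubMod (kcomp_subproof g f).

Definition karoubi : linCat K.
Proof.
refine (@LinCat K karObj khom kid kcomp _ _ _ _ _).
- by move=> X Y Z W h g f; apply/submod_inj/compA.
- by move=> X Y f; apply/submod_inj/khom_l.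
- by move=> X Y f; apply/submod_inj/khom_r.
- by move=> X Y Z f a g g'; apply/submod_inj/comp_linear_l.
- by move=> X Y Z g a f f'; apply/submod_inj/comp_linear_r.
Defined.

Lemma idc_idem (X : A) : idc X ∘ idc X = idc X.
Proof. exact: comp1f. Qed.
Definition kar_in (X : A) : karoubi := KarObj (idc_idem X).

Lemma kar_map_subproof (X Y : A) (f : hom X Y) :
  f \in submod_pred (kar_closed (KarObj (idc_idem X)) (KarObj (idc_idem Y))).
Proof. by apply/eqP; rewrite /= comp1f compf1. Qed.
Definition kar_map (X Y : A) (f : hom X Y) : hom (kar_in X) (kar_in Y) :=
  SubMod (kar_map_subproof f).

End Karoubi.

(* S is the image of f: f factors as a split epimorphism onto S followed by a
   split monomorphism. *)
Definition is_image (K : fieldType) (A : linCat K) (X Y : A) (f : hom X Y)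
    (S : A) : Prop :=
  exists (p : hom X S) (i : hom S Y) (s : hom S X) (r : hom Y S),
    [/\ p ∘ s = idc S, r ∘ i = idc S & f = i ∘ p].

Section Schur.
Variables (K : fieldType) (A : symCat K).

Fixpoint tpow (M : A) (n : nat) : A :=
  if n is m.+1 then M ⊗ tpow M m else unit.

(* x_0 ⊗ (x_1 ⊗ y) |-> x_1 ⊗ (x_0 ⊗ y) *)
Definition swap01 (X Y P : A) : hom (X ⊗ (Y ⊗ P)) (Y ⊗ (X ⊗ P)) :=
  assoc Y X P ∘ (symm X Y ⊠ idc P) ∘ assoc' X Y P.

(* moves the first factor of M^{⊗ n+1} to position k *)
Fixpoint insert_first (M : A) (n k : nat) {struct n} :
    hom (M ⊗ tpow M n) (M ⊗ tpow M n) :=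
  match n, k with
  | m.+1, k'.+1 => (idc M ⊠ insert_first M m k') ∘ swap01 M M (tpow M m)
  | _, _ => idc _
  end.

(* The action of s on M^{⊗ n} by the symmetry, sending the factor in position i
   to position s i: the permutation s' describes where the factors other than
   the first one go relative to each other. *)
Fixpoint perm_act (M : A) (n : nat) : 'S_n -> hom (tpow M n) (tpow M n) :=
  match n with
  | 0 => fun _ => idc _
  | m.+1 => fun s =>
      let s' := odflt 1%g [pick s' : 'S_m | lift_perm ord0 (s ord0) s' == s] in
      insert_first M m (s ord0) ∘ (idc M ⊠ perm_act M s')
  end.

End Schur.

Definition is_partition (la : seq nat) : bool :=
  sorted geq la && all (leq 1) la.

(* The boxes of the Young diagram of la are numbered from 0 row by row;
   box i is in row reshape_index la i and column reshape_offset la i. *)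
Definition row_stab (la : seq nat) : {set 'S_(sumn la)} :=
  [set s : 'S_(sumn la) |
    [forall i, reshape_index la (s i) == reshape_index la i]].
Definition col_stab (la : seq nat) : {set 'S_(sumn la)} :=
  [set s : 'S_(sumn la) |
    [forall i, reshape_offset la (s i) == reshape_offset la i]].

Section SchurFunctor.
Variables (K : fieldType) (A : symCat K).

(* the action on M^{⊗ n} of the Young symmetrizer c_la = a_la b_la *)
Definition young_symmetrizer (la : seq nat) (M : A) :
    hom (tpow M (sumn la)) (tpow M (sumn la)) :=
  (\sum_(p in row_stab la) perm_act M p) ∘
  (\sum_(q in col_stab la) (-1) ^+ q *: perm_act M q).

(* The Schur functor S_la sends M to the image of c_la on M^{⊗ n}; the image
   exists in the idempotent completion because c_la is a nonzero multiple of
   an idempotent. *)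
Definition is_schur (la : seq nat) (M : A) (S : karoubi A) : Prop :=
  is_image (kar_map (young_symmetrizer la M)) S.

(* A nonzero Schur functor is a nonempty direct sum of functors S_la, so that
   it is enough to consider the latter. *)
Definition schur_finite (M : A) : Prop :=
  exists la : seq nat, is_partition la /\
    exists S : karoubi A, is_schur la M S /\ is_zero S.

End SchurFunctor.

(* Main.v *)
From HB Require Import structures.
From mathcomp Require Import all_boot all_order all_algebra all_fingroup all_field.
From mathcomp Require Import boolp ring zify.
Require Import Defs.

(** Let H be a realisation, over an extension L of K, of a category whose
    quotient by the ideal N is equivalent to A; let M be an object of A, and X an
    object lifting it. Everything rests on two facts: H preserves traces, and a
    morphism killed by H lies in N.

    Schur-finiteness. By the second fact it is enough to find a partition la whose
    Young symmetrizer vanishes on the tensor power of the super vector space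
    V = H(X). For d = dim V, take the rectangle with d + 1 rows and d (d + 1) + 1
    columns, which is in general larger than the one of the hook theorem but makes the
    vanishing elementary ([syoung_eq0]): fill the boxes with homogeneous vectors of
    a spanning set. Two equal even vectors in a column are killed by the column
    antisymmetrizer; otherwise every column contains an odd vector, so that, after
    any permutation of the boxes inside the columns, some row contains two equal
    odd vectors, and is killed by the row symmetrizer, which antisymmetrizes odd
    vectors. The signs come from an explicit formula for the action of a
    permutation on a pure tensor ([perm_ptens]): it counts the inversions between odd vectors.

    Integrality. The super trace of H computes the traces of all products of
    endomorphisms of M ([trace_model]). As the trace form on End(M) is
    nondegenerate, it has dual bases ([dual_bases]), at most (dim V)^2 elements
    long; they remain dual bases of the extended algebra E = End(M) ⊗ Kb, which is
    therefore finite-dimensional with a nondegenerate trace form. A given u in E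
    has its coordinates in a subfield K1 of Kb, finitely generated over K, that
    has a common extension L1 with L ([compositum]); hence the traces of the
    powers of u are the super traces of the powers of a matrix Q over L1
    ([power_model]). Polynomials in Q that are spectral projections show that
    the trace of u is an integer when u is idempotent ([etr_idempotent]), namely a
    difference of ranks, and is zero when u is nilpotent ([etr_nilpotent]).

    It remains to determine the algebras over an algebraically closed field with a
    nondegenerate trace form that vanishes on nilpotent elements. A minimal right
    ideal of such an algebra contains a non-nilpotent element, so it is generated
    by an idempotent e such that eEe consists of the scalars ([corner_idempotent]);
    this gives a decomposition of 1 into such idempotents, then matrix units, and E
    is a product of matrix algebras. On each factor the trace form is the matrix
    trace multiplied by the value of the form on one of those idempotents
    ([wedderburn_trace]): these values are the multiplicities, and are integers. *)

Set Implicit Arguments.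
Unset Strict Implicit.
Unset Printing Implicit Defensive.

Import GRing.Theory.
Local Open Scope ring_scope.
Local Open Scope cat_scope.

(** * Tensor functors, dualities and traces *)

Section FunctorTheory.
Variables (K L : fieldType) (iota : {rmorphism K -> L}).

Section Linear.
Variables (A : symCat K) (B : symCat L) (F : tensorFunctor iota A B).

Lemma fhomD (X Y : A) (f g : hom X Y) : fhom F (f + g) = fhom F f + fhom F g.
Proof. by have := fhom_semilin F 1 f g; rewrite rmorph1 !scale1r. Qed.
Lemma fhom0 (X Y : A) : fhom F (0 : hom X Y) = 0.
Proof. by apply: (addrI (fhom F 0)); rewrite -fhomD !addr0. Qed.
Lemma fhomZ (X Y : A) a (f : hom X Y) : fhom F (a *: f) = iota a *: fhom F f.
Proof. by have := fhom_semilin F a f 0; rewrite fhom0 !addr0. Qed.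
Lemma fhom_sum (X Y : A) I r (P : pred I) (f : I -> hom X Y) :
  fhom F (\sum_(i <- r | P i) f i) = \sum_(i <- r | P i) fhom F (f i).
Proof.
by elim/big_rec2: _ => [|i x y _ <-]; [exact: fhom0 | rewrite fhomD].
Qed.
End Linear.

Section Duality.
Variables (A : rigidCat K) (B : symCat L) (F : tensorFunctor iota A B).
Implicit Types X : A.

Definition fev X : hom (F (dual X) ⊗ F X) unit :=
  feta' F ∘ fhom F (ev X) ∘ fmu F (dual X) X.
Definition fcoev X : hom unit (F X ⊗ F (dual X)) :=
  fmu' F X (dual X) ∘ fhom F (coev X) ∘ feta F.

(** [fev] and [fcoev] make F (dual X) a dual of F X; one of the two triangle
    identities is enough to compare it with any other dual. *)
Lemma fzigzag X :
  runit (F X) ∘ (idc (F X) ⊠ fev X) ∘ assoc _ _ _ ∘ (fcoev X ⊠ idc (F X))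
    ∘ lunit' (F X) = idc (F X).
Proof.
have eR : runit (F X) ∘ (idc (F X) ⊠ fev X) =
    fhom F (runit X) ∘ fhom F (idc X ⊠ ev X) ∘ fmu F _ _ ∘ (idc _ ⊠ fmu F _ _).
  rewrite -fmu_runit -[in LHS]compA tensh_idl /fev !compA fetaK' comp1f.
  by rewrite -[LHS]compA -tensh_idl !compA -(compA _ (fmu F X unit)) -fhom_id
    fmu_nat !compA.
have eL : fmu F _ _ ∘ ((fmu F X (dual X) ∘ fcoev X) ⊠ idc (F X))
    ∘ lunit' (F X) = fhom F (coev X ⊠ idc X) ∘ fhom F (lunit' X).
  rewrite /fcoev !compA fmuK' comp1f -tensh_idr !compA -fhom_id fmu_nat.
  rewrite -!compA; congr (_ ∘ _).
  apply: (iso_cancell (i := fhom F (lunit X)) (j := fhom F (lunit' X))).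
    by rewrite -fhom_comp lunitK fhom_id.
  by rewrite -fhom_comp lunitK' !compA fhom_id fmu_lunit lunitK'.
rewrite eR -(compA _ (fmu F X _)) -(compA _ (_ ∘ _) (assoc _ _ _)).
rewrite -fmu_assoc -!compA.
rewrite (compA (fmu F X (dual X) ⊠ _)) tensh_idr.
rewrite [fmu F _ _ ∘ (_ ∘ _)]compA eL -!fhom_comp !compA.
by rewrite zigzag_l fhom_id.
Qed.

(** The loop on the left-hand side is the image under F, up to the structure
    isomorphisms, of the loop that defines the trace of f. *)
Lemma floop X (f : hom X X) :
  fev X ∘ symm _ _ ∘ (fhom F f ⊠ idc (F (dual X))) ∘ fcoev X =
  iota (tr f) *: idc unit.
Proof.
have e := unit_coefE (ev X ∘ symm X (dual X) ∘ (f ⊠ idc (dual X)) ∘ coev X).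
have -> : iota (tr f) *: idc unit = feta' F ∘ fhom F (tr f *: idc unit) ∘ feta F.
  by rewrite fhomZ compZr compZl fhom_id compf1 fetaK.
rewrite -e /fev /fcoev !fhom_comp !compA; congr (_ ∘ _ ∘ _).
rewrite -!compA; congr (_ ∘ (_ ∘ _)).
rewrite !compA -fmu_symm -!compA; congr (_ ∘ _).
by rewrite !compA -fhom_id fmu_nat -compA fmuK' compf1.
Qed.
End Duality.

Section Rigid.
Variables (A : rigidCat K) (B : rigidCat L) (F : tensorFunctor iota A B).

Lemma partial_tr_comp (X P : B) (a : hom unit (X ⊗ P)) (g : hom (P ⊗ X) unit)
    (f : hom X X) :
  partial_tr a (g ∘ (idc P ⊠ f)) = partial_tr a g ∘ f.
Proof.
rewrite /partial_tr -tensh_idl -!compA -lunit'_nat.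
rewrite (compA (a ⊠ _)) tensh_lr -[a ⊠ f]tensh_rl -(tensh1 X P).
by rewrite -!compA (compA (assoc _ _ _) ((_ ⊠ _) ⊠ _)) assoc_nat -!compA.
Qed.

(** The trace does not depend on the duality used to compute it, so that the
    transported duality of [floop] computes traces in [B]. *)
Lemma tr_fhom (X : A) (f : hom X X) : tr (fhom F f) = iota (tr f).
Proof.
have -> : fhom F f = partial_tr (fcoev F X) (fev F X ∘ (idc _ ⊠ fhom F f)).
  by rewrite partial_tr_comp /partial_tr fzigzag comp1f.
rewrite /tr tr_partial_tr -[RHS](unit_coefZ B) -(floop F); congr unit_coef.
by rewrite -!compA (compA (symm _ _) (_ ⊠ _)) symm_nat -!compA.
Qed.
End Rigid.
End FunctorTheory.

Section ChangeOfHoms.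
Variables (K L : fieldType) (iota : {rmorphism K -> L}) (A : rigidCat K).
Variable C : homChange iota A.

(** [cpi C f], with a type from which composition and tensor product can infer
    the category. *)
Definition cmor (X Y : A) (f : hom X Y) : hom (X : change_rigid C) Y := cpi C f.

Lemma cmorM (X Y Z : A) (g : hom Y Z) (f : hom X Y) :
  cmor (g ∘ f) = cmor g ∘ cmor f.
Proof. by rewrite /comp /= /cmor ccomp_pi. Qed.
Lemma cmorT (X X' Y Y' : A) (f : hom X X') (g : hom Y Y') :
  cmor (f ⊠ g) = cmor f ⊠ cmor g.
Proof. by rewrite /tensh /= /cmor ctens_pi. Qed.
Lemma cmorZ (X Y : A) a (f : hom X Y) : cmor (a *: f) = iota a *: cmor f.
Proof. exact: cpiZ. Qed.

Lemma tr_cmor (X : A) (f : hom X X) : tr (cmor f) = iota (tr f).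
Proof.
have -> : tr (cmor f) =
    unit_coef (cmor (ev X ∘ symm X (dual X) ∘ (f ⊠ idc (dual X)) ∘ coev X)).
  by rewrite !cmorM cmorT.
by rewrite [X in cmor X]unit_coefE cmorZ unit_coefZ.
Qed.
End ChangeOfHoms.

(** * The super trace *)

Section EndMatrix.
Variables (L : fieldType) (U : vectType L).
Local Notation b := (vbasis {:U}).

Definition endmx (f : 'End(U)) : 'M[L]_(\dim {:U}) :=
  \matrix_(i, j) coord b i (f b`_j).

Lemma endmxM (f g : 'End(U)) : endmx (f \o g)%VF = endmx f *m endmx g.
Proof.
apply/matrixP => i j; rewrite !mxE comp_lfunE.
rewrite [in LHS](coord_vbasis (memvf (g _))) !linear_sum /=.
by apply: eq_bigr => k _; rewrite !linearZ /= !mxE mulrC.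
Qed.
Lemma endmx1 : endmx \1%VF = 1%:M.
Proof.
apply/matrixP => i j; rewrite [LHS]mxE [RHS]mxE id_lfunE coord_free.
  by rewrite (eq_sym j i).
exact: basis_free (vbasisP _).
Qed.
End EndMatrix.

Section SuperTrace.
Variable L : fieldType.

Lemma pure_sum (U V : vectType L) (m : tsp U V) :
  exists d : 'I_(\dim {:U}) -> V, m = \sum_(i < \dim {:U}) pure (vbasis {:U})`_i (d i).
Proof.
exists (fun i => \sum_j m i j *: (vbasis {:V})`_j).
have e : tmap (@pure L U V) = \1%VF.
  apply: tsp_ext => u v; rewrite id_lfunE tmap_pure //.
    exact: pure_linear_l.
  exact: pure_linear_r.
have := congr1 (fun f : 'Hom(_, _) => f m) e.
rewrite id_lfunE /tmap linfunE; last exact: tlift_linear.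
move=> {1}<-; apply: eq_bigr => i _.
elim/big_rec2: _ => [|j x y _ ->]; first by rewrite pure0r.
by rewrite pureDr pureZr.
Qed.

Definition slin (U V : sVec L) (f : hom U V) : 'Hom(U : superVec L, V : superVec L) :=
  submod_val (f : shom U V).
Lemma slinM (U V W : sVec L) (g : hom V W) (f : hom U V) u :
  slin (g ∘ f) u = slin g (slin f u).
Proof. exact: comp_lfunE. Qed.
Lemma slinT (U U' V V' : sVec L) (f : hom U U') (g : hom V V') u v :
  slin (f ⊠ g) (pure u v) = pure (slin f u) (slin g v).
Proof. exact: thomE. Qed.
Lemma slin1 (U : sVec L) u : slin (idc U) u = u.
Proof. exact: id_lfunE. Qed.
Lemma slin_assoc (U V W : sVec L) (u : U : superVec L) (v : V : superVec L)
    (w : W : superVec L) :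
  slin (assoc U V W) (pure (pure u v) w) = pure u (pure v w).
Proof. exact: tassocE. Qed.
Lemma slin_lunit' (U : sVec L) u : slin (lunit' U) u = pure (1 : L^o) u.
Proof. exact: tlunit'E. Qed.
Lemma slin_runit (U : sVec L) (u : U : superVec L) (a : L^o) :
  slin (runit U) (pure u a) = a *: u.
Proof. exact: trunitE. Qed.

Lemma pure_suml (U V : vectType L) n (u : 'I_n -> U) (v : V) :
  pure (\sum_i u i) v = \sum_i pure (u i) v.
Proof.
by elim/big_rec2: _ => [|i x y _ <-]; rewrite ?pure0l ?pureDl.
Qed.

Lemma slin_sum (U V : sVec L) (f : hom U V) n (u : 'I_n -> (U : superVec L)) :
  slin f (\sum_i u i) = \sum_i slin f (u i).
Proof. exact: linear_sum. Qed.
Lemma slinZ (U V : sVec L) (f : hom U V) a (u : U : superVec L) :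
  slin f (a *: u) = a *: slin f u.
Proof. exact: linearZ. Qed.
Lemma slinB (U V : sVec L) (f : hom U V) (u v : U : superVec L) :
  slin f (u - v) = slin f u - slin f v.
Proof. exact: linearB. Qed.

Lemma slin_symm (U V : sVec L) (u : U : superVec L) (v : V : superVec L) :
  slin (symm U V) (pure u v) =
  pure v u - 2%:R *: pure (oddp V v) (oddp U u).
Proof.
rewrite /slin /= /ksymm comp_lfunE add_lfunE opp_lfunE scale_lfunE.
rewrite id_lfunE thomE linearB linearZ /= !tmap_pure //.
all: by [exact: pure_linear_l | exact: pure_linear_r].
Qed.

Section Loop.
Variables (W D : sVec L) (c : hom unit (W ⊗ D)) (e : hom (D ⊗ W) unit).
Local Notation b := (vbasis {:(W : superVec L)}).
Hypothesis zz : runit W ∘ (idc W ⊠ e) ∘ assoc W D W ∘ (c ⊠ idc W) ∘ lunit' W =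
  idc W.

(** The unit object is purely even, so that e vanishes on tensors of vectors of
    opposite parities. *)
Lemma even_pairing (d : D : superVec L) (w : W : superVec L) :
  slin e (pure (oddp D d) (oddp W w)) = slin e (pure d (oddp W w)).
Proof.
have ee m : slin e (sodd D W m) = 0.
  by rewrite [LHS](shom_odd e m) zero_lfunE.
have PP x : oddp W (oddp W x) = oddp W x.
  by rewrite -[LHS]comp_lfunE oddp_idem.
have := ee (pure d (oddp W w)).
rewrite /sodd add_lfunE opp_lfunE scale_lfunE add_lfunE !thomE !id_lfunE PP.
rewrite linearB linearD linearZ /= scaler_nat mulr2n opprD addrA.
have pq (p q : L^o) : p + q - p - p = 0 -> p = q.
  by rewrite (addrAC p q) subrr add0r => /subr0_eq ->.
exact: pq.
Qed.

(** The super trace: writing [c 1] as the sum of the [b_i ⊗ d_i], for [b] a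
    basis of [W], the triangle identity says that [e (d_i ⊗ -)] is the i-th
    coordinate. The Koszul sign of the symmetry becomes the factor 1 - 2 P, where
    P is the projector on the odd part, because [e] is even. *)
Lemma super_loop (f : hom W W) :
  e ∘ symm W D ∘ (f ⊠ idc D) ∘ c =
  \tr ((1%:M - 2%:R *: endmx (oddp W)) *m endmx (slin f)) *: idc unit.
Proof.
have [d ed] := pure_sum (slin c (1 : L^o)).
have ecoord i w : slin e (pure (d i) w) = coord b i w.
  have /(congr1 (fun g => slin g w)) := zz.
  rewrite !slinM slin1 slin_lunit' slinT ed slin1 pure_suml !slin_sum => ew.
  have {}ew : w = \sum_(k < \dim {:(W : superVec L)}) slin e (pure (d k) w) *: b`_k.
    rewrite -[LHS]ew; apply: eq_bigr => k _.
    by rewrite slin_assoc slinT slin1 slin_runit.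
  by rewrite [in RHS]ew coord_sum_free //; exact: basis_free (vbasisP _).
pose t := \tr ((1%:M - 2%:R *: endmx (oddp W)) *m endmx (slin f)).
apply: shom_eq; apply/lfunP => x.
have x1 (g : 'End(L^o)) : g x = x *: g (1 : L^o).
  by rewrite -linearZ /= /GRing.scale /= mulr1.
rewrite [LHS]x1 [RHS]x1; congr (_ *: _).
have -> : submod_val (t *: idc (unit : sVec L)) (1 : L^o) = t *: (1 : L^o).
  by rewrite /= scale_lfunE id_lfunE.
have -> : t = \sum_(i < \dim {:(W : superVec L)})
    (coord b i (slin f b`_i) - 2%:R * coord b i (oddp W (slin f b`_i))).
  rewrite /t mulmxBl mul1mx -scalemxAl -endmxM linearB linearZ /=.
  rewrite /mxtrace mulr_sumr -sumrB; apply: eq_bigr => i _.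
  by rewrite !mxE comp_lfunE.
have -> : submod_val (e ∘ symm W D ∘ (f ⊠ idc D) ∘ c) (1 : L^o) =
    slin (e ∘ symm W D ∘ (f ⊠ idc D) ∘ c) (1 : L^o) by [].
rewrite !slinM ed !slin_sum scaler_suml; apply: eq_bigr => i _.
rewrite slinT slin1 slin_symm slinB slinZ even_pairing !ecoord.
by rewrite [RHS]/GRing.scale /= mulr1.
Qed.
End Loop.
End SuperTrace.

(** * A matrix model of the traces of endomorphisms *)

Section Realisation.
Variables (K L : fieldType) (iota : {rmorphism K -> L}) (A : rigidCat K).
Variable H : tensorFunctor iota A (sVec L).

Lemma tr_realisation (X : A) (f : hom X X) :
  iota (tr f) =
  \tr ((1%:M - 2%:R *: endmx (oddp (H X))) *m endmx (slin (fhom H f))).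
Proof.
have := super_loop (fzigzag H X) (fhom H f); rewrite floop.
move=> /(congr1 (fun g : shom (sunit L) (sunit L) => submod_val g (1 : L^o))).
by rewrite /= !scale_lfunE !id_lfunE /GRing.scale /= !mulr1.
Qed.

Definition realmx (X : A) (f : endo X) : 'M[L]_(\dim {:(H X : superVec L)}) :=
  endmx (slin (fhom H (f : hom X X))).

Lemma realmxM (X : A) : {morph @realmx X : f g / f * g}.
Proof. by move=> f g; rewrite /realmx fhom_comp -[RHS]endmxM. Qed.

Lemma realmx1 (X : A) : realmx (1 : endo X) = 1.
Proof. by rewrite /realmx fhom_id -[RHS]endmx1. Qed.

Lemma realmx_odd (X : A) (f : endo X) :
  realmx f * endmx (oddp (H X)) = endmx (oddp (H X)) * realmx f.
Proof.
rewrite -[LHS]endmxM -[RHS]endmxM; congr endmx.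
by apply/lfunP => u; rewrite !comp_lfunE; exact: shom_odd.
Qed.
End Realisation.

Section Origin.
Variables (K : fieldType) (A : rigidCat K).
Hypothesis Aho : homological_origin A.

(** The matrix h f realises a lift of f to a category of homological type; it is
    neither additive nor multiplicative in f, as the lifts are arbitrary, but traces
    of products do not depend on the lifts. *)
Lemma trace_model (M : A) :
  exists (L : fieldType) (iota : {rmorphism K -> L}) (n : nat) (P : 'M[L]_n)
         (h : endo M -> 'M[L]_n),
    [/\ P * P = P, forall f, h f * P = P * h f &
        forall s : seq (endo M),
          iota (tr (\prod_(f <- s) f : endo M)) =
          \tr ((1 - 2%:R *: P) * \prod_(f <- s) h f)].
Proof.
have [A0 [[L [iota [H]]] [F [Fbij _]]]] := Aho.
pose X : A0 := F M.
pose l (f : endo M) : endo X := quot_repr (fhom F (f : hom M M)).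
have cl f : cmor (quot_change A0) (l f) = fhom F (f : hom M M).
  exact: quot_reprK.
exists L, iota, (\dim {:(H X : superVec L)}), (endmx (oddp (H X))).
exists (fun f => realmx H (l f)); split.
- by rewrite -[LHS]endmxM oddp_idem.
- by move=> f; apply: realmx_odd.
move=> s.
have -> : \prod_(f <- s) realmx H (l f) = realmx H (\prod_(f <- s) l f).
  elim/big_rec2: _ => [|f x y _ ->]; first by rewrite realmx1.
  by rewrite realmxM.
rewrite -[RHS]tr_realisation; congr (iota _).
transitivity (tr (fhom F (\prod_(f <- s) f : endo M))); first by rewrite tr_fhom.
have -> : fhom F (\prod_(f <- s) f : endo M) =
    cmor (quot_change A0) (\prod_(f <- s) l f : endo X).
  elim/big_rec2: _ => [|f x y _ e]; first by rewrite fhom_id.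
  by rewrite fhom_comp cmorM -e cl.
exact: tr_cmor.
Qed.

(** The quotient by the ideal N has no non-zero morphism orthogonal to all others,
    and the equivalence with this quotient preserves traces. *)
Lemma trace_nondegenerate (M : A) (f : endo M) :
  (forall g : endo M, tr (g * f : endo M) = 0) -> f = 0.
Proof.
have [A0 [_ [F [Fbij _]]]] := Aho => f0.
have [F' F'K FK] := Fbij M M.
apply: (can_inj F'K); rewrite fhom0.
pose X : A0 := F M.
rewrite -[fhom F f]quot_reprK; apply/esym.
have -> : (0 : hom (F M) (F M)) = quot_pi (0 : hom X X).
  have := quot_pi_linear (-1) (0 : hom X X) 0.
  by rewrite scaleN1r addNr => ->; rewrite scaleN1r addNr.
apply/esym/quot_piP; rewrite subr0 => g.
suff : tr (cmor (quot_change A0) (g ∘ quot_repr (fhom F f))) = 0.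
  by rewrite tr_cmor.
have -> : cmor (quot_change A0) (g ∘ quot_repr (fhom F f)) =
    fhom F ((F' (quot_pi g) : endo M) * f).
  rewrite cmorM fhom_comp FK; congr (_ ∘ _); exact: quot_reprK.
by rewrite tr_fhom f0.
Qed.
End Origin.

(** * The action of permutations under tensor functors *)

Section SwapNat.
Variables (K : fieldType) (A : symCat K).
Lemma swap01_nat (X X' Y Y' P P' : A) (f : hom X X') (g : hom Y Y')
    (h : hom P P') :
  swap01 X' Y' P' ∘ (f ⊠ (g ⊠ h)) = (g ⊠ (f ⊠ h)) ∘ swap01 X Y P.
Proof.
rewrite /swap01 -compA assoc'_nat !compA -assoc_nat -!compA; congr (_ ∘ _).
by rewrite !compA -!tensh_comp symm_nat comp1f compf1.
Qed.
End SwapNat.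

Section TensorPowers.
Variables (K L : fieldType) (iota : {rmorphism K -> L}).
Variables (A : symCat K) (B : symCat L) (F : tensorFunctor iota A B).
Implicit Types X Y P M : A.

(** The isomorphism between the tensor power of F M and the image of the tensor
    power of M; it intertwines the two actions of the symmetric group. *)
Fixpoint fpow M n : hom (tpow (F M) n) (F (tpow M n)) :=
  if n is m.+1 then fmu F M (tpow M m) ∘ (idc (F M) ⊠ fpow M m) else feta F.
Fixpoint fpow' M n : hom (F (tpow M n)) (tpow (F M) n) :=
  if n is m.+1 then (idc (F M) ⊠ fpow' M m) ∘ fmu' F M (tpow M m) else feta' F.

Lemma fpowK' M n : fpow M n ∘ fpow' M n = idc _.
Proof.
elim: n => [|n IHn] /=; first exact: fetaK'.
by rewrite -compA (compA (_ ⊠ _)) tensh_idl IHn tensh1 comp1f fmuK'.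
Qed.

(** The three compatibilities of F, with the inverse associator, the symmetry
    and the associator, applied in this order. *)
Lemma fhom_swap01 X Y P :
  fhom F (swap01 X Y P) ∘ (fmu F X (Y ⊗ P) ∘ (idc (F X) ⊠ fmu F Y P)) =
  fmu F Y (X ⊗ P) ∘ (idc (F Y) ⊠ fmu F X P) ∘ swap01 (F X) (F Y) (F P).
Proof.
have eA : fhom F (assoc' X Y P) ∘ (fmu F X (Y ⊗ P) ∘ (idc _ ⊠ fmu F Y P)) =
    fmu F (X ⊗ Y) P ∘ (fmu F X Y ⊠ idc _) ∘ assoc' _ _ _.
  apply: (iso_cancell (i := fhom F (assoc X Y P)) (j := fhom F (assoc' X Y P))).
    by rewrite -fhom_comp assocK fhom_id.
  rewrite !compA -fhom_comp assocK' fhom_id comp1f fmu_assoc.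
  by rewrite -!compA assocK' compf1.
rewrite /swap01 !fhom_comp -!compA eA !compA -fmu_assoc -!compA.
congr (_ ∘ _); rewrite !compA -fmu_nat fhom_id -[LHS]compA -!compA.
congr (_ ∘ _); rewrite !compA; congr (_ ∘ _).
by rewrite !tensh_idr fmu_symm.
Qed.

Lemma fhom_insert M n k :
  fhom F (insert_first M n k) ∘ fpow M n.+1 =
  fpow M n.+1 ∘ insert_first (F M) n k.
Proof.
have fid (X : B) Y (f : hom X (F Y)) : fhom F (idc Y) ∘ f = f ∘ idc X.
  by rewrite fhom_id comp1f compf1.
elim: n k => [|n IHn] [|k]; do ?exact: fid.
rewrite [insert_first M _ _]/= [insert_first (F M) _ _]/= fhom_comp.
rewrite [fpow M n.+2]/= -[in LHS]tensh_idl -compA.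
rewrite (compA (fmu F M _)) (compA (fhom F (swap01 _ _ _))) fhom_swap01.
move: (swap01_nat (idc (F M)) (idc (F M)) (fpow M n)).
move: (swap01 _ _ (F _)) (swap01 _ _ (tpow (F M) n)) => s1 s2 nat_s.
rewrite -!compA nat_s !compA; congr (_ ∘ _).
rewrite -fmu_nat fhom_id -!compA; congr (_ ∘ _).
by rewrite !tensh_idl; congr (_ ⊠ _); rewrite -[RHS]IHn.
Qed.

Lemma fhom_perm_act M n (s : 'S_n) :
  fhom F (perm_act M s) ∘ fpow M n = fpow M n ∘ perm_act (F M) s.
Proof.
elim: n s => [|n IHn] s; first by rewrite /= fhom_id comp1f compf1.
rewrite [perm_act M s]/= [perm_act (F M) s]/=; set s' := odflt _ _.
rewrite fhom_comp [RHS]compA -fhom_insert -[LHS]compA -[RHS]compA.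
congr (_ ∘ _).
rewrite [fpow M n.+1]/= compA -fmu_nat fhom_id -!compA; congr (_ ∘ _).
by rewrite !tensh_idl IHn.
Qed.

Lemma fhom_young (la : seq nat) M :
  fhom F (young_symmetrizer la M) ∘ fpow M _ =
  fpow M _ ∘ young_symmetrizer la (F M).
Proof.
have comp_suml (C : linCat L) (X Y Z : C) I r (Q : pred I) (g : I -> hom Y Z)
    (f : hom X Y) :
    (\sum_(i <- r | Q i) g i) ∘ f = \sum_(i <- r | Q i) g i ∘ f.
  by elim/big_rec2: _ => [|i x y _ <-]; [exact: comp0f | exact: compDl].
have comp_sumr (C : linCat L) (X Y Z : C) I r (Q : pred I) (g : I -> hom X Y)
    (f : hom Y Z) :
    f ∘ (\sum_(i <- r | Q i) g i) = \sum_(i <- r | Q i) f ∘ g i.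
  by elim/big_rec2: _ => [|i x y _ <-]; [exact: compf0 | exact: compDr].
rewrite /young_symmetrizer fhom_comp -compA !fhom_sum.
have -> : (\sum_(q in col_stab la) fhom F ((-1) ^+ q *: perm_act M q))
    ∘ fpow M (sumn la) =
   fpow M (sumn la) ∘ \sum_(q in col_stab la) (-1) ^+ q *: perm_act (F M) q.
  rewrite comp_suml comp_sumr; apply: eq_bigr => q _.
  by rewrite fhomZ compZl compZr fhom_perm_act rmorphXn rmorphN1.
rewrite !compA; congr (_ ∘ _).
by rewrite comp_suml comp_sumr; apply: eq_bigr => q _; apply: fhom_perm_act.
Qed.

Lemma fhom_young_eq0 (la : seq nat) M :
  young_symmetrizer la (F M) = 0 -> fhom F (young_symmetrizer la M) = 0.
Proof.
move=> y0; have := fhom_young la M; rewrite y0 compf0 => e.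
apply: (iso_cancelr (fpowK' M (sumn la))); by rewrite e comp0f.
Qed.
End TensorPowers.

Section ChangePowers.
Variables (K L : fieldType) (iota : {rmorphism K -> L}) (A : rigidCat K).
Variable C : homChange iota A.

Lemma cmor_insert (M : A) n k :
  cmor C (insert_first M n k) = insert_first (M : change_rigid C) n k.
Proof.
elim: n k => [|n IHn] [|k] //=.
by rewrite cmorM cmorT IHn /swap01 !cmorM cmorT.
Qed.

Lemma cmor_perm_act (M : A) n (s : 'S_n) :
  cmor C (perm_act M s) = perm_act (M : change_rigid C) s.
Proof. by elim: n s => [|n IHn] s //=; rewrite cmorM cmorT IHn cmor_insert. Qed.

Lemma cmor_young la (M : A) :
  cmor C (young_symmetrizer la M) = young_symmetrizer la (M : change_rigid C).
Proof.
have cmor_sum (X Y : A) I r (Q : pred I) (f : I -> hom X Y) :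
    cmor C (\sum_(i <- r | Q i) f i) = \sum_(i <- r | Q i) cmor C (f i).
  elim/big_rec2: _ => [|i x y _ <-]; first exact: cpi0.
  exact: cpiD.
rewrite /young_symmetrizer cmorM !cmor_sum; congr (_ ∘ _).
  by apply: eq_bigr => p _; rewrite cmor_perm_act.
apply: eq_bigr => q _.
by rewrite cmorZ rmorphXn rmorphN1 cmor_perm_act.
Qed.
End ChangePowers.

(** * Inversions between marked points *)

Section Inversions.
Variable n : nat.
Implicit Types (s t : 'S_n) (y : 'I_n -> bool).

(** The exponent of the sign by which s acts on a tensor of homogeneous vectors,
    the odd ones being those in the positions marked by y. *)
Definition oddinv y s : nat :=
  \sum_(a < n) \sum_(b < n) [&& y a, y b, (a < b)%N & (s b < s a)%N].

Lemma sum_lt_sym (g : 'I_n -> 'I_n -> nat) :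
    (forall a b, g a b = g b a) -> (forall a, g a a = 0%N) ->
  ((\sum_(a < n) \sum_(b < n) (a < b) * g a b).*2 = \sum_(a < n) \sum_(b < n) g a b)%N.
Proof.
move=> gC g0; rewrite -addnn {2}exchange_big -big_split /=.
apply: eq_bigr => a _; rewrite -big_split /=; apply: eq_bigr => b _.
by case: ltngtP => [||/val_inj->]; rewrite ?mul1n ?mul0n ?addn0 ?g0.
Qed.

(** A sum over unordered pairs is invariant under a permutation; it is half of
    the sum over ordered pairs, which can be reindexed. *)
Lemma sum_lt_perm t (g : 'I_n -> 'I_n -> nat) :
    (forall a b, g a b = g b a) -> (forall a, g a a = 0%N) ->
  (\sum_(a < n) \sum_(b < n) (a < b) * g (t a) (t b) =
   \sum_(a < n) \sum_(b < n) (a < b) * g a b)%N.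
Proof.
move=> gC g0; apply: double_inj; rewrite !sum_lt_sym //.
rewrite [RHS](reindex_inj (@perm_inj _ t)); apply: eq_bigr => a _.
by rewrite [RHS](reindex_inj (@perm_inj _ t)).
Qed.

Definition inverted s (a b : 'I_n) : bool :=
  (a < b)%N && (s b < s a)%N || (b < a)%N && (s a < s b)%N.

Lemma invertedC s a b : inverted s a b = inverted s b a.
Proof. by rewrite /inverted orbC. Qed.
Lemma inverted_id s a : inverted s a a = false.
Proof. by rewrite /inverted ltnn. Qed.

Lemma oddinvE y s :
  oddinv y s = (\sum_(a < n) \sum_(b < n) (a < b) * [&& y a, y b & inverted s a b])%N.
Proof.
apply: eq_bigr => a _; apply: eq_bigr => b _; rewrite /inverted.
by case: ltngtP; case: (y a); case: (y b); rewrite ?andbF ?orbF ?mul1n ?mul0n.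
Qed.

(** Modulo 2, the inversions of t * s at a pair are those of t at this pair plus
    those of s at the image of the pair. *)
Lemma oddinvM y s t : (forall a, y (t a) = y a) ->
  odd (oddinv y (t * s)%g) = odd (oddinv y t) (+) odd (oddinv y s).
Proof.
move=> yt; pose g a b : nat := [&& y a, y b & inverted s a b].
have gC a b : g a b = g b a by rewrite /g invertedC andbCA.
have g0 a : g a a = 0%N by rewrite /g inverted_id !andbF.
rewrite -oddD [oddinv y s]oddinvE -(sum_lt_perm t gC g0) !oddinvE.
rewrite -big_split /= !(big_morph odd oddD (erefl _)); apply: eq_bigr => a _.
rewrite -big_split /= !(big_morph odd oddD (erefl _)); apply: eq_bigr => b _.
rewrite /g !yt /inverted !permM !oddD !oddM.
case: (y a); case: (y b); rewrite ?andbF //=.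
case: (ltngtP a b) => //= ab.
have tab : (t a != t b :> nat).
  by rewrite (inj_eq val_inj) (inj_eq perm_inj) -(inj_eq val_inj) ltn_eqF.
have sab : (s (t a) != s (t b) :> nat).
  by rewrite (inj_eq val_inj) (inj_eq perm_inj) -(inj_eq val_inj).
move: tab sab.
by case: (ltngtP (t a) (t b)); case: (ltngtP (s (t a)) (s (t b))).
Qed.

(** Besides the pair {i, j}, the inversions of the transposition (i j) are the
    pairs {i, k} and {j, k} for k marked between i and j, which come in twos. *)
Lemma oddinv_tperm y i j : i != j -> y i -> y j -> odd (oddinv y (tperm i j)).
Proof.
wlog ij : i j / (i < j)%N => [wl nij yi yj|].
  case: (ltngtP i j) => [ij|ji|/val_inj ij]; first exact: wl.
    by rewrite tpermC; apply: wl; rewrite // eq_sym.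
  by rewrite ij eqxx in nij.
move=> nij yi yj; set t := tperm i j.
pose g a b : nat := [&& y a, y b & inverted t a b].
have gC a b : g a b = g b a by rewrite /g invertedC andbCA.
have g0 a : g a a = 0%N by rewrite /g inverted_id !andbF.
have gij : g i j = 1%N by rewrite /g yi yj /inverted tpermL tpermR ij.
have gk k : k != i -> k != j -> g i k = g j k.
  move=> ki kj; rewrite /g yi yj /inverted tpermL tpermR tpermD 1?eq_sym //=.
  by rewrite orbC; congr (nat_of_bool (y k && (_ || _))); rewrite andbC.
have gkl k l : k != i -> k != j -> l != i -> l != j -> g k l = 0%N.
  move=> ki kj li lj; rewrite /g /inverted !tpermD 1?eq_sym //.
  by case: ltngtP; rewrite ?andbF.
suff e : oddinv y t = (1 + (\sum_(k | (k != i) && (k != j)) g i k).*2)%N.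
  by rewrite e oddD odd_double.
apply: double_inj; rewrite oddinvE (sum_lt_sym gC g0).
have nji : j != i by rewrite eq_sym.
have row a : (\sum_(b < n) g a b =
    g a i + (g a j + \sum_(k | (k != i) && (k != j)) g a k))%N.
  rewrite (bigD1 i) //; congr (_ + _)%N; exact: bigD1.
rewrite (bigD1 i) //= [X in (_ + X)%N](bigD1 j) //=.
rewrite !row !g0 (gC j i) gij.
have -> : (\sum_(k | (k != i) && (k != j)) \sum_(b < n) g k b =
   (\sum_(k | (k != i) && (k != j)) g i k).*2)%N.
  rewrite -addnn -big_split; apply: eq_bigr => k /andP[ki kj] /=.
  rewrite row big1 ?addn0; last by move=> l /andP[li lj]; apply: gkl.
  by rewrite (gC k i) (gC k j) gk.
have -> : (\sum_(k | (k != i) && (k != j)) g j k =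
   \sum_(k | (k != i) && (k != j)) g i k)%N.
  by apply: eq_bigr => k /andP[ki kj]; rewrite gk.
by rewrite -!addnn; lia.
Qed.

(** The transposition (i j) moves no marked position. *)
Lemma oddinv_even_tperm y s i j : ~~ y i -> ~~ y j ->
  oddinv y (tperm i j * s)%g = oddinv y s.
Proof.
move=> /negPf yi /negPf yj; apply: eq_bigr => a _; apply: eq_bigr => b _.
case ya : (y a) => //=; case yb : (y b) => //=.
have nij c : y c -> tperm i j c = c.
  by move=> yc; rewrite tpermD //; apply: contraTneq yc => <-; rewrite ?yi ?yj.
by rewrite !permM !nij.
Qed.
End Inversions.

(** * The action of permutations on tensors of a super vector space *)

Lemma lift_permP n (s : 'S_n.+1) :
  exists s' : 'S_n, lift_perm ord0 (s ord0) s' = s.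
Proof.
pose f i := odflt i (unlift (s ord0) (s (lift ord0 i))).
have fE i : lift (s ord0) (f i) = s (lift ord0 i).
  rewrite /f; case: unliftP => [j -> //|/perm_inj/eqP].
  by rewrite eq_sym (negPf (neq_lift _ _)).
have finj : injective f.
  move=> i j e; apply: (@lift_inj _ ord0); apply: (@perm_inj _ s).
  by rewrite -!fE e.
exists (perm finj); apply/permP => i.
case: (unliftP ord0 i) => [j|] ->; last by rewrite lift_perm_id.
by rewrite lift_perm_lift permE fE.
Qed.

Lemma pure_ext (L : fieldType) (U P W : vectType L) I (u : I -> U) J (p : J -> P) :
    (forall f g : 'Hom(U, W), (forall i, f (u i) = g (u i)) -> f = g) ->
    (forall f g : 'Hom(P, W), (forall j, f (p j) = g (p j)) -> f = g) ->
  forall f g : 'Hom(tsp U P, W),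
    (forall i j, f (pure (u i) (p j)) = g (pure (u i) (p j))) -> f = g.
Proof.
move=> extU extP f g e; apply: tsp_ext => x y.
pose F (h : 'Hom(tsp U P, W)) y : 'Hom(U, W) := linfun (fun x => h (pure x y)).
have FE h z t : F h t z = h (pure z t).
  by rewrite linfunE // => a z1 z2; rewrite pureDl pureZl linearP.
suff /lfunP/(_ x) : F f y = F g y by rewrite !FE.
apply: extU => i; rewrite !FE.
pose G (h : 'Hom(tsp U P, W)) : 'Hom(P, W) := linfun (fun y => h (pure (u i) y)).
have GE h t : G h t = h (pure (u i) t).
  by rewrite linfunE // => a z1 z2; rewrite pureDr pureZr linearP.
suff /lfunP/(_ y) : G f = G g by rewrite !GE.
by apply: extP => j; rewrite !GE.
Qed.

Section SuperAction.
Variable L : fieldType.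
Implicit Types U P W : superVec L.

(** [pure], with a type that is a tensor product of super vector spaces. *)
Definition spure U P (u : U) (p : P) : stens U P := pure u p.

Lemma spureZl U P a (u : U) (p : P) : spure (a *: u) p = a *: spure u p.
Proof. exact: pureZl. Qed.
Lemma spureZr U P a (u : U) (p : P) : spure u (a *: p) = a *: spure u p.
Proof. exact: pureZr. Qed.

Lemma spure_ext U P (W : vectType L) I (u : I -> U) J (p : J -> P) :
    (forall f g : 'Hom(U, W), (forall i, f (u i) = g (u i)) -> f = g) ->
    (forall f g : 'Hom(P, W), (forall j, f (p j) = g (p j)) -> f = g) ->
  forall f g : 'Hom(stens U P, W),
    (forall i j, f (spure (u i) (p j)) = g (spure (u i) (p j))) -> f = g.
Proof. exact: pure_ext. Qed.

Definition sap U W (f : shom U W) (u : U) : W := submod_val f u.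

Lemma sapM U P W (g : shom P W) (f : shom U P) u :
  sap (scomp g f) u = sap g (sap f u).
Proof. exact: comp_lfunE. Qed.
Lemma sap1 U (u : U) : sap (sid U) u = u.
Proof. exact: id_lfunE. Qed.
Lemma sapZ U W (f : shom U W) a u : sap f (a *: u) = a *: sap f u.
Proof. exact: linearZ. Qed.
Lemma sap_tensh U U' P P' (f : shom U U') (g : shom P P') u p :
  sap (stensh f g) (spure u p) = spure (sap f u) (sap g p).
Proof. exact: thomE. Qed.

Definition sswap01 U P W : shom (stens U (stens P W)) (stens P (stens U W)) :=
  scomp (scomp (sassoc P U W) (stensh (ssymm U P) (sid W))) (sassoc' U P W).

Lemma sap_swap01 U P W x y (u : U) (v : P) (w : W) :
  homog x u -> homog y v ->
  sap (sswap01 U P W) (spure u (spure v w)) =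
  (-1) ^+ (x && y) *: spure v (spure u w).
Proof.
move=> hu hv; rewrite /sswap01 !sapM.
have -> : sap (sassoc' U P W) (spure u (spure v w)) = spure (spure u v) w.
  exact: tassoc'E.
rewrite sap_tensh sap1.
have -> : sap (ssymm U P) (spure u v) = (-1) ^+ (x && y) *: spure v u.
  exact: ksymmE.
by rewrite spureZl sapZ; congr (_ *: _); exact: tassocE.
Qed.

(** The tensor powers of V and the action of permutations, built from the
    operations on super vector spaces rather than from the tensor category of super
    vector spaces. They are definitionally equal to [tpow], [insert_first] and
    [perm_act], but do not carry along the whole structure of this category. *)
Fixpoint vpow (V : superVec L) m : superVec L :=
  if m is m'.+1 then stens V (vpow V m') else sunit L.

Fixpoint sinsert (V : superVec L) (n k : nat) {struct n} :
    shom (stens V (vpow V n)) (stens V (vpow V n)) :=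
  match n, k with
  | m.+1, k'.+1 =>
      scomp (stensh (sid V) (sinsert V m k')) (sswap01 V V (vpow V m))
  | _, _ => sid _
  end.

Fixpoint sperm (V : superVec L) (n : nat) : 'S_n -> shom (vpow V n) (vpow V n) :=
  match n with
  | 0 => fun _ => sid _
  | m.+1 => fun s =>
      let s' := odflt 1%g [pick s' : 'S_m | lift_perm ord0 (s ord0) s' == s] in
      scomp (sinsert V m (s ord0)) (stensh (sid V) (sperm V s'))
  end.

Variable V : superVec L.
Local Notation b := (vbasis {:V}).
Local Notation d := (\dim {:V}).

(** The odd and the even component of the i-th basis vector, for the letters
    (i, true) and (i, false): homogeneous vectors that span V. *)
Definition letter (l : 'I_d * bool) : V :=
  if l.2 then oddp V b`_(l.1) else b`_(l.1) - oddp V b`_(l.1).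

Lemma homog_letter l : homog l.2 (letter l).
Proof.
have PP x : oddp V (oddp V x) = oddp V x.
  by rewrite -[LHS]comp_lfunE oddp_idem.
case: l => i [] /=; rewrite /homog /letter /=; first by rewrite PP scale1r.
by rewrite linearB /= PP subrr scale0r.
Qed.

Lemma letter_ext (W : vectType L) (f g : 'Hom(V, W)) :
  (forall l, f (letter l) = g (letter l)) -> f = g.
Proof.
move=> e; apply/lfunP => v; rewrite (coord_vbasis (memvf v)) !linear_sum.
apply: eq_bigr => i _; rewrite !linearZ /=; congr (_ *: _).
have -> : b`_i = letter (i, true) + letter (i, false).
  by rewrite /letter /= addrC subrK.
by rewrite [LHS]linearD [RHS]linearD /= !e.
Qed.

Fixpoint ptens m : ('I_m -> V) -> (vpow V m) :=
  match m with
  | 0 => fun _ => (1 : L^o)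
  | m'.+1 => fun T => spure (T ord0) (ptens (fun i => T (lift ord0 i)))
  end.

Lemma eq_ptens m (T T' : 'I_m -> V) : T =1 T' -> ptens T = ptens T'.
Proof. by move=> e; congr ptens; apply: funext. Qed.

Lemma ptensS m (T : 'I_m.+1 -> V) :
  ptens T = spure (T ord0) (ptens (fun i => T (lift ord0 i))).
Proof. by []. Qed.

Lemma ptens_letter_cons m l (T : 'I_m -> 'I_d * bool) :
  exists T' : 'I_m.+1 -> 'I_d * bool,
    ptens (letter \o T') = spure (letter l) (ptens (letter \o T)).
Proof.
exists (fun i => if unlift ord0 i is Some j then T j else l).
rewrite ptensS; congr (spure _ _); first by rewrite /= unlift_none.
by apply: eq_ptens => i; rewrite /= liftK.
Qed.

Lemma ptens_ext m (W : vectType L) (f g : 'Hom((vpow V m), W)) :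
  (forall T : 'I_m -> 'I_d * bool,
     f (ptens (letter \o T)) = g (ptens (letter \o T))) -> f = g.
Proof.
elim: m f g => [|m IHm] f g e.
  apply/lfunP => x; have -> : x = (x : L^o) *: (1 : L^o) by rewrite /GRing.scale /= mulr1.
  have T : 'I_0 -> 'I_d * bool by case.
  by rewrite !linearZ; congr (_ *: _); exact: (e T).
apply: (@spure_ext V (vpow V m) _ _ letter _
  (fun T => ptens (letter \o T))) => [f' g'|f' g'|l T].
- exact: letter_ext.
- exact: IHm.
by have [T' eT] := ptens_letter_cons l T; have := e T'; rewrite eT.
Qed.

Definition insert_at m (k : 'I_m.+1) (v : V) (w : 'I_m -> V) (j : 'I_m.+1) :=
  if unlift k j is Some i then w i else v.

Lemma insert_at0 m v (w : 'I_m -> V) :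
  ptens (insert_at ord0 v w) = spure v (ptens w).
Proof.
rewrite ptensS /insert_at unlift_none; congr (spure _ _).
by apply: eq_ptens => i; rewrite liftK.
Qed.

Lemma unlift_lift m (k : 'I_m.+1) (j : 'I_m.+1) :
  unlift (lift ord0 k) (lift ord0 j) = omap (lift ord0) (unlift k j).
Proof.
case: (unliftP k j) => [i|] ->; last by rewrite unlift_none.
have -> : lift ord0 (lift k i) = lift (lift ord0 k) (lift ord0 i).
  by apply: val_inj; rewrite /= /bump /= !add1n ltnS addnS.
by rewrite liftK.
Qed.

Lemma insert_at_lift m (k : 'I_m.+1) v (w : 'I_m.+1 -> V) :
  ptens (insert_at (lift ord0 k) v w) =
  spure (w ord0) (ptens (insert_at k v (fun i => w (lift ord0 i)))).
Proof.
rewrite ptensS {1}/insert_at.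
have -> : unlift (lift ord0 k) ord0 = Some (ord0 : 'I_m.+1).
  have -> : ord0 = lift (lift ord0 k) (ord0 : 'I_m.+1) by exact: val_inj.
  by rewrite liftK.
congr (spure _ _); apply: (@eq_ptens m.+1) => i.
by rewrite /insert_at unlift_lift; case: (unlift k i).
Qed.

(** The sign counts the odd vectors that the first one, if odd, has to cross. *)
Lemma insert_ptens m (k : 'I_m.+1) x v y (w : 'I_m -> V) :
  homog x v -> (forall i, homog (y i) (w i)) ->
  sap (sinsert V m k) (spure v (ptens w)) =
  (-1) ^+ (\sum_(i < m) [&& x, y i & (i < k)%N]) *: ptens (insert_at k v w).
Proof.
elim: m k y w => [|m IHm] k y w hv hw.
  by rewrite big_ord0 expr0 scale1r (ord1 k) insert_at0 [LHS]sap1.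
case: (unliftP ord0 k) => [k'|] ->; last first.
  rewrite insert_at0 big1 ?expr0 ?scale1r ?[LHS]sap1 // => i _.
  by rewrite ltn0 !andbF.
rewrite insert_at_lift [nat_of_ord _]/= /bump leq0n add1n.
rewrite [sinsert _ _ _]/= sapM [ptens _]/= (sap_swap01 _ hv (hw ord0)).
rewrite sapZ sap_tensh sap1 (IHm _ (fun i => y (lift ord0 i))) //.
rewrite spureZr scalerA -exprD; congr (_ ^+ _ *: _).
by rewrite big_ord_recl /= andbT; congr (_ + _)%N.
Qed.

(** The Koszul rule for a permutation. In the induction, inversions that involve
    the first position are those counted by [insert_ptens]. *)
Lemma perm_ptens m (s : 'S_m) y (T : 'I_m -> V) :
  (forall i, homog (y i) (T i)) ->
  sap (sperm V s) (ptens T) =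
  (-1) ^+ oddinv y s *: ptens (fun i => T (s^-1%g i)).
Proof.
elim: m s y T => [|m IHm] s y T hT.
  rewrite [LHS]sap1 /oddinv big_ord0 expr0 scale1r.
  by apply: eq_ptens => -[].
rewrite [sperm V s]/=.
case: pickP => [s' /eqP es|no]; last first.
  by have [s' /eqP] := lift_permP s; rewrite no.
rewrite [odflt _ _]/= sapM [ptens _]/= sap_tensh sap1.
rewrite (IHm _ (fun i => y (lift ord0 i))) // spureZr sapZ.
rewrite (insert_ptens _ (hT ord0) (y := fun i => y (lift ord0 (s'^-1%g i)))) //.
have sl i : s (lift ord0 i) = lift (s ord0) (s' i).
  by rewrite -[in LHS]es lift_perm_lift.
rewrite scalerA -exprD; congr (_ ^+ _ *: _).
  rewrite /oddinv [RHS]big_ord_recl addnC; congr (_ + _)%N.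
    rewrite [RHS]big_ord_recl /= !andbF add0n.
    rewrite (reindex_inj (@perm_inj _ s')) /=; apply: eq_bigr => i _.
    rewrite permK sl; congr (nat_of_bool [&& _, _ & _]).
    rewrite /= /bump; case: leqP => h /=; last by rewrite add0n h.
    by rewrite add1n ltnNge (leq_trans h) // ltnNge h.
  apply: eq_bigr => i _; rewrite [RHS]big_ord_recl /= !andbF add0n.
  apply: eq_bigr => j _; rewrite !sl; congr (nat_of_bool [&& _, _, _ & _]).
  by rewrite /= /bump; do 2!case: leqP; lia.
apply: eq_ptens => j; rewrite /insert_at.
case: (unliftP (s ord0) j) => [i|] ->; last by rewrite permK.
congr T; apply: (@perm_inj _ s); rewrite permKV sl permKV //.
Qed.

End SuperAction.

(** * Vanishing of a Young symmetrizer *)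

Arguments letter {L V} l.

Section Kill.
Variables (L : fieldType) (V : superVec L).
Hypothesis char2 : (2%:R : L) != 0.
Local Notation d := (\dim {:V}).

Definition syoung (la : seq nat) : shom (vpow V (sumn la)) (vpow V (sumn la)) :=
  scomp (\sum_(p in row_stab la) sperm V p)
        (\sum_(q in col_stab la) (-1) ^+ q *: sperm V q).

Lemma syoungE la : young_symmetrizer la (V : sVec L) = syoung la.
Proof. by []. Qed.

Lemma sap_sum (U W : superVec L) I r (Q : pred I) (f : I -> shom U W) (u : U) :
  sap (\sum_(i <- r | Q i) f i) u = \sum_(i <- r | Q i) sap (f i) u.
Proof.
elim/big_rec2: _ => [|i x y _ <-]; first exact: zero_lfunE.
exact: add_lfunE.
Qed.

(** Reindexing by t shows that the sum is equal to its opposite. *)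
Lemma sum_antisym n (W : lmodType L) (G : {set 'S_n}) (t : 'S_n) (F : 'S_n -> W) :
    (forall p, ((t * p)%g \in G) = (p \in G)) ->
    (forall p, F (t * p)%g = - F p) ->
  \sum_(p in G) F p = 0.
Proof.
move=> tG tF; set S := \sum_(p in G) F p.
have e : S = - S.
  rewrite {1}/S (reindex_inj (mulgI t)) /= -sumrN.
  by apply: eq_big => [p|p _]; [exact: tG | exact: tF].
have : 2%:R *: S = 0 by rewrite scaler_nat mulr2n {2}e subrr.
by move/eqP; rewrite scaler_eq0 (negPf char2) => /eqP.
Qed.

Lemma stab_tperm n (T : eqType) (c : 'I_n -> T) i j p : c i = c j ->
  ((tperm i j * p)%g \in [set s : 'S_n | [forall k, c (s k) == c k]]) =
  (p \in [set s : 'S_n | [forall k, c (s k) == c k]]).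
Proof.
move=> cij; have ct k : c (tperm i j k) = c k by case: tpermP => [->|->|].
rewrite !inE; apply/forallP/forallP => h k; apply/eqP.
  have /eqP := h (tperm i j k).
  by rewrite permM tpermK ct.
by rewrite permM (eqP (h _)) ct.
Qed.

Section Fixed.
Variables (n : nat) (y : 'I_n -> bool) (T : 'I_n -> V) (i j : 'I_n).
Hypothesis hT : forall k, homog (y k) (T k).
Hypotheses (nij : i != j) (Tij : T i = T j).

Lemma T_tperm (p : 'S_n) :
  ptens (fun k => T ((tperm i j * p)^-1%g k)) = ptens (fun k => T (p^-1%g k)).
Proof.
apply: eq_ptens => k; rewrite invMg permM tpermV.
by case: tpermP => [->|->|].
Qed.

(** The transposition of i and j preserves the tensor up to the sign -1, which is
    the Koszul sign for two odd vectors. *)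
Lemma row_kill (c : 'I_n -> nat) : y i -> y j -> c i = c j ->
  sap (\sum_(p in [set s : 'S_n | [forall k, c (s k) == c k]]) sperm V p)
    (ptens T) = 0.
Proof.
move=> yi yj cij; rewrite sap_sum.
apply: (@sum_antisym _ _ _ (tperm i j)) => p; first exact: stab_tperm.
rewrite !(perm_ptens _ hT) T_tperm -scaleNr; congr (_ *: _).
rewrite -signr_odd oddinvM; last first.
  by move=> k; case: tpermP => [->|->|] //; rewrite yi yj.
by rewrite oddinv_tperm // addTb signrN signr_odd.
Qed.

(** Two even vectors are exchanged without a sign, so that the sign -1 is here the
    signature of the transposition. *)
Lemma col_kill (c : 'I_n -> nat) : ~~ y i -> ~~ y j -> c i = c j ->
  sap (\sum_(p in [set s : 'S_n | [forall k, c (s k) == c k]])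
    (-1) ^+ p *: sperm V p) (ptens T) = 0.
Proof.
move=> yi yj cij; rewrite sap_sum.
apply: (@sum_antisym _ _ _ (tperm i j)) => p; first exact: stab_tperm.
have sapZl (a : L) (f : shom (vpow V n) (vpow V n)) u : sap (a *: f) u = a *: sap f u.
  exact: scale_lfunE.
rewrite !sapZl !(perm_ptens _ hT) T_tperm oddinv_even_tperm //.
by rewrite odd_permM odd_tperm nij addTb signrN scaleNr.
Qed.
End Fixed.

(** A tableau of letters with d + 1 rows and d (d + 1) + 1 columns has either two
    equal even letters in a column, and is killed by the column antisymmetrizer,
    or an odd letter in every column; after any permutation of the boxes inside
    the columns there are still so many odd letters that some row contains d + 1
    of them, hence two equal ones, and is killed by the row symmetrizer. *)
Lemma syoung_eq0 : syoung (nseq d.+1 (d.+1 * d).+1) = 0.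
Proof.
set la := nseq _ _; set R := d.+1; set C := (R * d).+1.
have sizela : size la = R by rewrite size_nseq.
have nthla r : (r < R)%N -> nth 0 la r = C by rewrite nth_nseq => ->.
have box_lt (r : 'I_R) (c : 'I_C) : (flatten_index la r c < sumn la)%N.
  by apply: flatten_indexP; rewrite ?sizela // nthla.
pose box r c := Ordinal (box_lt r c).
have rowbox r c : reshape_index la (box r c) = r.
  by apply: flatten_indexKl; rewrite nthla.
have colbox r c : reshape_offset la (box r c) = c.
  by apply: flatten_indexKr; rewrite nthla.
apply: submod_inj; apply: ptens_ext => T.
rewrite zero_lfunE; set N := sumn la in T *.
change (sap (syoung la) (ptens (letter \o T)) = 0).
have hT k : homog (T k).2 ((@letter L V \o T) k) by exact: homog_letter.
rewrite /syoung sapM.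
case: (boolP [exists c : 'I_C, exists r : 'I_R, exists r' : 'I_R,
   [&& r != r', ~~ (T (box r c)).2 & T (box r c) == T (box r' c)]]).
  case/existsP=> c /existsP[r /existsP[r' /and3P[nr ev /eqP eT]]].
  rewrite [X in sap _ X](@col_kill _ (fun k => (T k).2) _ (box r c) (box r' c)) //.
  - by rewrite /sap linear0.
  - apply: contraNneq nr => /(congr1 (fun k : 'I_N => reshape_index la k)).
    by rewrite !rowbox => /val_inj->.
  - by rewrite /= eT.
  - by rewrite -eT.
  - by rewrite !colbox.
move=> noT.
(* the d + 1 letters of a column cannot all be even and distinct *)
have oddcol (c : 'I_C) : {r : 'I_R | (T (box r c)).2}.
  apply/sigW; apply/existsP; rewrite -[[exists _, _]]negbK negb_exists.
  apply/forallP => ev; move/negP: noT; apply.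
  pose f (r : 'I_R) := (T (box r c)).1.
  have /injectivePn[r [r' nr e]] : ~~ injectiveb f.
    by apply/injectiveP => /leq_card; rewrite !card_ord ltnn.
  apply/existsP; exists c; apply/existsP; exists r; apply/existsP; exists r'.
  rewrite nr ev /=; apply/eqP; move: e (ev r) (ev r'); rewrite /f.
  by case: (T _) (T _) => [a []] [a' []] //= ->.
rewrite [X in sap _ X]sap_sum [LHS]linear_sum big1 // => q qcol.
have -> : sap ((-1) ^+ q *: sperm V q) (ptens (letter \o T)) =
    (-1) ^+ q *: sap (sperm V q) (ptens (letter \o T)) by exact: scale_lfunE.
rewrite (perm_ptens _ hT) scalerA /sap linearZ /=.
apply/eqP; rewrite scaler_eq0; apply/orP; right; apply/eqP.
(* f sends a column to the row that its odd box reaches under q, and to the index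
   of the letter in it: there are more columns than values of f *)
pose T' k := T (q^-1%g k).
pose f (c : 'I_C) : 'I_R * 'I_d :=
  let k := q (box (sval (oddcol c)) c) in
  (inord (reshape_index la k), (T' k).1).
have /injectivePn[c [c' nc [er el]]] : ~~ injectiveb f.
  apply/injectiveP => /leq_card; rewrite card_prod !card_ord.
  by rewrite ltnn.
set k := q (box _ c) in er el; set k' := q (box _ c') in er el.
have oT (c0 : 'I_C) : (T' (q (box (sval (oddcol c0)) c0))).2.
  by rewrite /T' permK; case: (oddcol c0).
apply: (@row_kill _ (fun k => (T' k).2) (letter \o T') k k').
- by move=> k0; exact: homog_letter.
- apply: contraNneq nc => /perm_inj/(congr1 (fun k : 'I_N => reshape_offset la k)).
  by rewrite !colbox => /val_inj->.
- rewrite /=; congr letter; move: el (oT c) (oT c'); rewrite -/k -/k'.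
  by case: (T' k) (T' k') => [a []] [a' []] //= ->.
- exact: oT.
- exact: oT.
- have := congr1 val er; rewrite /= !inordK //.
  + by have := reshape_indexP (ltn_ord k'); rewrite sizela.
  + by have := reshape_indexP (ltn_ord k); rewrite sizela.
Qed.
End Kill.

(** * Schur-finiteness *)

(** The image of the zero morphism is the direct summand of the tensor power cut
    out by the idempotent 0. *)
Lemma schur_finite_young (K : fieldType) (A : symCat K) (M : A) (la : seq nat) :
  is_partition la -> young_symmetrizer la M = 0 -> schur_finite M.
Proof.
move=> pla y0; exists la; split => //.
pose z : hom (tpow M (sumn la)) (tpow M (sumn la)) := 0.
have i0 : z ∘ z = z by exact: comp0f.
pose Z : karoubi A := KarObj i0.
have Z0 : is_zero Z.
  move=> X; split=> f; apply: submod_inj => /=.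
    by rewrite -(khom_r (X := Z)) compf0.
  by rewrite -(khom_l (Y := Z)) comp0f.
exists Z; split=> //; exists 0, 0, 0, 0; split.
- by rewrite compf0; apply: submod_inj.
- by rewrite compf0; apply: submod_inj.
- by rewrite compf0; apply: submod_inj; rewrite /= y0.
Qed.

Section SchurFinite.
Variables (K : fieldType) (A : rigidCat K).
Hypothesis charK : [pchar K] =i pred0.

(** As the Young symmetrizer vanishes for H(X), that of X is sent to 0 by H; hence
    its product with any morphism has trace 0, and it is 0 in the quotient by N. *)
Lemma schur_finite_origin : homological_origin A -> forall M : A, schur_finite M.
Proof.
move=> [A0 [[L [iota [H]]] [F [Fbij _]]]] M.
pose X : A0 := F M; pose d := \dim {:(H X : superVec L)}.
pose la := nseq d.+1 (d.+1 * d).+1.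
apply: (@schur_finite_young _ _ _ la).
  apply/andP; split; last by apply/allP => k /nseqP[->].
  by rewrite /la /=; elim: (d in path _ _ (nseq d _)) => //= n ->; rewrite leqnn.
have char2 : (2%:R : L) != 0.
  by rewrite -(rmorph_nat iota) fmorph_eq0 (proj1 (pcharf0P K) charK).
have HX : fhom H (young_symmetrizer la X) = 0.
  by apply: fhom_young_eq0; rewrite syoungE; exact: syoung_eq0.
have [F' F'K _] := Fbij (tpow M (sumn la)) (tpow M (sumn la)).
apply: (can_inj F'K); rewrite fhom0; apply: fhom_young_eq0.
rewrite -[LHS](cmor_young (quot_change A0)).
have <- : cmor (quot_change A0) (0 : hom (tpow X (sumn la)) (tpow X (sumn la))) = 0.
  exact: cpi0.
apply/quot_piP; rewrite subr0 => g; apply: (fmorph_inj iota); rewrite rmorph0.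
have -> : iota (tr (g ∘ young_symmetrizer la X)) = 0 :> L.
  rewrite (tr_realisation H) fhom_comp HX compf0.
  suff -> : endmx (slin (0 : hom (H (tpow X (sumn la))) (H (tpow X (sumn la))))) = 0.
    by rewrite mulmx0 linear0.
  by apply/matrixP => i j; rewrite !mxE zero_lfunE linear0.
by [].
Qed.
End SchurFinite.

(** * Super traces of the powers of a matrix *)

Section MatrixTraces.
Variable F : fieldType.

(** Write E = C R with C injective and R surjective: then R C is the identity, and
    has the same trace as E. *)
Lemma tr_idempotent n (E : 'M[F]_n) : E *m E = E -> \tr E = (\rank E)%:R.
Proof.
move=> EE.
have [CR] := (mulmx_base E, (row_base_free E, col_base_full E)).
move: (\rank E) (col_base E) (row_base E) CR => r C R CR [Rf Cf].
suff RC : R *m C = 1%:M by rewrite -CR mxtrace_mulC RC mxtrace1.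
apply: (row_full_inj Cf); apply: (row_free_inj Rf) => /=.
by rewrite mulmx1 !mulmxA CR -mulmxA CR.
Qed.

(** X - M divides X^N in the matrix algebra, so that the characteristic polynomial
    of M divides a power of X. *)
Lemma tr_nilpotent n (M : 'M[F]_n) N : M ^+ N = 0 -> \tr M = 0.
Proof.
case: n M => [|n] M MN; first by rewrite /mxtrace big_ord0.
pose X : 'M[{poly F}]_n.+1 := 'X%:M; pose Mp := map_mx (@polyC F) M.
have XM : GRing.comm X Mp by apply: esym; exact: scalar_mxC.
have MpN : Mp ^+ N = 0 by rewrite /Mp -rmorphXn /= MN map_mx0.
have e := subrXX_comm N XM; rewrite MpN subr0 in e.
have XN : X ^+ N = ('X ^+ N)%:M by rewrite /X -rmorphXn.
have : char_poly M %| ('X - 0%:P) ^+ (N * n.+1).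
  rewrite subr0 exprM -det_scalar -XN e -/(X - Mp).
  by rewrite [X in _ %| X]det_mulmx dvdp_mulr.
case/dvdp_exp_XsubCP => k _; rewrite subr0 eqp_monic ?char_poly_monic ?monicXn //.
move=> /eqP eX; have := char_poly_trace M (ltn0Sn n).
have := size_char_poly M; rewrite eX size_polyXn => -[->].
by rewrite coefXn /= ltn_eqF // => /esym/eqP; rewrite oppr_eq0 => /eqP.
Qed.

Section SuperTracePowers.
Variables (n : nat) (P Q : 'M[F]_n.+1).
Hypotheses (PP : P * P = P) (PQ : Q * P = P * Q).
Local Notation str M := (\tr ((1 - 2%:R *: P) * M)).

Lemma strE M : str M = \tr M - 2%:R * \tr (P *m M).
Proof. by rewrite mulrBl mul1r linearB /= -scalerAl linearZ. Qed.

Lemma horner_mx_sum p : horner_mx Q p = \sum_(i < size p) p`_i *: Q ^+ i.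
Proof.
rewrite -[p in LHS]coefK poly_def linear_sum; apply: eq_bigr => i _.
by rewrite linearZ /= rmorphXn /= horner_mx_X.
Qed.

Lemma horner_mx_commP p : P * horner_mx Q p = horner_mx Q p * P.
Proof.
rewrite horner_mx_sum mulr_sumr mulr_suml; apply: eq_bigr => i _.
rewrite -scalerAr -scalerAl; congr (_ *: _).
exact/commrX/esym.
Qed.

Lemma str_horner p : str (horner_mx Q p) = \sum_(i < size p) p`_i * str (Q ^+ i).
Proof.
rewrite horner_mx_sum mulr_sumr linear_sum; apply: eq_bigr => i _.
by rewrite -scalerAr linearZ.
Qed.

Lemma horner_mx_eq0 p : char_poly Q %| p -> horner_mx Q p = 0.
Proof. by case/dvdpP => q ->; rewrite rmorphM /= Cayley_Hamilton mulr0. Qed.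

(** The idempotent is the spectral projection of Q for the eigenvalue 1, which is
    a polynomial e in Q with e(0) = 0 and e(1) = 1. *)
Lemma str_const_int d :
  (forall k, (0 < k)%N -> str (Q ^+ k) = d) -> exists z : int, d = z%:~R.
Proof.
move=> Qd; have [m [q nq1 chi]] := multiplicity_XsubC (char_poly Q) 1.
rewrite monic_neq0 ?char_poly_monic //= in nq1.
have cop : coprimep (q * 'X) (('X - 1%:P) ^+ m.+1).
  rewrite coprimep_expr // coprimep_XsubC rootM negb_or nq1 /=.
  by rewrite -[X in root X]subr0 root_XsubC oner_eq0.
have [[u v] /= uv] := Bezout_eq1_coprimepP _ _ cop.
set e := u * (q * 'X) in uv; have e1 : e = 1 - v * ('X - 1%:P) ^+ m.+1.
  by rewrite -uv addrK.
pose E := horner_mx Q e.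
have EE : E * E = E.
  apply/eqP; rewrite -subr_eq0 -rmorphM -rmorphB /=; apply/eqP/horner_mx_eq0.
  have -> : e * e - e = char_poly Q * (- (u * 'X * v * ('X - 1%:P))).
    rewrite -[X in _ - X]mulr1 -mulrBr {2}e1 addrAC subrr add0r chi /e exprS.
    by rewrite !mulrN !mulrA; congr (- _); rewrite mulrC; ring.
  exact: dvdp_mulr.
have dE : d = str E.
  have e0 : e`_0 = 0 by rewrite /e mulrA coefMX.
  have : e.[1] = 1 by rewrite e1 !hornerE subrr expr0n mulr0 subr0.
  rewrite str_horner horner_coef => es.
  transitivity (\sum_(i < size e) e`_i * 1 ^+ i * d).
    by rewrite -mulr_suml es mul1r.
  apply: eq_bigr => -[[|i] hi] _ /=.
    by rewrite e0 !mul0r.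
  by rewrite Qd // expr1n mulr1. 
have PE := horner_mx_commP e.
rewrite dE strE tr_idempotent // tr_idempotent; last first.
  by rewrite -/(P * E * (P * E)) -mulrA (mulrA E) -PE mulrA -mulrA !mulrA PP -mulrA EE.
exists ((\rank E)%:Z - 2%:Z * (\rank (P *m E))%:Z).
by rewrite rmorphB rmorphM.
Qed.

(** The same argument with the spectral projection for the eigenvalue 0: up to a
    nilpotent matrix, Q is the value at Q of a polynomial divisible by a high power
    of X. *)
Lemma str_nilpotent m :
  (forall k, (m <= k)%N -> str (Q ^+ k) = 0) -> str Q = 0.
Proof.
move=> Q0; have [m' [q nq0 chi]] := multiplicity_XsubC (char_poly Q) 0.
rewrite monic_neq0 ?char_poly_monic //= subr0 in nq0 chi.
pose N := (m + m').+1.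
have cop : coprimep q ('X ^+ N).
  by rewrite coprimep_expr // -[X in coprimep _ X]subr0 coprimep_XsubC.
have [[u v] /= uv] := Bezout_eq1_coprimepP _ _ cop.
pose W := horner_mx Q (u * q * 'X).
have QW : Q = W + horner_mx Q (v * 'X * 'X ^+ N).
  rewrite -rmorphD /= -[LHS]horner_mx_X; congr (horner_mx Q _).
  by rewrite -[LHS]mul1r -uv; ring.
have WN : W ^+ N = 0.
  rewrite -rmorphXn /=; apply: horner_mx_eq0; rewrite chi !exprMn.
  have -> : 'X ^+ N = 'X ^+ m' * 'X ^+ m.+1 :> {poly F} by rewrite -exprD addnC.
  have -> : q ^+ N = q * q ^+ (m + m') by rewrite -exprS.
  by apply/dvdpP; exists (u ^+ N * q ^+ (m + m') * 'X ^+ m.+1); ring.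
have W0 : str W = 0.
  rewrite strE (tr_nilpotent WN) (@tr_nilpotent _ (P * W) N) ?mulr0 ?subr0 //.
  by rewrite exprMn_comm ?WN ?mulr0 //; apply: horner_mx_commP.
rewrite [X in str X]QW mulrDr linearD /= W0 add0r str_horner big1 // => i _.
rewrite coefMXn; case: ltnP => iN; first by rewrite mul0r.
by rewrite Q0 ?mulr0 //; apply: leq_trans iN; rewrite ltnW // ltnS leq_addr.
Qed.
End SuperTracePowers.
End MatrixTraces.

(** * Common extensions of fields *)

Section Compositum.

Lemma irreducible_factor (F : fieldType) (p : {poly F}) :
  (1 < size p)%N -> exists2 r : {poly F}, irreducible_poly r & r %| p.
Proof.
have [n] := ubnP (size p); elim: n p => // n IHn p sp p1.
have [irr|nirr] := pselect (irreducible_poly p); first by exists p.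
have [q [q1 qp nqp]] : exists q : {poly F}, [/\ size q != 1, q %| p & ~~ (q %= p)].
  apply: contrapT => no; apply: nirr; split=> // q q1 qp.
  by apply: contrapT => /negP nqp; apply: no; exists q.
have p0 : p != 0 by rewrite -size_poly_gt0 (ltn_trans _ p1).
have sq : (size q < size p)%N.
  by rewrite ltn_neqAle dvdp_leq // (dvdp_size_eqp qp) nqp.
have q0 : q != 0 by apply: contraNneq p0 => q0; rewrite -dvd0p -q0.
have [||r irr rq] := IHn q; first by apply: leq_trans sq _; rewrite -ltnS.
  by case: (size q) q1 (size_poly_gt0 q) => [|[|]] //; rewrite q0.
by exists r => //; apply: dvdp_trans qp.
Qed.

Lemma minimal_annihilator (F E : fieldType) (j : {rmorphism F -> E}) (c : E) :
    algebraicOver j c ->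
  exists p : {poly F}, [/\ p != 0, root (map_poly j p) c &
    forall q, root (map_poly j q) c -> p %| q].
Proof.
case=> p0 p0n p0c.
pose Q n := `[< exists p : {poly F}, [/\ p != 0, root (map_poly j p) c & size p = n] >].
have exQ : exists n, Q n by exists (size p0); apply/asboolP; exists p0.
case: (ex_minnP exQ) => n /asboolP[p [pn pc sp]] min.
exists p; split=> // q qc; apply: contraT => nd.
have rc : root (map_poly j (q %% p)) c.
  have := qc; rewrite {1}(divp_eq q p) rmorphD rmorphM /= /root hornerD hornerM.
  by rewrite (eqP (pc : _ == 0)) mulr0 add0r.
have := min (size (q %% p)); rewrite -sp leqNgt ltn_modp pn; apply.
by apply/asboolP; exists (q %% p).
Qed.

(** With p the minimal polynomial of c, K1(c) embeds in an extension of L1 where an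
    irreducible factor of the image of p has a root. *)
Lemma compositum_step (K1 Kb L1 : fieldType) (j : {rmorphism K1 -> Kb})
    (b : {rmorphism K1 -> L1}) (c : Kb) : algebraicOver j c ->
  exists (K2 L2 : fieldType) (s : {rmorphism K1 -> K2})
    (j2 : {rmorphism K2 -> Kb}) (t : {rmorphism L1 -> L2})
    (b2 : {rmorphism K2 -> L2}),
    [/\ forall x, j2 (s x) = j x, forall x, b2 (s x) = t (b x) &
        exists x, j2 x = c].
Proof.
move=> /minimal_annihilator[p [p0 pc pmin]].
have sp : (1 < size (map_poly b p))%N.
  rewrite size_map_poly -(size_map_poly j).
  by apply: root_size_gt1 pc; rewrite map_poly_eq0.
have [r irr rp] := irreducible_factor sp.
have [L2 _ [th rth _]] := irredp_FAdjoin irr.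
pose t : {rmorphism L1 -> L2} := in_alg L2.
have ptb : root (map_poly t (map_poly b p)) th.
  have [q ->] := dvdpP _ _ rp.
  by rewrite rmorphM rootM rth orbT.
pose K2 := subFExtend j c p.
pose s : {rmorphism K1 -> K2} := inj_subfx j c p.
pose j2 : {rmorphism K2 -> Kb} := subfx_inj.
pose ev2 (q : {poly K1}) : L2 := (map_poly t (map_poly b q)).[th].
pose lift2 (x : K2) := projT1 (cid (subfxE x)).
pose b2 x := ev2 (lift2 x).
have j2E q : j2 (subfx_eval j c p q) = (map_poly j q).[c] by exact: subfx_inj_eval.
have b2E q : b2 (subfx_eval j c p q) = ev2 q.
  rewrite /b2 /lift2; case: cid => q' /= e; apply/eqP.
  rewrite -subr_eq0 /ev2 -hornerN -hornerD -!rmorphB.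
  have /dvdpP[u ->] : p %| q' - q.
    apply: pmin; rewrite rmorphB /root hornerD hornerN -!j2E -e.
    by rewrite subrr.
  by rewrite !rmorphM hornerM (eqP (ptb : _ == 0)) mulr0.
have b2_add : zmod_morphism b2.
  move=> x y; have [q ->] := subfxE x; have [q' ->] := subfxE y.
  by rewrite -rmorphB !b2E /ev2 !rmorphB hornerD hornerN.
have b2_mul : monoid_morphism b2.
  split=> [|x y].
    by rewrite -(rmorph1 (subfx_eval j c p)) b2E /ev2 !rmorph1 hornerC.
  have [q ->] := subfxE x; have [q' ->] := subfxE y.
  by rewrite -rmorphM !b2E /ev2 !rmorphM hornerM.
pose B := GRing.isZmodMorphism.Build _ _ b2 b2_add.
pose M := GRing.isMonoidMorphism.Build _ _ b2 b2_mul.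
pose B2 : {rmorphism K2 -> L2} := HB.pack b2 B M.
exists K2, L2, s, j2, t, B2; split=> [x|x|].
- by rewrite /s /= /inj_subfx /= j2E map_polyC hornerC.
- by rewrite /s /= /inj_subfx /= b2E /ev2 !map_polyC hornerC.
- by exists (subfx_eval j c p 'X); rewrite j2E map_polyX hornerX.
Qed.

(** An algebraic closure of K need not embed in an extension L of K, but finitely
    many of its elements lie in a subfield K1 such that K1 and L have a common
    extension. *)
Lemma compositum (K Kb L : fieldType) (k : {rmorphism K -> Kb})
    (i : {rmorphism K -> L}) (cs : seq Kb) :
    (forall c, algebraicOver k c) ->
  exists (K1 L1 : fieldType) (k1 : {rmorphism K -> K1})
    (j : {rmorphism K1 -> Kb}) (t : {rmorphism L -> L1})
    (b : {rmorphism K1 -> L1}),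
    [/\ forall x, j (k1 x) = k x, forall x, b (k1 x) = t (i x) &
        forall c, c \in cs -> exists x, j x = c].
Proof.
move=> alg; elim: cs => [|c cs [K1 [L1 [k1 [j [t [b [jk bk im]]]]]]]].
  by exists K, L, idfun, k, idfun, i.
have [|K2 [L2 [s [j2 [t2 [b2 [js bs [y yc]]]]]]]] := @compositum_step _ _ _ j b c.
  have [p p0 pc] := alg c; exists (map_poly k1 p); first by rewrite map_poly_eq0.
  by rewrite -map_poly_comp (eq_map_poly jk).
exists K2, L2, (s \o k1), j2, (t2 \o t), b2; split=> [x|x|c'].
- by rewrite /= js jk.
- by rewrite /= bs bk.
- rewrite inE => /predU1P[->|/im[x <-]]; first by exists y.
  by exists (s x).
Qed.
End Compositum.

(** * Dual bases for the trace form *)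

Section EndoTrace.
Variables (K : fieldType) (A : rigidCat K) (M : A).
Implicit Types f g : endo M.

(** [tr], with a domain on which products are written in the endomorphism ring. *)
Definition etr f : K := tr (f : hom M M).

Lemma etrD f g : etr (f + g) = etr f + etr g.
Proof. by have := tr_linear 1 (f : hom M M) g; rewrite scale1r mul1r. Qed.
Lemma etr0 : etr (0 : endo M) = 0.
Proof. by apply: (addrI (etr 0)); rewrite -etrD !addr0. Qed.
Lemma etrZ a f : etr (a *: f) = a * etr f.
Proof.
by have := tr_linear a (f : hom M M) 0; rewrite addr0 [tr 0]etr0 addr0.
Qed.
Lemma etrB f g : etr (f - g) = etr f - etr g.
Proof. by rewrite etrD -scaleN1r etrZ mulN1r. Qed.
Lemma etr_sum I r (Q : pred I) (F : I -> endo M) :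
  etr (\sum_(i <- r | Q i) F i) = \sum_(i <- r | Q i) etr (F i).
Proof. exact: (big_morph _ etrD etr0). Qed.

Lemma endo_scaleAl a f g : (a *: f) * g = a *: (f * g).
Proof. exact: compZl. Qed.
Lemma endo_scaleAr a f g : f * (a *: g) = a *: (f * g).
Proof. exact: compZr. Qed.
End EndoTrace.

Lemma tr_mxvec (F : fieldType) n (D B H : 'M[F]_n) :
  \tr (D * (B * H)) =
  \sum_a mxvec B 0 a * \tr (D * (vec_mx (delta_mx 0 a) * H)).
Proof.
rewrite -{1}(mxvecK B) [in LHS](row_sum_delta (mxvec B)) linear_sum /=.
rewrite mulr_suml mulr_sumr linear_sum; apply: eq_bigr => a _.
by rewrite linearZ /= -[_ * H]scalemxAl -[D * _]scalemxAr linearZ.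
Qed.

Section DualBases.
Variables (K : fieldType) (A : rigidCat K) (M : A).
Variables (L : fieldType) (iota : {rmorphism K -> L}) (n : nat) (P : 'M[L]_n).
Variable h : endo M -> 'M[L]_n.
Hypothesis hP : forall f, h f * P = P * h f.
Hypothesis h_tr : forall s : seq (endo M),
  iota (etr (\prod_(f <- s) f)) = \tr ((1 - 2%:R *: P) * \prod_(f <- s) h f).
Hypothesis nondeg : forall f : endo M, (forall g, etr (g * f) = 0) -> f = 0.
Implicit Types f g : endo M.

Let etr2 f g : iota (etr (f * g)) = \tr ((1 - 2%:R *: P) * (h f * h g)).
Proof. by have := h_tr [:: f; g]; rewrite !big_cons !big_nil !mulr1. Qed.

Lemma etrC f g : etr (f * g) = etr (g * f).
Proof.
have hD : h g *m (1 - 2%:R *: P) = (1 - 2%:R *: P) *m h g.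
  rewrite mulmxBr mulmxBl mulmx1 mul1mx -scalemxAr -scalemxAl.
  by congr (_ - _ *: _); exact: hP.
apply: (fmorph_inj iota); rewrite !etr2 mulrA [LHS]mxtrace_mulC.
by rewrite mulmxA hD -mulmxA.
Qed.

Definition dual_families m (f g : 'I_m -> endo M) :=
  forall i j, etr (f i * g j) = (i == j)%:R.

(** The Gram matrix of f and g factors through the space of matrices of size n,
    because of the matrix model h. *)
Lemma dual_families_bound m (f g : 'I_m -> endo M) :
  dual_families f g -> (m <= n * n)%N.
Proof.
move=> fg; pose X : 'M[L]_(m, n * n) := \matrix_i mxvec (h (f i)).
suff /eqP <- : row_free X by exact: rank_leq_col.
apply/row_freeP; pose Y : 'M[L]_(n * n, m) := \matrix_(a, j)
  \tr ((1 - 2%:R *: P) * (vec_mx (delta_mx 0 a) * h (g j))).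
exists Y; apply/matrixP => i j; rewrite !mxE -(rmorph_nat iota) -fg etr2.
by rewrite tr_mxvec; apply: eq_bigr => a _; rewrite !mxE.
Qed.

(** Dual families f and g of maximal length are dual bases: if u is not in the span
    of f, then removing its components along f, and normalising a vector that pairs
    non-trivially with the result, extends the two families. *)
Lemma dual_bases : exists m (f g : 'I_m -> endo M),
  dual_families f g /\ forall u, u = \sum_j etr (u * g j) *: f j.
Proof.
pose Q m := `[< exists f g : 'I_m -> endo M, dual_families f g >].
have exQ : exists m, Q m.
  by exists 0%N; apply/asboolP; exists (fun=> 0), (fun=> 0) => -[].
have Qle m : Q m -> (m <= n * n)%N.
  by move=> /asboolP[f [g]]; apply: dual_families_bound.
case: (ex_maxnP exQ Qle) => m /asboolP[f [g fg]] max.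
exists m, f, g; split=> // u; apply/eqP; rewrite -subr_eq0; apply: contraT => u0.
set u' := u - _ in u0.
have u'g j : etr (u' * g j) = 0.
  rewrite mulrBl etrB mulr_suml etr_sum (bigD1 j) //= big1.
    by rewrite endo_scaleAl etrZ fg eqxx addr0 mulr1 subrr.
  move=> i ij; rewrite endo_scaleAl etrZ fg (negPf ij).
  by rewrite mulr0.
have [v v1] : exists v, etr (u' * v) != 0.
  apply: contrapT => no; move/eqP: u0; apply; apply: nondeg => v.
  by rewrite etrC; apply: contrapT => /eqP nz; apply: no; exists v.
pose w := v - \sum_i etr (f i * v) *: g i.
have fw i : etr (f i * w) = 0.
  rewrite mulrBr etrB mulr_sumr etr_sum (bigD1 i) //= big1.
    by rewrite endo_scaleAr etrZ fg eqxx addr0 mulr1 subrr.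
  move=> j ij; rewrite endo_scaleAr etrZ fg eq_sym (negPf ij).
  by rewrite mulr0.
have u'w : etr (u' * w) = etr (u' * v).
  rewrite mulrBr etrB mulr_sumr etr_sum big1 ?subr0 // => j _.
  by rewrite endo_scaleAr etrZ u'g mulr0.
pose f' i := if unlift (ord_max : 'I_m.+1) i is Some k then f k else u'.
pose g' i := if unlift (ord_max : 'I_m.+1) i is Some k then g k
             else (etr (u' * v))^-1 *: w.
suff /max : Q m.+1 by rewrite ltnn.
apply/asboolP; exists f', g' => i j; rewrite /f' /g'.
case: (unliftP ord_max i) => [k|] ->; case: (unliftP ord_max j) => [l|] ->.
- by rewrite fg (inj_eq (@lift_inj _ _)).
- by rewrite endo_scaleAr etrZ fw mulr0 eq_sym (negPf (neq_lift _ _)).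
- by rewrite u'g (negPf (neq_lift _ _)).
- by rewrite endo_scaleAr etrZ u'w eqxx mulVf.
Qed.
End DualBases.

(** * Traces of idempotents and of nilpotents after extension of scalars *)

Lemma tr_mulmx_sumr (F : fieldType) n m (D X : 'M[F]_n) (c : 'I_m -> F)
    (Z : 'I_m -> 'M[F]_n) :
  \tr (D * (X * \sum_i c i *: Z i)) = \sum_i c i * \tr (D * (X * Z i)).
Proof.
rewrite !mulr_sumr raddf_sum; apply: eq_bigr => i _ /=.
by rewrite -[X * (_ *: _)]scalemxAr -[D * _]scalemxAr mxtraceZ.
Qed.

Section Extension.
Variables (K : fieldType) (A : rigidCat K) (M : A).
Hypothesis Aho : homological_origin A.
Variables (Kb : fieldType) (kappa : {rmorphism K -> Kb}).
(** [inn] stands for the map from End(M) to its extension of scalars End(M) ⊗ Kb;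
    it is known here through its formal properties. *)
Variables (B : rigidCat Kb) (Mb : B) (inn : endo M -> endo Mb).
Hypothesis alg : forall c, algebraicOver kappa c.
Local Notation E := (endo M).
Local Notation Eb := (endo Mb).
Implicit Types (f g : E) (u v : Eb).
Hypothesis innM : forall f g, inn (f * g) = inn f * inn g.
Hypothesis inn1 : inn 1 = 1.
Hypothesis inn_semilin : semilin kappa inn.
Hypothesis etr_inn : forall f, etr (inn f) = kappa (etr f).
Hypothesis inn_ind : forall Q : Eb -> Prop,
  Q 0 -> (forall a f u, Q u -> Q (a *: inn f + u)) -> forall u, Q u.

Lemma innD f g : inn (f + g) = inn f + inn g.
Proof. by have := inn_semilin 1 f g; rewrite rmorph1 !scale1r. Qed.
Lemma inn0 : inn 0 = 0.
Proof. by apply: (addrI (inn 0)); rewrite -innD !addr0. Qed.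
Lemma innZ a f : inn (a *: f) = kappa a *: inn f.
Proof. by have := inn_semilin a f 0; rewrite inn0 !addr0. Qed.
Lemma inn_sum m (F : 'I_m -> E) : inn (\sum_i F i) = \sum_i inn (F i).
Proof. exact: (big_morph _ innD inn0). Qed.

Lemma etrC_ext u v : etr (u * v) = etr (v * u).
Proof.
have [L [iota [n [P [h [_ hP h_tr]]]]]] := trace_model Aho M.
elim/inn_ind: u => [|a f u IHu]; first by rewrite mul0r mulr0.
rewrite mulrDl mulrDr endo_scaleAl endo_scaleAr !etrD !etrZ IHu.
congr (_ * _ + _); elim/inn_ind: v {IHu} => [|b g v IHv]; first by rewrite mul0r mulr0.
rewrite mulrDl mulrDr endo_scaleAl endo_scaleAr !etrD !etrZ IHv.
by rewrite -!innM !etr_inn (etrC hP h_tr).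
Qed.

Lemma dual_bases_ext : exists m (f g : 'I_m -> Eb),
  (forall i j, etr (f i * g j) = (i == j)%:R) /\
  forall u, u = \sum_j etr (u * g j) *: f j.
Proof.
have [L [iota [n [P [h [_ hP h_tr]]]]]] := trace_model Aho M.
have [m [f [g [fg span]]]] := dual_bases hP h_tr (trace_nondegenerate Aho (M := M)).
exists m, (inn \o f), (inn \o g); split=> [i j|u] /=.
  by rewrite -innM etr_inn fg rmorph_nat.
elim/inn_ind: u => [|a e u IHu].
  by rewrite big1 // => j _; rewrite mul0r etr0 scale0r.
rewrite {1}IHu {1}(span e) inn_sum scaler_sumr -big_split; apply: eq_bigr => j _.
rewrite innZ mulrDl endo_scaleAl etrD etrZ -innM etr_inn.
by rewrite scalerDl scalerA.
Qed.

(** For a single element u of the extended algebra, the traces of the powers of u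
    are super traces of the powers of a matrix Q, over a field that contains a
    field of definition of u. *)
Lemma power_model u :
  exists (K1 L1 : fieldType) (j : {rmorphism K1 -> Kb}) (b : {rmorphism K1 -> L1})
    (n : nat) (P Q : 'M[L1]_n) (t : nat -> K1),
    [/\ P * P = P, Q * P = P * Q, forall k, etr (u ^+ k) = j (t k) &
        forall k, b (t k) = \tr ((1 - 2%:R *: P) * Q ^+ k)].
Proof.
have [L [iota [n [P [h [PP hP h_tr]]]]]] := trace_model Aho M.
have [m [f [g [fg span]]]] := dual_bases hP h_tr (trace_nondegenerate Aho (M := M)).
have [c uE] : exists c : 'I_m -> Kb, u = \sum_i c i *: inn (f i).
  elim/inn_ind: u => [|a e u [c ->]].
    by exists (fun=> 0); rewrite big1 // => i _; rewrite scale0r.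
  exists (fun i => a * kappa (etr (e * g i)) + c i).
  rewrite {1}(span e) inn_sum scaler_sumr -big_split; apply: eq_bigr => i _.
  by rewrite innZ scalerDl scalerA.
have [K1 [L1 [k1 [j [t [b [jk bk im]]]]]]] := compositum iota [seq c i | i : 'I_m] alg.
have [x jx] : exists x : 'I_m -> K1, forall i, j (x i) = c i.
  apply: (@fin_all_exists 'I_m (fun=> K1) (fun i y => j y = c i)) => i.
  by apply: im; apply: image_f.
pose hb f := map_mx t (h f); pose P1 := map_mx t P.
pose Q := \sum_i b (x i) *: hb (f i).
have hbP e : hb e * P1 = P1 * hb e 
  by rewrite -[LHS]map_mxM -[RHS]map_mxM; congr map_mx; exact: hP.
have QP : Q * P1 = P1 * Q.
  rewrite /Q mulr_suml mulr_sumr; apply: eq_bigr => i _.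
  rewrite -[LHS]scalemxAl -[RHS]scalemxAr; congr (_ *: _); exact: hbP.
have QZ Z : Q * Z = \sum_i b (x i) *: (hb (f i) * Z).
  by rewrite /Q mulr_suml; apply: eq_bigr => i _; rewrite -[LHS]scalemxAl.
have key k : forall l : seq E, exists d,
    etr (u ^+ k * inn (\prod_(e <- l) e)) = j d /\
    b d = \tr ((1 - 2%:R *: P1) * (Q ^+ k * \prod_(e <- l) hb e)).
  elim: k => [|k IHk] l.
    exists (k1 (etr (\prod_(e <- l) e))); rewrite !expr0 !mul1r etr_inn jk bk.
    split=> //; rewrite h_tr -[LHS]trace_map_mx; congr (\tr _).
    rewrite [LHS]map_mxM map_mxB map_mxZ map_mx1 rmorph_nat; congr (_ *m _).
    elim/big_rec2: _ => [|i y z _ <-]; first exact: map_mx1.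
    exact: map_mxM.
  have [d dE] := @fin_all_exists 'I_m (fun=> K1) _ (fun i => IHk (f i :: l)).
  exists (\sum_i x i * d i); rewrite !rmorph_sum; split.
    rewrite exprSr -mulrA {2}uE mulr_suml mulr_sumr etr_sum; apply: eq_bigr => i _.
    rewrite rmorphM /= jx endo_scaleAl endo_scaleAr etrZ -innM.
    by have [<- _] := dE i; rewrite big_cons.
  rewrite exprSr -mulrA QZ tr_mulmx_sumr.
  by apply: eq_bigr => i _; rewrite rmorphM /=; have [_ ->] := dE i; rewrite big_cons.
have exd k : exists d, etr (u ^+ k) = j d /\
    b d = \tr ((1 - 2%:R *: P1) * Q ^+ k).
  by have [d] := key k [::]; rewrite !big_nil inn1 !mulr1; exists d.
pose d k := projT1 (cid (exd k)); have dE k := projT2 (cid (exd k)).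
exists K1, L1, j, b, n, P1, Q, d; split=> //.
- by rewrite /P1 -[LHS]map_mxM; congr map_mx; exact: PP.
- by move=> k; case: (dE k).
- by move=> k; case: (dE k).
Qed.

Lemma etr_idempotent u : u * u = u -> exists z : int, etr u = z%:~R.
Proof.
move=> uu; have [K1 [L1 [j [b [n [P [Q [t [PP PQ jt bt]]]]]]]]] := power_model u.
have uk k : (0 < k)%N -> u ^+ k = u.
  by case: k => // k _; elim: k => // k IHk; rewrite exprS IHk.
have tk k : (0 < k)%N -> t k = t 1%N.
  by move=> k0; apply: (fmorph_inj j); rewrite -!jt uk // expr1.
suff [z tz] : exists z : int, b (t 1%N) = z%:~R.
  exists z; rewrite -[u]expr1 jt -(rmorph_int j); congr (j _).
  by apply: (fmorph_inj b); rewrite tz rmorph_int.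
case: n P Q PP PQ bt => [|n] P Q PP PQ bt.
  by exists 0; rewrite bt /mxtrace big_ord0.
by apply: (str_const_int PP PQ) => k k0; rewrite -bt tk.
Qed.

Lemma etr_nilpotent u m : u ^+ m = 0 -> etr u = 0.
Proof.
move=> um; have [K1 [L1 [j [b [n [P [Q [t [PP PQ jt bt]]]]]]]]] := power_model u.
suff t1 : b (t 1%N) = 0.
  by rewrite -[u]expr1 jt; apply/eqP; rewrite fmorph_eq0 -(fmorph_eq0 b) t1.
rewrite bt expr1; case: n P Q PP PQ bt => [|n] P Q PP PQ bt.
  by rewrite /mxtrace big_ord0.
apply: (str_nilpotent PQ (m := m)) => k mk.
rewrite -bt; apply/eqP; rewrite fmorph_eq0 -(fmorph_eq0 j) -jt.
by rewrite -(subnKC mk) exprD um mul0r etr0.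
Qed.
End Extension.

(** * Minimal right ideals *)

Section Eigenvalue.
Variables (F : fieldType) (E : vectType F).
Hypothesis closedF : GRing.closed_field_axiom F.

Lemma stable_eigenvector (f : 'End(E)) (V : {vspace E}) :
    V != 0%VS -> (f @: V <= V)%VS ->
  exists a v, [/\ v \in V, v != 0 & f v = a *: v].
Proof.
move=> V0 fV; set n := \dim V; pose b := vbasis V.
have fb : basis_of V b := vbasisP V.
pose M : 'M[F]_n := \matrix_(i, j) coord b j (f b`_i).
have n0 : (0 < n)%N by rewrite lt0n dimv_eq0.
have [a] : exists a, root (char_poly M) a.
  apply/(PreClosedField.closed_rootP closedF).
  by rewrite size_char_poly; case: n n0 M.
rewrite -eigenvalue_root_char => /eigenvalueP[r rM r0].
have fbV (i : 'I_n) : f b`_i \in V.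
  by apply: (subvP fV); rewrite memv_img // vbasis_mem // mem_nth // size_tuple.
exists a, (\sum_i r 0 i *: b`_i); split.
- apply: memv_suml => i _; rewrite memvZ // vbasis_mem // mem_nth //.
  by rewrite size_tuple.
- apply: contra_neq r0 => r0; apply/rowP => i.
  have := congr1 (coord b i) r0; rewrite coord_sum_free ?(basis_free fb) //.
  by rewrite linear0 mxE.
rewrite linear_sum scaler_sumr /=.
transitivity (\sum_i \sum_j (r 0 i * M i j) *: b`_j).
  apply: eq_bigr => i _; rewrite linearZ /= {1}(coord_vbasis (fbV i)) scaler_sumr.
  by apply: eq_bigr => j _; rewrite scalerA mxE.
rewrite exchange_big; apply: eq_bigr => j _ /=; rewrite -scaler_suml scalerA.
by have /rowP/(_ j) := rM; rewrite !mxE => ->.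
Qed.
End Eigenvalue.

Section MinimalIdeals.
Variables (F : fieldType) (E : falgType F).
Hypothesis closedF : GRing.closed_field_axiom F.
Variable tau : E -> F.
Hypothesis nondeg : forall x, (forall y, tau (x * y) = 0) -> x = 0.
Hypothesis nilp : forall x m, x ^+ m = 0 -> tau x = 0.
Implicit Types (x y e g : E) (V : {vspace E}).

Definition scalar_corner e := forall x, exists a, e * x * e = a *: e.

Definition rideal V := forall v x, v \in V -> v * x \in V.
Definition rprincipal g : {vspace E} := limg (amull g).

Lemma rprincipalP g v : g * g = g -> reflect (g * v = v) (v \in rprincipal g).
Proof.
move=> gg; apply: (iffP memv_imgP) => [[x _ ->]|gv].
  by rewrite lfunE /= mulrA gg.
by exists v; rewrite ?memvf // lfunE.
Qed.

Lemma rideal_principal g : g * g = g -> rideal (rprincipal g).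
Proof.
by move=> gg v x /(rprincipalP _ gg) gv; apply/(rprincipalP _ gg); rewrite mulrA gv.
Qed.

(** A minimal right ideal contains an element that is not nilpotent, since the
    trace form is nondegenerate, and it is then generated by an idempotent e; by
    Schur's lemma e E e is a division algebra, hence reduced to the scalars. *)
Lemma corner_idempotent g : g * g = g -> g != 0 ->
  exists e, [/\ e != 0, e * e = e, g * e = e, e * g = e & scalar_corner e].
Proof.
move=> gg g0.
pose Q n := `[< exists V,
  [/\ V != 0%VS, rideal V, (V <= rprincipal g)%VS & \dim V = n] >].
have exQ : exists n, Q n.
  exists (\dim (rprincipal g)); apply/asboolP; exists (rprincipal g); split=> //.
    apply: contraNneq g0 => V0.
    have : g \in rprincipal g by apply/(rprincipalP _ gg).
    by rewrite V0 memv0.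
  exact: rideal_principal.
case: (ex_minnP exQ) => n /asboolP[V [V0 idV Vg dimV]] min.
have minV U : U != 0%VS -> rideal U -> (U <= V)%VS -> U = V.
  move=> U0 idU UV; apply/eqP; rewrite -(geq_leqif (dimv_leqif_eq UV)) dimV.
  by apply: min; apply/asboolP; exists U; split=> //; apply: subv_trans Vg.
have gV v : v \in V -> g * v = v.
  by move=> vV; apply/(rprincipalP _ gg)/(subvP Vg).
have [w wV wnil] : exists2 w, w \in V & forall m, w ^+ m != 0.
  have [y ty] : exists y, tau (vpick V * y) != 0.
    apply: contrapT => no; move/negP: V0; apply; rewrite -vpick0; apply/eqP.
    by apply: nondeg => y; apply: contrapT => /eqP ty; apply: no; exists y.
  exists (vpick V * y); first exact/idV/memv_pick.
  by move=> m; apply: contra_neq ty; apply: nilp.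
(* multiplication by w is a bijection of the minimal ideal V, so that w = w e0 for
   some e0 in V, which is idempotent *)
have wVV : (amull w @: V)%VS = V.
  apply: minV.
  - apply: contraTneq wV => wV0; apply/negP => wV.
    have : w * w \in (amull w @: V)%VS by apply/memv_imgP; exists w; rewrite ?lfunE.
    by rewrite wV0 memv0 -expr2 (negPf (wnil 2)).
  - move=> _ x /memv_imgP[v vV ->]; apply/memv_imgP; exists (v * x).
      exact: idV.
    by rewrite !lfunE /= mulrA.
  - by apply/subvP => _ /memv_imgP[v vV ->]; rewrite lfunE; apply: idV.
have wker v : v \in V -> w * v = 0 -> v = 0.
  move=> vV wv; have := limg_ker_dim (amull w) V; rewrite wVV => /eqP.
  rewrite -[X in _ == X]add0n eqn_add2r dimv_eq0 => /eqP k0.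
  apply/eqP; rewrite -memv0 -k0 memv_cap vV memv_ker lfunE /=.
  by rewrite wv.
have [e0 e0V we0] : exists2 e0, e0 \in V & w * e0 = w.
  have : w \in (amull w @: V)%VS by rewrite wVV.
  by case/memv_imgP => e0 e0V ew; exists e0; rewrite // {2}ew lfunE.
have e00 : e0 * e0 = e0.
  apply/eqP; rewrite -subr_eq0; apply/eqP/wker; first by rewrite memvB // idV.
  by rewrite mulrBr mulrA !we0 subrr.
have e0n : e0 != 0.
  by apply: contra_neq (wnil 1) => e0z; rewrite expr1 -we0 e0z mulr0.
(* e0 generates V but need not commute with g; e0 g does *)
pose e := e0 * g; have eV : e \in V by exact: idV.
have ee0 : e * e0 = e0 by rewrite /e -mulrA gV.
have ee : e * e = e by rewrite {2}/e mulrA ee0.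
have en : e != 0 by apply: contra_neq e0n => ez; rewrite -ee0 ez mul0r.
have eE : rprincipal e = V.
  apply: minV; last by apply/subvP => v /(rprincipalP _ ee) <-; apply: idV.
    apply: contraNneq en => z; rewrite -memv0 -z; exact/(rprincipalP _ ee).
  exact: rideal_principal.
have eVe v : v \in V -> e * v = v.
  by rewrite -eE => /(rprincipalP _ ee).
exists e; split=> //; first by rewrite gV.
  by rewrite /e -mulrA gg.
move=> x; pose y := e * x * e.
have yV v : v \in V -> y * v \in V.
  by move=> vV; rewrite /y -!mulrA; apply: idV.
have [||a [v [vV v0 yv]]] := @stable_eigenvector _ _ closedF (amull y) V.
- exact: V0.
- by apply/subvP => _ /memv_imgP[v vV ->]; rewrite lfunE; apply: yV.
rewrite lfunE /= in yv.
pose U := (V :&: lker (amull (y - a *: e)))%VS.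
have UP u : u \in U = (u \in V) && (y * u == a *: u).
  rewrite memv_cap memv_ker lfunE /= mulrBl -scalerAl subr_eq0.
  by case uV : (u \in V) => //=; rewrite eVe.
have UV : U = V.
  apply: minV; last exact: capvSl.
    apply: contraNneq v0 => U0; rewrite -memv0 -U0 UP vV yv eqxx //.
  move=> u z; rewrite !UP => /andP[uV /eqP yu]; rewrite idV //= mulrA yu.
  by rewrite scalerAl.
exists a; have : e \in U by rewrite UV.
by rewrite UP => /andP[_ /eqP <-]; rewrite /y -[RHS]mulrA ee.
Qed.

Definition corner_idem e := [/\ e != 0, e * e = e & scalar_corner e].

(** Each [corner_idempotent] e is split off g: the right ideal of g - e is strictly
    smaller than that of g. *)
Lemma corner_decomposition g : g * g = g ->
  exists s : seq E,
    [/\ forall e, e \in s -> corner_idem e,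
        forall e, e \in s -> g * e = e /\ e * g = e,
        pairwise (fun e f => (e * f == 0) && (f * e == 0)) s &
        \sum_(e <- s) e = g].
Proof.
have [n] := ubnP (\dim (rprincipal g)); elim: n g => // n IHn g dg gg.
have [->|g0] := eqVneq g 0; first by exists [::]; rewrite big_nil.
have [e [e0 ee ge eg ce]] := corner_idempotent gg g0.
pose g' := g - e.
have gg' : g * g' = g' by rewrite mulrBr gg ge.
have g'g : g' * g = g' by rewrite mulrBl gg eg.
have eg' : e * g' = 0 by rewrite mulrBr eg ee subrr.
have g'e : g' * e = 0 by rewrite mulrBl ge ee subrr.
have g'g' : g' * g' = g' by rewrite {1}/g' mulrBl gg' eg' subr0.
have [||s [s1 s2 s3 s4]] := IHn g' => //.
  rewrite -ltnS; apply: leq_trans dg; rewrite ltnS.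
  apply: contraT; rewrite -leqNgt => le.
  have sub : (rprincipal g' <= rprincipal g)%VS.
    apply/subvP => v /(rprincipalP _ g'g') <-; apply/(rprincipalP _ gg).
    by rewrite mulrA gg'.
  have /eqP eqV : rprincipal g' == rprincipal g by rewrite eqEdim sub.
  have : e \in rprincipal g' by rewrite eqV; apply/(rprincipalP _ gg).
  by move=> /(rprincipalP _ g'g'); rewrite g'e => ez; rewrite -ez eqxx in e0.
exists (e :: s); split=> [f|f||].
- by rewrite inE => /predU1P[->|/s1].
- rewrite inE => /predU1P[->//|/s2[g'f fg']].
  by split; [rewrite -g'f mulrA gg' | rewrite -fg' -mulrA g'g].
- rewrite pairwise_cons s3 andbT; apply/allP => f /s2[g'f fg'].
  apply/andP; split; first by rewrite -g'f mulrA eg' mul0r.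
  by rewrite -fg' -mulrA g'e mulr0.
- by rewrite big_cons s4 addrC subrK.
Qed.
End MinimalIdeals.

(** * Matrix units *)

(** The size n + 1 is made explicit because a matrix algebra over 'I_n.+1 is not
    zero. *)
Lemma enum_nonempty (T : finType) (S : {set T}) (x : T) : x \in S ->
  exists n (ix : 'I_n.+1 -> T),
    [/\ injective ix, forall a, ix a \in S,
        forall y, y \in S -> exists a, y = ix a &
        forall (V : nmodType) (G : T -> V), \sum_(i in S) G i = \sum_a G (ix a)].
Proof.
move=> xS; have e : #|S|.-1.+1 = #|S| by rewrite prednK // (cardD1 x) xS.
exists #|S|.-1, (fun a => enum_val (cast_ord e a)); split=> [a b|a|y yS|V G].
- by move=> /enum_val_inj/cast_ord_inj.
- exact: enum_valP.
- exists (cast_ord (esym e) (enum_rank_in xS y)).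
  by rewrite cast_ordKV enum_rankK_in.
- rewrite big_enum_val (reindex (cast_ord e)) //.
  by exists (cast_ord (esym e)) => i _; [apply: cast_ordK | apply: cast_ordKV].
Qed.

Section MatrixUnits.
Variables (F : fieldType) (E : falgType F) (tau : E -> F).
Hypothesis tau_lin : linear (tau : E -> F^o).
Hypothesis tauC : forall x y, tau (x * y) = tau (y * x).
Hypothesis nondeg : forall x, (forall y, tau (x * y) = 0) -> x = 0.
Variables (N : nat) (e : 'I_N -> E).
Hypothesis e_corner : forall i, corner_idem (e i).
Hypothesis e_orth : forall i j, i != j -> e i * e j = 0.
Hypothesis e_sum : \sum_i e i = 1.
Implicit Types (i j k : 'I_N) (x y f : E).

Lemma tauZ a x : tau (a *: x) = a * tau x.
Proof.
have t0 : tau 0 = 0.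
  by apply: (addrI (tau 0)); have := tau_lin 1 0 0; rewrite !scale1r !addr0.
by have := tau_lin a x 0; rewrite t0 !addr0.
Qed.
Lemma tau_sum I r (Q : pred I) (G : I -> E) :
  tau (\sum_(i <- r | Q i) G i) = \sum_(i <- r | Q i) tau (G i).
Proof.
apply: (big_morph tau) => [x y|].
  by have := tau_lin 1 x y; rewrite !scale1r.
by rewrite -(scale0r 0) tauZ mul0r.
Qed.

Lemma e_neq0 i : e i != 0. Proof. by case: (e_corner i). Qed.
Lemma e_idem i : e i * e i = e i. Proof. by case: (e_corner i). Qed.

Lemma e_scalar i : scalar_corner (e i). Proof. by case: (e_corner i). Qed.

Definition coef i x : F := projT1 (cid (e_scalar i x)).
Lemma coefP i x : e i * x * e i = coef i x *: e i.
Proof. exact: projT2 (cid (e_scalar i x)). Qed.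
(** Opposite non-zero Peirce components e_i E e_j are dual lines: an element of
    the first one has an inverse in the second one, because of the trace form. *)
Lemma corner_inverse i j x : x != 0 -> e i * x = x -> x * e j = x ->
  exists y, [/\ e j * y = y, y * e i = y, x * y = e i & y * x = e j].
Proof.
move=> x0 ix xj.
have [z tz] : exists z, tau (x * z) != 0.
  apply: contrapT => no; move/eqP: x0; apply; apply: nondeg => z.
  by apply: contrapT => /eqP tz; apply: no; exists z.
pose y := e j * z * e i.
have jy : e j * y = y by rewrite /y !mulrA e_idem.
have yi : y * e i = y by rewrite /y -!mulrA e_idem.
have xyE : x * y = e i * (x * z) * e i by rewrite /y !mulrA xj ix.
have yE : e j * z * e i = y by [].
clearbody y.
pose a := coef i (x * z); have xy : x * y = a *: e i by rewrite xyE coefP.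
have a0 : a != 0.
  apply: contra_neq tz => a0.
  rewrite -{1}ix -{1}xj -!mulrA tauC -!mulrA.
  by rewrite [e j * _]mulrA yE xy a0 tauZ mul0r.
have yx : y * x = a *: e j.
  have yxE : y * x = e j * (y * x) * e j by rewrite !mulrA jy -mulrA xj.
  rewrite yxE coefP; congr (_ *: _); set c := coef _ _.
  have : c *: x = a *: x.
    rewrite -{2}ix scalerAl -xy -mulrA yxE coefP -/c -scalerAr xj //.
  by move/eqP; rewrite -subr_eq0 -scalerBl scaler_eq0 (negPf x0) orbF subr_eq0 => /eqP.
exists (a^-1 *: y); split.
- by rewrite -scalerAr jy.
- by rewrite -scalerAl yi.
- by rewrite -scalerAr xy scalerA mulVf // scale1r.
- by rewrite -scalerAl yx scalerA mulVf // scale1r.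
Qed.

(** The right ideals e_i E and e_j E are isomorphic; the classes of this relation
    are the simple factors. *)
Definition linked i j : bool := `[< exists x, e i * x * e j != 0 >].

Lemma linkedP i j : linked i j ->
  exists x y, [/\ e i * x = x, x * e j = x, e j * y = y, y * e i = y &
                  x * y = e i /\ y * x = e j].
Proof.
move=> /asboolP[x0 nx]; pose x := e i * x0 * e j.
have ix : e i * x = x by rewrite /x !mulrA e_idem.
have xj : x * e j = x by rewrite /x -!mulrA e_idem.
by have [y [jy yi xy yx]] := corner_inverse nx ix xj; exists x, y.
Qed.

Lemma linked_refl i : linked i i.
Proof. by apply/asboolP; exists 1; rewrite mulr1 e_idem e_neq0. Qed.
Lemma linked_sym i j : linked i j -> linked j i.
Proof.
move=> /linkedP[x [y [ix xj jy yi [xy _]]]]; apply/asboolP; exists y.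
by rewrite jy yi; apply: contra_neq (e_neq0 i) => y0; rewrite -xy y0 mulr0.
Qed.
Lemma linked_trans i j k : linked i j -> linked j k -> linked i k.
Proof.
move=> /linkedP[x [y [ix xj _ _ [xy _]]]] /linkedP[x' [y' [_ x'k _ _ [xy' _]]]].
apply/asboolP; exists (x * x'); rewrite mulrA ix -mulrA x'k.
apply: contra_neq (e_neq0 i) => xx0; rewrite -xy -xj -xy' mulrA -!mulrA.
by rewrite [x * _]mulrA xx0 mul0r.
Qed.

(** As [linked i] only depends on the class of i, the choice made by [pick] is a
    representative of this class. *)
Definition rep i : 'I_N := odflt i [pick j | linked i j].
Lemma linked_rep i : linked i (rep i).
Proof. by rewrite /rep; case: pickP => //= _; apply: linked_refl. Qed.
Lemma rep_linked i j : linked i j -> rep i = rep j.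
Proof.
move=> ij; have e_ij : linked i =1 linked j.
  move=> k; apply/idP/idP => [ik|jk]; last exact: linked_trans ij jk.
  exact: linked_trans (linked_sym ij) ik.
rewrite /rep (eq_pick e_ij); case: pickP => //= /(_ j).
by rewrite linked_refl.
Qed.
Lemma rep_id i : rep (rep i) = rep i.
Proof. by rewrite -(rep_linked (linked_rep i)). Qed.

(** Mutually inverse elements of e_i E e_r and of e_r E e_i, where r = rep i: the
    products [ux i * uy j], for i and j in the same class, are matrix units. *)
Definition ux i : E := projT1 (cid (linkedP (linked_rep i))).
Definition uy i : E := projT1 (cid (projT2 (cid (linkedP (linked_rep i))))).
Lemma unitsP i :
  [/\ e i * ux i = ux i, ux i * e (rep i) = ux i, e (rep i) * uy i = uy i,
      uy i * e i = uy i & ux i * uy i = e i /\ uy i * ux i = e (rep i)].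
Proof. exact: projT2 (cid (projT2 (cid (linkedP (linked_rep i))))). Qed.

Lemma e_uxE i : e i * ux i = ux i. Proof. by case: (unitsP i). Qed.
Lemma ux_eE i : ux i * e (rep i) = ux i. Proof. by case: (unitsP i). Qed.
Lemma e_uyE i : e (rep i) * uy i = uy i. Proof. by case: (unitsP i). Qed.
Lemma uy_eE i : uy i * e i = uy i. Proof. by case: (unitsP i). Qed.
Lemma ux_uy i : ux i * uy i = e i. Proof. by case: (unitsP i) => _ _ _ _ []. Qed.
Lemma uy_ux i j : uy i * ux j = if i == j then e (rep i) else 0.
Proof.
case: eqVneq => [<-|ij]; first by case: (unitsP i) => _ _ _ _ [].
by rewrite -(uy_eE i) -(e_uxE j) mulrA -(mulrA (uy i)) e_orth // mulr0 mul0r.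
Qed.
Lemma e_unlinked i f j : rep i != rep j -> e i * f * e j = 0.
Proof.
move=> nij; apply/eqP; apply: contraNT nij => nz; apply/eqP/rep_linked.
by apply/asboolP; exists f.
Qed.

(** The coefficient of the matrix unit [ux i * uy j] in f. *)
Definition entry i j f : F := coef (rep i) (uy i * f * ux j).

Lemma entryP i j f : rep i = rep j -> uy i * f * ux j = entry i j f *: e (rep i).
Proof.
move=> rij; rewrite -coefP !mulrA e_uyE.
by rewrite -[in RHS]mulrA rij ux_eE.
Qed.
Lemma entryE i j f a :
  rep i = rep j -> uy i * f * ux j = a *: e (rep i) -> entry i j f = a.
Proof.
move=> rij; rewrite entryP // => /eqP.
rewrite -subr_eq0 -scalerBl scaler_eq0 (negPf (e_neq0 _)) orbF subr_eq0.
by move/eqP.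
Qed.

Lemma entry_linear i j a f g : rep i = rep j ->
  entry i j (a *: f + g) = a * entry i j f + entry i j g.
Proof.
move=> rij; apply: entryE => //.
by rewrite mulrDr mulrDl -scalerAr -scalerAl !entryP // scalerDl scalerA.
Qed.

Lemma entry1 i j : rep i = rep j -> entry i j 1 = (i == j)%:R.
Proof.
move=> rij; apply: entryE => //; rewrite mulr1 uy_ux.
by case: eqP; rewrite ?scale1r ?scale0r.
Qed.

Lemma entryM i k f g : rep i = rep k ->
  entry i k (f * g) = \sum_(j | rep j == rep i) entry i j f * entry j k g.
Proof.
move=> rik; apply: entryE => //; rewrite mulrA -[uy i * f]mulr1 -e_sum.
rewrite mulr_sumr !mulr_suml scaler_suml.
rewrite (bigID (fun j => rep j == rep i)) /= [X in _ + X]big1 ?addr0.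
  apply: eq_bigr => j /eqP rj; rewrite -ux_uy !mulrA entryP //.
  rewrite -!mulrA [uy j * _]mulrA entryP ?rj // -scalerAl -scalerAr e_idem.
  by rewrite scalerA.
move=> j nij; rewrite -(uy_eE i) -(mulrA (uy i)) -(mulrA (uy i) _ (e j)).
by rewrite e_unlinked 1?eq_sym // mulr0 !mul0r.
Qed.

Lemma entries_inj f g :
  (forall i j, rep i = rep j -> entry i j f = entry i j g) -> f = g.
Proof.
have ijE i j h : rep i = rep j -> e i * h * e j = entry i j h *: (ux i * uy j).
  move=> rij; rewrite -!ux_uy !mulrA -(mulrA (ux i)) -(mulrA (ux i) _ (ux j)).
  by rewrite entryP // -scalerAr -scalerAl ux_eE.
have sumE h : h = \sum_i \sum_j e i * h * e j.
  rewrite -[LHS]mul1r -[LHS]mulr1 -e_sum mulr_suml mulr_suml; apply: eq_bigr => i _.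
  by rewrite mulr_sumr.
move=> fg; rewrite (sumE f) (sumE g); apply: eq_bigr => i _; apply: eq_bigr => j _.
have [rij|rij] := eqVneq (rep i) (rep j); first by rewrite !ijE ?fg.
by rewrite !e_unlinked.
Qed.

Lemma entry_unit i j k l : rep i = rep j -> rep k = rep l ->
  entry i j (ux k * uy l) = ((i == k) && (l == j))%:R.
Proof.
move=> rij rkl; apply: entryE => //.
rewrite mulrA -mulrA !uy_ux; case: eqP => [->|_]; last by rewrite mul0r scale0r.
by case: eqP; rewrite /= ?mulr0 ?scale0r // rkl e_idem scale1r.
Qed.

Lemma tau_entries f : tau f = \sum_i tau (e (rep i)) * entry i i f.
Proof.
rewrite -[f in LHS]mulr1 -e_sum mulr_sumr tau_sum; apply: eq_bigr => i _.
by rewrite -ux_uy mulrA tauC mulrA entryP // tauZ mulrC.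
Qed.
End MatrixUnits.

(** * The structure theorem *)

Section Wedderburn.
Variables (F : fieldType) (E : falgType F) (tau : E -> F).
Hypothesis closedF : GRing.closed_field_axiom F.
Hypothesis tau_lin : linear (tau : E -> F^o).
Hypothesis tauC : forall x y, tau (x * y) = tau (y * x).
Hypothesis nondeg : forall x, (forall y, tau (x * y) = 0) -> x = 0.
Hypothesis nilp : forall x m, x ^+ m = 0 -> tau x = 0.

Lemma corner_family : exists N (e : 'I_N -> E),
  [/\ forall i, corner_idem (e i), forall i j, i != j -> e i * e j = 0 &
      \sum_i e i = 1].
Proof.
have [s [s1 _ s3 s4]] := corner_decomposition closedF nondeg nilp (mulr1 1).
exists (size s), (fun i => s`_i); split=> [i|i j ij|].
- exact/s1/mem_nth.
- have /(pairwiseP 0) pw := s3.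
  case: (ltngtP i j) => [lt|lt|/val_inj eij]; last by rewrite eij eqxx in ij.
    by have /andP[/eqP] := pw i j (ltn_ord i) (ltn_ord j) lt.
  by have /andP[_ /eqP] := pw j i (ltn_ord j) (ltn_ord i) lt.
- by rewrite -s4 [RHS](big_nth 0) big_mkord.
Qed.

(** The k-th factor corresponds to the k-th class of linked idempotents, and d k is
    the representative of this class. *)
Theorem wedderburn_trace :
  exists r (n : 'I_r -> nat) (phi : forall k, E -> 'M[F]_((n k).+1)) (d : 'I_r -> E),
    [/\ forall k, linear (phi k), forall k, monoid_morphism (phi k),
        forall b : (forall k, 'M[F]_((n k).+1)), exists! f, forall k, phi k f = b k,
        forall f, tau f = \sum_k tau (d k) * \tr (phi k f) &
        forall k, d k * d k = d k].
Proof.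
have [N [e [e_corner e_orth e_sum]]] := corner_family.
pose rp := rep e; pose ent := entry tau_lin tauC nondeg e_corner.
have rp_id i : rp (rp i) = rp i by exact: rep_id.
have ent_rp i j f : rp i = rp j -> uy tau_lin tauC nondeg e_corner i * f *
    ux tau_lin tauC nondeg e_corner j = ent i j f *: e (rp i).
  exact: entryP.
pose R := [set rp i | i : 'I_N]; pose r := #|R|.
pose c (k : 'I_r) : 'I_N := enum_val k.
have rc k : rp (c k) = c k.
  by have /imsetP[i _ ->] : c k \in R by exact: enum_valP.
pose S k := [set i | rp i == c k].
have cS k : c k \in S k by rewrite inE rc.
pose n k := projT1 (cid (enum_nonempty (cS k))).
pose ix k : 'I_(n k).+1 -> 'I_N := projT1 (cid (projT2 (cid (enum_nonempty (cS k))))).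
have ixP k : [/\ injective (ix k), forall a, ix k a \in S k,
    forall i, i \in S k -> exists a, i = ix k a &
    forall (V : nmodType) (G : 'I_N -> V),
      \sum_(i in S k) G i = \sum_a G (ix k a)].
  exact: projT2 (cid (projT2 (cid (enum_nonempty (cS k))))).
have ix_inj k : injective (ix k) by case: (ixP k).
have rix k a : rp (ix k a) = c k.
  by have [_ /(_ a)] := ixP k; rewrite inE => /eqP.
have rixx k a b : rp (ix k a) = rp (ix k b) by rewrite !rix.
have ix_sum k (V : nmodType) (G : 'I_N -> V) :
    \sum_(i | rp i == c k) G i = \sum_a G (ix k a).
  by have [_ _ _ <-] := ixP k; apply: eq_bigl => i; rewrite inE.
have ix_surj i : exists k a, i = ix k a.
  have riR : rp i \in R by exact: imset_f.
  have ci : c (enum_rank_in riR (rp i)) = rp i by exact: enum_rankK_in.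
  have [_ _ + _] := ixP (enum_rank_in riR (rp i)) => /(_ i).
  rewrite inE ci eqxx => /(_ isT)[a ->]; by eexists; exists a.
have c_inj : injective c by exact: enum_val_inj.
have entD i j (f g : E) : rp i = rp j -> ent i j (f + g) = ent i j f + ent i j g.
  by move=> rij; rewrite -[f]scale1r /ent entry_linear // mul1r scale1r.
have ent0 i j : rp i = rp j -> ent i j 0 = 0.
  by move=> rij; apply: (addrI (ent i j 0)); rewrite -entD // !addr0.
have ent_sum i j (I : finType) (G : I -> E) : rp i = rp j ->
    ent i j (\sum_a G a) = \sum_a ent i j (G a).
  move=> rij; elim/big_rec2: _ => [|a x y _ <-]; first exact: ent0.
  exact: entD.
have entZ i j a (f : E) : rp i = rp j -> ent i j (a *: f) = a * ent i j f.
  move=> rij; rewrite -[_ *: _]addr0 /ent entry_linear //.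
  by rewrite -/ent ent0 // addr0.
pose phi k f : 'M[F]_((n k).+1) := \matrix_(a, b) ent (ix k a) (ix k b) f.
exists r, n, phi, (fun k => e (c k)); split.
- move=> k a f g; apply/matrixP => p q; rewrite !mxE.
  exact: entry_linear.
- move=> k; split=> [|f g].
    apply/matrixP => p q; rewrite !mxE /ent entry1 //.
    by rewrite (inj_eq (ix_inj k)).
  apply/matrixP => p q; rewrite !mxE /ent entryM // -/ent.
  by rewrite -/rp rix ix_sum; apply: eq_bigr => a _; rewrite !mxE.
- move=> b.
  pose u := ux tau_lin tauC nondeg e_corner; pose v := uy tau_lin tauC nondeg e_corner.
  pose f0 := \sum_k \sum_p \sum_q b k p q *: (u (ix k p) * v (ix k q)).
  have phi0 k : phi k f0 = b k.
    apply/matrixP => p q; have hpq := rixx k p q.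
    rewrite mxE ent_sum // (bigD1 k) //= [X in _ + X]big1 ?addr0.
      rewrite ent_sum // (bigD1 p) //= [X in _ + X]big1 ?addr0.
        rewrite ent_sum // (bigD1 q) //= [X in _ + X]big1 ?addr0.
          by rewrite entZ // /ent entry_unit // !eqxx mulr1.
        move=> q' /negPf qq'; have h' := rixx k p q'; rewrite entZ // /ent entry_unit //.
        by rewrite !(inj_eq (ix_inj k)) qq' andbF mulr0.
      move=> p' /negPf pp'; rewrite ent_sum // big1 // => q' _.
      have h' := rixx k p' q'; rewrite entZ // /ent entry_unit //.
      by rewrite !(inj_eq (ix_inj k)) eq_sym pp' mulr0.
    move=> k' kk'; rewrite ent_sum // big1 // => p' _.
    rewrite ent_sum // big1 // => q' _.
    have h' := rixx k' p' q'; rewrite entZ // /ent entry_unit //.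
    case: eqP => [/(congr1 rp)|]; last by rewrite mulr0.
    by rewrite !rix => /c_inj ekk; rewrite ekk eqxx in kk'.
  exists f0; split=> // g bg.
  apply: (entries_inj e_sum (tau_lin := tau_lin) (tauC := tauC)
    (nondeg := nondeg) (e_corner := e_corner)) => i j rij.
  have [k [p ip]] := ix_surj i; have [k' [q jq]] := ix_surj j.
  have ekk : k' = k by apply: c_inj; rewrite -(rix k p) -(rix k' q) -ip -jq.
  move: q jq; rewrite ekk => q jq.
  by have /matrixP/(_ p q) := etrans (phi0 k) (esym (bg k)); rewrite !mxE ip jq.
- move=> f; rewrite (tau_entries tau_lin tauC nondeg e_corner e_sum).
  rewrite (partition_big rp (mem R)) /=; last by move=> i _; apply: imset_f.
  rewrite big_enum_val; apply: eq_bigr => k _; rewrite ix_sum mulr_sumr.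
  by apply: eq_bigr => a _; rewrite -/rp rix mxE.
- by move=> k; apply: e_idem.
Qed.
End Wedderburn.

(** * Integrality *)

Section MatrixAlgebra.
Variables (F : fieldType) (n : nat).
Local Notation B := 'M[F]_n.+1.

Lemma sandwich_delta (X : B) a i j b :
  delta_mx a i * X * delta_mx j b = X i j *: delta_mx a b.
Proof.
have e : delta_mx (0 : 'I_1) i *m X *m delta_mx j (0 : 'I_1) = (X i j)%:M.
  by apply/matrixP => k l; rewrite -rowE -colE !ord1 !mxE eqxx mulr1n.
rewrite -(mul_delta_mx (0 : 'I_1) a i) -(mul_delta_mx (0 : 'I_1) j b).
rewrite -[LHS]/(_ *m _ *m _ *m _) -!mulmxA (mulmxA (delta_mx 0 i)).
rewrite (mulmxA _ (delta_mx j 0)) e mul_scalar_mx -scalemxAr.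
by rewrite mul_delta_mx.
Qed.

Lemma mx_simple : simple_algebra (B : falgType F).
Proof.
move=> I lI rI; have [->|I0] := eqVneq I 0%VS; first by left.
right; apply/eqP; rewrite eqEsubv subvf /=; apply/subvP => X _.
have [i [j nz]] : exists i j, vpick I i j != 0.
  apply: contrapT => no; move/negP: I0; apply; rewrite -vpick0; apply/eqP.
  apply/matrixP => i j; rewrite mxE; apply: contrapT => /eqP nz.
  by apply: no; exists i, j.
have deltaI a b : delta_mx a b \in I.
  have -> : delta_mx a b = (vpick I i j)^-1 *:
      ((delta_mx a i : B) * vpick I * delta_mx j b).
    by rewrite sandwich_delta scalerA mulVf // scale1r.
  apply/memvZ/(subvP rI)/memv_mul; last exact: memvf.
  by apply/(subvP lI)/memv_mul; [exact: memvf | exact: memv_pick].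
rewrite (matrix_sum_delta X); apply: memv_suml => a _; apply: memv_suml => b _.
exact: memvZ.
Qed.

Lemma mx_center : 'Z({:B})%VS = <[1 : B]>%VS.
Proof.
apply/eqP; rewrite eqEsubv; apply/andP; split; apply/subvP => X.
  rewrite memv_cap => /andP[_ /centvP XC].
  have XE k i j : X k i = (k == i)%:R * X j j.
    have /matrixP/(_ k j) := XC (delta_mx i j) (memvf _).
    rewrite -[LHS]/((X *m delta_mx i j) k j) -[RHS]/((delta_mx i j *m X) k j) !mxE.
    rewrite (bigD1 i) //= big1 ?addr0 => [|l li]; last first.
      by rewrite !mxE (negPf li) mulr0.
    rewrite mxE !eqxx mulr1 => ->.
    rewrite (bigD1 j) //= big1 ?addr0 => [|l lj]; last first.
      by rewrite !mxE (negPf lj) andbF mul0r.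
    by rewrite mxE eqxx andbT.
  apply/vlineP; exists (X ord0 ord0); apply/matrixP => k i.
  by rewrite (XE k i ord0) !mxE mulrC.
move=> /vlineP[a ->]; rewrite memv_cap memvf /=; apply/centvP => Y _.
by rewrite -scalerAl -scalerAr mul1r mulr1.
Qed.

Lemma scalar_in_center (a : F) : (a%:M : B) \in 'Z({:B})%VS.
Proof. by rewrite mx_center; apply/vlineP; exists a; rewrite scalemx1. Qed.

Lemma mx_center_trace (a : F) : center_trace (a%:M : B) = a.
Proof.
rewrite /center_trace /=.
have dZ : \dim 'Z({:B})%VS = 1%N by rewrite mx_center dim_vline oner_neq0.
transitivity (\sum_(i < \dim 'Z({:B})%VS) a); last first.
  by rewrite sumr_const card_ord dZ mulr1n.
apply: eq_bigr => i _.
have -> : (a%:M : B) * (vbasis 'Z({:B})%VS)`_i = a *: (vbasis 'Z({:B})%VS)`_i.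
  exact: mul_scalar_mx.
rewrite linearZ /= coord_free ?eqxx ?mulr1 //.
exact: basis_free (vbasisP _).
Qed.

(** The matrix algebra is split by its own centre, through the identity. *)
Lemma mx_reduced_trace : is_Trd (fun X : B => \tr X).
Proof.
exists (fun X : B => (\tr X)%:M : B) => [|X]; last by rewrite mx_center_trace.
exists F, n.+1, idfun; split=> [|X]; last by split; [exact: scalar_in_center|].
split=> [z|].
  rewrite mx_center => /vlineP[a ->].
  have -> : a *: (1 : B) = a%:M by exact: scalemx1.
  exact: scalar_mx_is_scalar.
rewrite mx_center dim_vline oner_neq0 muln1 dimvf /dim /=.
by [].
Qed.
End MatrixAlgebra.

Section EndoAlgebra.
Variables (F : fieldType) (A : linCat F) (X : A).
Hypothesis nonzero : (1 : endo X) != 0.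
Variable N : nat.
Hypothesis findim : Vector.axiom N (endo X).

(** The endomorphism ring with an algebra structure, which depends on the proofs
    that it is not zero and has finite dimension. *)
Definition endo_alg of (1 : endo X) != 0 & Vector.axiom N (endo X) : Type :=
  endo X.
Local Notation E := (endo_alg nonzero findim).
HB.instance Definition _ := GRing.PzRing.on E.
HB.instance Definition _ := GRing.Lmodule.on E.
HB.instance Definition _ := GRing.PzSemiRing_isNonZero.Build E nonzero.
HB.instance Definition _ := GRing.Lmodule_isLalgebra.Build F E
  (fun a u v => esym (compZl a (u : hom X X) v)).
HB.instance Definition _ := GRing.Lalgebra_isAlgebra.Build F E
  (fun a u v => esym (compZr a (u : hom X X) v)).
HB.instance Definition _ := Lmodule_hasFinDim.Build F E findim.
HB.instance Definition _ := Algebra_isFalgebra.Build F E.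
End EndoAlgebra.

Section Integrality.
Variables (F : fieldType) (B : rigidCat F) (M : B).
Hypothesis closedF : GRing.closed_field_axiom F.
Hypothesis etr_comm : forall u v : endo M, etr (u * v) = etr (v * u).
Hypothesis etr_idem : forall u : endo M, u * u = u ->
  exists z : int, etr u = z%:~R.
Hypothesis etr_nilp : forall (u : endo M) m, u ^+ m = 0 -> etr u = 0.
Variables (m : nat) (f g : 'I_m -> endo M).
Hypothesis fg : forall i j, etr (f i * g j) = (i == j)%:R.
Hypothesis span : forall u, u = \sum_j etr (u * g j) *: f j.

Lemma dual_bases_findim : Vector.axiom m (endo M).
Proof.
exists (fun u => \row_j etr (u * g j)).
  move=> a u v; apply/rowP => j.
  by rewrite !mxE mulrDl endo_scaleAl etrD etrZ.
exists (fun w : 'rV_m => \sum_j w 0 j *: f j) => [u|w].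
  by rewrite [RHS]span; apply: eq_bigr => j _; rewrite mxE.
apply/rowP => j; rewrite mxE mulr_suml etr_sum (bigD1 j) //= big1 ?addr0.
  by rewrite endo_scaleAl etrZ fg eqxx mulr1.
by move=> i /negPf ij; rewrite endo_scaleAl etrZ fg ij mulr0.
Qed.

(** The multiplicities are the traces of the idempotents d k of [wedderburn_trace];
    an object with zero endomorphism ring has no simple factor at all. *)
Lemma integral_type_from_trace : integral_type M.
Proof.
have nondeg (u : endo M) : (forall v, etr (u * v) = 0) -> u = 0.
  move=> u0; rewrite [u]span big1 // => j _.
  by rewrite u0 scale0r.
have [M0|M1] := eqVneq (1 : endo M) 0.
  have all0 (u : endo M) : u = 0 by rewrite -[u]mulr1 M0 mulr0.
  pose B0 (i : 'I_0) : falgType F := 'M[F]_1.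
  have abs (i : 'I_0) (P : Prop) : P by case: i.
  exists 0%N, B0, (fun i _ => 0), (fun i => 0); split; [split|split|].
  - by move=> i; apply: abs i _.
  - by move=> i; apply: abs i _.
  - by move=> i; apply: abs i _.
  - move=> b; exists 0; split=> [i|u _]; first exact: abs i _.
    by rewrite (all0 u).
  - by move=> i; apply: abs i _.
  - exists (fun i _ => 0) => [i|u]; first exact: abs i _.
    by rewrite big_ord0 (all0 u); exact: (etr0 M).
  - by move=> i; apply: abs i _.
pose E : falgType F := endo_alg M1 dual_bases_findim.
have tl : linear (@etr F B M : E -> F^o) by exact: tr_linear.
have [r [n [phi [d [phi_lin phi_mul phi_bij phi_tr d_idem]]]]] :=
  @wedderburn_trace F E (@etr F B M) closedF tl etr_comm nondeg etr_nilp.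
exists r, (fun k => 'M[F]_((n k).+1) : falgType F), phi.
exists (fun k => (etr (d k : endo M))%:M); split; [split|split|].
- by move=> k; exact: mx_simple.
- exact: phi_lin.
- exact: phi_mul.
- exact: phi_bij.
- by move=> k; exact: scalar_in_center.
- exists (fun k X => \tr X) => [k|u]; first exact: mx_reduced_trace.
  rewrite [LHS]phi_tr; apply: eq_bigr => k _.
  by rewrite -[RHS]/(\tr (_ *m _)) mul_scalar_mx mxtraceZ.
- move=> k; have [z dz] := etr_idem (d_idem k); exists z.
  by rewrite [etr _]dz -[RHS](rmorph_int (@scalar_mx F (n k).+1)).
Qed.
End Integrality.

Theorem geometrically_integral_origin (K : fieldType) (A : rigidCat K) :
  homological_origin A -> geometrically_integral_cat A.
Proof.
move=> Aho M Kb kappa [closedKb alg].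
pose C := scalext_change kappa A.
pose inn (f : endo M) : endo (M : scalext_rigid kappa A) := cmor C f.
have innM f g : inn (f * g) = inn f * inn g by exact: cmorM.
have inn1 : inn 1 = 1 by [].
have inn_lin : semilin kappa inn by exact: (cpi_semilin C).
have etr_inn f : etr (inn f) = kappa (etr f) by exact: tr_cmor.
have inn_ind (Q : endo (M : scalext_rigid kappa A) -> Prop) :
    Q 0 -> (forall a f u, Q u -> Q (a *: inn f + u)) -> forall u, Q u.
  exact: (@cpi_ind _ _ _ _ C).
have [m [f [g [fg span]]]] := dual_bases_ext Aho innM inn_lin etr_inn inn_ind.
apply: (integral_type_from_trace closedKb _ _ _ fg span).
- exact: (etrC_ext Aho innM etr_inn inn_ind).
- exact: (etr_idempotent Aho alg innM inn1 inn_lin etr_inn inn_ind).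
- exact: (etr_nilpotent Aho alg innM inn1 inn_lin etr_inn inn_ind).
Qed.

Theorem theorem4p6 (K : fieldType) (charK : [pchar K] =i pred0)
    (A : rigidCat K) (Ass : semisimple_cat A) (Aho : homological_origin A) :
  (forall M : A, schur_finite M) /\ geometrically_integral_cat A.
Proof.
by split; [exact: schur_finite_origin | exact: geometrically_integral_origin].
Qed.
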